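(* Let $G$ be a real reductive Lie group, let $\pi$ be in $\mathrm{Rep}^{\infty,F}(G)$, let $P$ be a parabolic subgroup of $G$ with unipotent radical $N_P$, and let $\mathfrak n=\mathrm{Lie}(N_P)$. Then: (1) $\overline{\mathfrak n.\mathbf{CJ}_{s,P}^{\infty}(\pi)}=\mathbf{CJ}_{s,P}^{\infty}(\pi)$. (2) The natural map $\pi\to\mathbf{CJ}_P^{\infty}(\pi)$ is surjective, and hence there is a strict short exact sequence $$0\to \mathbf{CJ}^{\infty}_{s,P}(\pi)\to\pi\to\mathbf{CJ}^{\infty}_P(\pi)\to 0 .$$ (3) For any epimorphism $f:\pi_1\to\pi_2$ in $\mathrm{Rep}^{\infty,F}(G)$, the maps $\mathbf{CJ}_P^{\infty}(f)$ and $\mathbf{CJ}_{s,P}^{\infty}(f)$ are also epimorphisms. For any surjective morphism $f:\pi_1\to\pi_2$ in $\mathrm{Rep}^{\infty,F}(G)$, $\mathbf{CJ}_P^{\infty}(f)$ is also surjective. (4) If $Q$ is a parabolic subgroup of $G$ with $Q\subset P$, then $\mathbf{CJ}^{\infty}_Q\circ\mathbf{CJ}^{\infty}_P(\pi)\cong\mathbf{CJ}^{\infty}_Q(\pi)$.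
   Context: Fix an algebraic scale $\|\cdot\|_G$ on $G$, e.g. $\|g\|_G=\mathrm{tr}(\rho(g)\rho(g)^* )+\mathrm{tr}(\rho(g^{-1})\rho(g^{-1})^* )$ for a finite-dimensional representation $\rho$ of $G$ with finite kernel and closed image. For a closed subgroup $H\subset G$, $\mathrm{Rep}^{\infty,F}(H)$ is the category of smooth Fréchet representations of $H$ of moderate growth: complex Fréchet spaces $\pi$ with a continuous linear action $H\times\pi\to\pi$ such that every orbit map is smooth and such that for every continuous seminorm $p_1$ on $\pi$ there are an integer $r\ge 0$ and a continuous seminorm $p_2$ with $p_1(h.v)\le \|h\|_G^r\,p_2(v)$ for all $h\in H$, $v\in\pi$; morphisms are continuous $H$-equivariant linear maps. A morphism is an epimorphism iff it has dense image. A morphism is strict if its image is closed; a short exact sequence is strict if all its morphisms are strict (so the first map is injective with closed image, the second is surjective, and the image of the first is the kernel of the second). $\mathfrak n^k.\pi$ is the linear span of all $X_1\cdots X_k.v$ with $X_i\in\mathfrak n$, $v\in\pi$ ($\mathfrak n^0.\pi=\pi$); closures are taken in $\pi$. Define $$\mathbf{CJ}^{\infty}_{s,P}(\pi)=\bigcap_{k=0}^{\infty}\overline{\mathfrak n^k.\pi}\ \text{(subspace topology)},\qquad \mathbf{CJ}^{\infty}_P(\pi)=\varprojlim_k \pi/\overline{\mathfrak n^k.\pi}\ \text{(inverse limit topology)},$$ both regarded as representations of $P$ and functorial in $\pi$. In (4), $\mathbf{CJ}^{\infty}_Q$ is applied to the $P$-representation $\mathbf{CJ}_P^\infty(\pi)$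 by the same formula, using $\mathrm{Lie}(N_Q)\subset\mathrm{Lie}(P)$; the isomorphism is one of topological $Q$-representations. *)

(* Defs.v *)
From HB Require Import structures.
From mathcomp Require Import all_boot all_order all_algebra.
From mathcomp Require Import all_classical all_reals all_analysis.
From mathcomp Require Import complex.
(* not imported: the notations of mpoly clash with those of analysis *)
From mathcomp Require mpoly.

Set Implicit Arguments.
Unset Strict Implicit.
Unset Printing Implicit Defensive.

Import Order.TTheory GRing.Theory Num.Theory numFieldNormedType.Exports.

Local Open Scope classical_set_scope.
Local Open Scope ring_scope.

Lemma continuous_comp2 (T X Y Z : topologicalType) (f : T -> X) (g : T -> Y)
    (h : X * Y -> Z) :
  continuous f -> continuous g -> continuous h ->
  continuous (fun t => h (f t, g t)).
Proof.
move=> cf cg ch t A /ch [[B C]/= [fB gC] BC].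
have : nbhs t (f @^-1` B `&` g @^-1` C) by apply: filterI; [exact: cf|exact: cg].
by apply: filterS => u [fu gu]; exact: (BC (f u, g u)).
Qed.

(** ** Subspaces, quotients and products of topological vector spaces *)

Section SubSpace.
Context (K : numDomainType) (V : topologicalLmodType K).

Definition sub_space (S : submodClosed V) : Type := {v : V | v \in S}.

Variable S : submodClosed V.
HB.instance Definition _ := SubType.copy (sub_space S) {v : V | v \in S}.
HB.instance Definition _ := [Choice of sub_space S by <:].
HB.instance Definition _ := [SubChoice_isSubLmodule of sub_space S by <:].
HB.instance Definition _ :=
  Topological.copy (sub_space S) (initial_topology (val : sub_space S -> V)).

Lemma sub_space_val_continuous : continuous (val : sub_space S -> V).
Proof. exact: (@initial_continuous (sub_space S) V val). Qed.

Lemma continuous_sub_space (T : topologicalType) (f : T -> sub_space S) :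
  continuous (val \o f) -> continuous f.
Proof. by move=> cf; apply: (@continuous_comp_initial (sub_space S) T V val f). Qed.

Lemma sub_space_add_continuous :
  continuous (fun x : sub_space S * sub_space S => x.1 + x.2).
Proof.
apply: continuous_sub_space.
have cv := sub_space_val_continuous.
apply: (continuous_comp2 (f := fun x : sub_space S * sub_space S => val x.1)
  (g := fun x : sub_space S * sub_space S => val x.2)
  _ _ (@add_continuous V)).
- by move=> x; apply: continuous_comp; [exact: cvg_fst|exact: cv].
- by move=> x; apply: continuous_comp; [exact: cvg_snd|exact: cv].
Qed.

Lemma sub_space_scale_continuous :
  continuous (fun z : K^o * sub_space S => z.1 *: z.2).
Proof.
apply: continuous_sub_space.
have cv := sub_space_val_continuous.
apply: (continuous_comp2 (f := fun x : K^o * sub_space S => x.1)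
  (g := fun x : K^o * sub_space S => val x.2)
  _ _ (@scale_continuous K V)).
- by move=> x; exact: cvg_fst.
- by move=> x; apply: continuous_comp; [exact: cvg_snd|exact: cv].
Qed.

HB.instance Definition _ := PreTopologicalNmodule_isTopologicalNmodule.Build
  (sub_space S) sub_space_add_continuous.
HB.instance Definition _ := TopologicalNmodule_isTopologicalLmodule.Build
  K (sub_space S) sub_space_scale_continuous.
End SubSpace.

Section QuotientSpace.
Local Open Scope quotient_scope.
Context (K : numDomainType) (V : topologicalLmodType K).

(* a linear subspace seen as an additive subgroup, as [Quotient.quot] wants it *)
Definition zmod_of (S : submodClosed V) : {pred V} := [pred v | v \in S].

Lemma zmod_of_zmod_closed (S : submodClosed V) : zmod_closed (zmod_of S).
Proof. exact: (submodClosedP S). Qed.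

HB.instance Definition _ (S : submodClosed V) :=
  GRing.isZmodClosed.Build V (zmod_of S) (zmod_of_zmod_closed S).

Definition quot_space (S : submodClosed V) : Type :=
  quotient_topology (Quotient.quot (zmod_of S)).

Variable S : submodClosed V.
Local Notation Q := (quot_space S).
HB.instance Definition _ := Topological.copy Q (quotient_topology (Quotient.quot (zmod_of S))).
HB.instance Definition _ := Quotient.copy Q (Quotient.quot (zmod_of S)).
HB.instance Definition _ := @GRing.isZmodule.Build Q _ _ _
  (@Quotient.addqA V (zmod_of S)) (@Quotient.addqC V (zmod_of S))
  (@Quotient.add0q V (zmod_of S)) (@Quotient.addNq V (zmod_of S)).

Definition qpi (v : V) : Q := \pi_(Quotient.quot (zmod_of S)) v.

Lemma qpi_surj (q : Q) : exists v, q = qpi v.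
Proof. by exists (repr q); rewrite /qpi reprK. Qed.

Lemma qpi_eq (v w : V) : (qpi v = qpi w) <-> v - w \in S.
Proof.
have e := @Quotient.idealrBE V (zmod_of S) v w.
rewrite [_ \in S]e; split=> [h|/eqP//]; exact/eqP.
Qed.

Lemma qpiD v w : qpi (v + w) = qpi v + qpi w.
Proof. exact: (@Quotient.pi_add V (zmod_of S)). Qed.

Definition qscale (a : K) (q : Q) : Q := qpi (a *: repr q).

Lemma qpiZ a v : qpi (a *: v) = qscale a (qpi v).
Proof.
rewrite /qscale; apply/qpi_eq; rewrite -scalerBr rpredZ//.
by apply/qpi_eq; rewrite /qpi reprK.
Qed.

Lemma qscaleA a b q : qscale a (qscale b q) = qscale (a * b) q.
Proof. by have [v ->] := qpi_surj q; rewrite -!qpiZ scalerA. Qed.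
Lemma qscale1 : left_id 1 qscale.
Proof. by move=> q; have [v ->] := qpi_surj q; rewrite -!qpiZ scale1r. Qed.
Lemma qscaleDr : right_distributive qscale +%R.
Proof.
move=> a p q; have [v ->] := qpi_surj p; have [w ->] := qpi_surj q.
by rewrite -qpiD -!qpiZ scalerDr qpiD.
Qed.
Lemma qscaleDl q : {morph qscale^~ q : a b / a + b}.
Proof. by move=> a b; have [v ->] := qpi_surj q; rewrite -!qpiZ scalerDl qpiD. Qed.

HB.instance Definition _ := GRing.Zmodule_isLmodule.Build K Q
  qscaleA qscale1 qscaleDr qscaleDl.

Lemma qpi_linear : linear qpi.
Proof. by move=> a v w; rewrite qpiD qpiZ. Qed.

HB.instance Definition _ := GRing.isLinear.Build K V Q _ qpi qpi_linear.

Lemma qpi_continuous : continuous qpi.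
Proof. exact: (@pi_continuous V (Quotient.quot (zmod_of S))). Qed.

Lemma qpi_nbhs (v : V) (A : set V) : nbhs v A -> nbhs (qpi v) (qpi @` A).
Proof.
rewrite nbhsE => -[B [oB Bv] BA].
rewrite nbhsE; exists (qpi @` B); last exact: image_subset.
split; last by exists v.
rewrite /open/= /quotient_open.
rewrite (_ : _ @^-1` _ = \bigcup_(w in [set w | w \in S]) (fun x => x - w) @^-1` B).
  apply: bigcup_open => w _; move: oB; apply: open_comp => x _.
  apply: (@continuous_comp _ (V * V)%type _ (fun x => (x, - w)) (fun y => y.1 + y.2)).
    by apply: cvg_pair; [exact: cvg_id|exact: cvg_cst].
  exact: add_continuous.
apply/seteqP; split=> [x /= [b Bb bx]|x /= [w wS Bxw]].
  exists (x - b); last by rewrite /= opprB addrC subrK.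
  by apply/qpi_eq; rewrite bx.
by exists (x - w) => //; apply/qpi_eq; rewrite addrAC subrr add0r -scaleN1r rpredZ.
Qed.

Lemma quot_space_add_continuous : continuous (fun x : Q * Q => x.1 + x.2).
Proof.
move=> [p q] A /=; have [v ->] := qpi_surj p; have [w ->] := qpi_surj q.
rewrite -qpiD => /qpi_continuous /(@add_continuous V (v, w)) [[B C]/= [Bv Cw] BC].
exists (qpi @` B, qpi @` C); first by split; exact: qpi_nbhs.
move=> [_ _]/= [[x Bx <-] [y Cy <-]]; rewrite -qpiD.
exact: (BC (x, y)).
Qed.

Lemma quot_space_scale_continuous : continuous (fun z : K^o * Q => z.1 *: z.2).
Proof.
move=> [a q] A /=; have [v ->] := qpi_surj q.
rewrite -[a *: _]qpiZ => /qpi_continuous /(@scale_continuous _ V (a, v)).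
move=> [[B C]/= [Bv Cw] BC].
exists (B, qpi @` C); first by split=> //; exact: qpi_nbhs.
move=> [b _]/= [Bb [y Cy <-]]; rewrite -[b *: _]qpiZ.
exact: (BC (b, y)).
Qed.

HB.instance Definition _ := PreTopologicalNmodule_isTopologicalNmodule.Build
  Q quot_space_add_continuous.
HB.instance Definition _ := TopologicalNmodule_isTopologicalLmodule.Build
  K Q quot_space_scale_continuous.
End QuotientSpace.

Section ProdSpace.
Context (K : numDomainType) (I : eqType) (V : I -> topologicalLmodType K).

Definition prod_space : Type := prod_topology V.
Local Notation P := prod_space.
HB.instance Definition _ := Topological.copy P (prod_topology V).

Definition pzero : P := fun i => 0.
Definition popp (x : P) : P := fun i => - x i.
Definition padd (x y : P) : P := fun i => x i + y i.
Definition pscale a (x : P) : P := fun i => a *: x i.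
Lemma paddA : associative padd.
Proof. by move=> x y z; apply: functional_extensionality_dep => i; exact: addrA. Qed.
Lemma paddC : commutative padd.
Proof. by move=> x y; apply: functional_extensionality_dep => i; exact: addrC. Qed.
Lemma padd0 : left_id pzero padd.
Proof. by move=> x; apply: functional_extensionality_dep => i; exact: add0r. Qed.
Lemma paddN : left_inverse pzero popp padd.
Proof. by move=> x; apply: functional_extensionality_dep => i; exact: addNr. Qed.
HB.instance Definition _ := GRing.isZmodule.Build P paddA paddC padd0 paddN.
Lemma pscaleA a b x : pscale a (pscale b x) = pscale (a * b) x.
Proof. by apply: functional_extensionality_dep => i; exact: scalerA. Qed.
Lemma pscale1 : left_id 1 pscale.
Proof. by move=> x; apply: functional_extensionality_dep => i; exact: scale1r. Qed.
Lemma pscaleDr : right_distributive pscale +%R.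
Proof. by move=> a x y; apply: functional_extensionality_dep => i; exact: scalerDr. Qed.
Lemma pscaleDl x : {morph pscale^~ x : a b / a + b}.
Proof. by move=> a b; apply: functional_extensionality_dep => i; exact: scalerDl. Qed.
HB.instance Definition _ := GRing.Zmodule_isLmodule.Build K P
  pscaleA pscale1 pscaleDr pscaleDl.

Lemma prod_space_proj_continuous i : continuous (fun x : P => x i).
Proof. exact: (@proj_continuous I V i). Qed.

Lemma continuous_prod_space (T : topologicalType) (f : T -> P) :
  (forall i, continuous (fun t => f t i)) -> continuous f.
Proof.
move=> cf t; apply/cvg_sup => i.
exact: (@continuous_comp_initial P T (V i) (fun x : P => x i) f (cf i) t).
Qed.

Lemma prod_space_add_continuous : continuous (fun x : P * P => x.1 + x.2).
Proof.
apply: continuous_prod_space => i.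
have cp := @prod_space_proj_continuous i.
apply: (continuous_comp2 (f := fun x : P * P => x.1 i)
  (g := fun x : P * P => x.2 i) _ _ (@add_continuous (V i))).
- by move=> x; apply: (@continuous_comp _ P (V i) fst (fun y : P => y i)); [exact: cvg_fst|exact: cp].
- by move=> x; apply: (@continuous_comp _ P (V i) snd (fun y : P => y i)); [exact: cvg_snd|exact: cp].
Qed.

Lemma prod_space_scale_continuous : continuous (fun z : K^o * P => z.1 *: z.2).
Proof.
apply: continuous_prod_space => i.
have cp := @prod_space_proj_continuous i.
apply: (continuous_comp2 (f := fun x : K^o * P => x.1)
  (g := fun x : K^o * P => x.2 i) _ _ (@scale_continuous K (V i))).
- by move=> x; exact: cvg_fst.
- by move=> x; apply: (@continuous_comp _ P (V i) snd (fun y : P => y i)); [exact: cvg_snd|exact: cp].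
Qed.

HB.instance Definition _ := PreTopologicalNmodule_isTopologicalNmodule.Build
  P prod_space_add_continuous.
HB.instance Definition _ := TopologicalNmodule_isTopologicalLmodule.Build
  K P prod_space_scale_continuous.
End ProdSpace.

Section Span.
Context (K : numDomainType) (V : topologicalLmodType K).

Definition lspan (A : set V) : set V :=
  [set x | exists2 s : seq (K * V),
     (forall z, z \in s -> A z.2) & x = \sum_(z <- s) z.1 *: z.2].

Definition linear_set (A : set V) :=
  A 0 /\ forall a v w, A v -> A w -> A (a *: v + w).

Lemma lspan_linear (A : set V) : linear_set (lspan A).
Proof.
split=> [|a v w [s sA ->] [t tA ->]]; first by exists [::] => [z|]; rewrite ?inE ?in_nil ?big_nil.
exists ([seq (a * z.1, z.2) | z <- s] ++ t) => [z|].
  by rewrite mem_cat => /orP[/mapP[y /sA Ay ->]|/tA].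
rewrite big_cat big_map scaler_sumr; congr (_ + _).
by apply: eq_bigr => z _; rewrite scalerA.
Qed.

Lemma sub_lspan (A : set V) : A `<=` lspan A.
Proof.
move=> v Av; exists [:: (1, v)]; last by rewrite big_seq1 scale1r.
by move=> z; rewrite inE => /eqP ->.
Qed.

Lemma lspan_mono (A B : set V) : A `<=` B -> lspan A `<=` lspan B.
Proof. by move=> AB v [s sA ->]; exists s => // z /sA /AB. Qed.

Lemma closure_linear (A : set V) : linear_set A -> linear_set (closure A).
Proof.
move=> [A0 Al]; split=> [|a v w cv cw B]; first exact: subset_closure.
have cs : continuous (fun x : V => a *: x).
  apply: (continuous_comp2 (f := fun=> (a : K^o)) (g := id)
    _ _ (@scale_continuous K V)); first by move=> x; exact: cvg_cst.
  by move=> x; exact: cvg_id.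
move=> /(@add_continuous V (a *: v, w)) [[C D]/= [/cs nC nD] CD].
have [x [Ax Cx]] := cv _ nC; have [y [Ay Dy]] := cw _ nD.
by exists (a *: x + y); split; [exact: Al|exact: (CD (a *: x, y))].
Qed.

Lemma linear_set_submod (A : set V) : linear_set A ->
  submod_closed [pred v : V | v \in A].
Proof.
move=> [A0 Al]; split=> [|a v w]; first by rewrite !inE.
by rewrite !inE => Av Aw; exact: Al.
Qed.

End Span.

(** ** Real reductive groups, parabolic subgroups, unipotent radicals *)

HB.mixin Record isTopologicalGroup G of Group G & Topological G := {
  mulg_continuous : continuous (fun x : G * G => (x.1 * x.2)%g);
  invg_continuous : continuous (fun x : G => (x^-1)%g)
}.

#[short(type="topologicalGroupType")]
HB.structure Definition TopologicalGroup :=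
  {G of isTopologicalGroup G & Group G & Topological G}.

(* The group law is a parameter so that the same definitions apply to subgroups
   of GL_n(R), inside the square matrices, and to subgroups of a topological
   group G given with a representation rho. *)
Section Subgroups.
Context (R : realType) (T : topologicalType).
Variables (mul : T -> T -> T) (inv : T -> T) (e : T).
Variables (n : nat) (rho : T -> 'M[R]_n).

Definition is_subgroup (H : set T) :=
  [/\ H e, forall x y, H x -> H y -> H (mul x y) & forall x, H x -> H (inv x)].

Definition is_normal_in (P U : set T) :=
  U `<=` P /\ forall x u, P x -> U u -> U (mul (mul x u) (inv x)).

Definition unipotent_mx (X : 'M[R]_n) := exists k : nat, (X - 1%:M) ^+ k = 0.

Definition connected_normal_unipotent (P U : set T) :=
  [/\ is_subgroup U, is_normal_in P U, connected U &
      forall u, U u -> unipotent_mx (rho u)].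

Definition largest_connected_normal_unipotent (P N : set T) :=
  connected_normal_unipotent P N /\
  forall U, connected_normal_unipotent P U -> U `<=` N.

End Subgroups.

Section AlgebraicGroups.
Context (R : realType) (n : nat).
Let mul (X Y : 'M[R]_n) : 'M[R]_n := X *m Y.
Let inv (X : 'M[R]_n) : 'M[R]_n := invmx X.

Definition zero_locus (I : set (mpoly.mpoly (n * n) R)) : set 'M[R]_n :=
  [set X | X \in unitmx /\ forall q, I q -> mpoly.meval (mxvec X 0) q = 0].

(* real points of a reductive linear algebraic group over R: the unipotent
   radical is trivial *)
Definition reductive_algebraic (A : set 'M[R]_n) :=
  [/\ exists I, A = zero_locus I,
      is_subgroup mul inv 1%:M A &
      largest_connected_normal_unipotent mul inv 1%:M id A [set 1%:M]].

End AlgebraicGroups.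

(* G is a finite covering, through rho, of an open subgroup of the real points
   of a reductive linear algebraic group; in particular G is a Lie group and
   rho has finite kernel and closed image. *)
Record real_reductive (R : realType) (G : topologicalGroupType) (n : nat)
    (rho : G -> 'M[R]_n) : Prop := RealReductive {
  rr_hausdorff : hausdorff_space G;
  rr_dim : (0 < n)%N;
  rr_one : rho 1%g = 1%:M;
  rr_mul : forall x y, rho (x * y)%g = rho x *m rho y;
  rr_continuous : continuous rho;
  rr_finite_ker : finite_set [set g | rho g = 1%:M];
  rr_open_image : exists2 A, reductive_algebraic A &
    forall U : set G, open U -> exists2 V, open V & rho @` U = V `&` A
}.

Section OneParameter.
Context (R : realType) (G : topologicalGroupType).

(* The Lie algebra of a subgroup H, as its continuous one-parameter subgroups. *)
Definition one_param (H : set G) : set (R -> G) :=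
  [set c | [/\ continuous c, forall s t, c (s + t) = (c s * c t)%g &
               forall t, H (c t)]].

Variables (n : nat) (rho : G -> 'M[R]_n).

Definition lie_mx (H : set G) : set 'M[R]_n :=
  [set X | exists2 c, one_param H c &
    forall i j, is_derive (0 : R) (1 : R) (fun t : R => rho (c t) i j) (X i j)].

End OneParameter.

Section MatrixLieAlgebras.
Context (K : fieldType) (n : nat).
Implicit Types (X Y : 'M[K]_n) (U V b g : {vspace 'M[K]_n}).

Definition lie_bracket X Y := X *m Y - Y *m X.

Definition bracket_space U V : {vspace 'M[K]_n} :=
  <<[seq lie_bracket X Y | X <- vbasis U, Y <- vbasis V]>>%VS.

Definition lie_subalgebra U := (bracket_space U U <= U)%VS.

Definition lie_solvable U :=
  exists k : nat, iter k (fun V => bracket_space V V) U = 0%VS.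

Definition borel_subalgebra g b :=
  [/\ (b <= g)%VS, lie_subalgebra b, lie_solvable b &
      forall b' : {vspace 'M[K]_n}, (b <= b')%VS -> (b' <= g)%VS ->
        lie_subalgebra b' -> lie_solvable b' -> b' = b].

End MatrixLieAlgebras.

Section Parabolic.
Context (R : realType) (G : topologicalGroupType) (n : nat) (rho : G -> 'M[R]_n).

Definition complexify (U : {vspace 'M[R]_n}) : {vspace 'M[R[i]]_n} :=
  <<[seq map_mx (fun x : R => x%:C%C) X | X <- vbasis U]>>%VS.

Definition parabolic_subalgebra (g p : {vspace 'M[R]_n}) :=
  [/\ (p <= g)%VS, lie_subalgebra p &
      exists2 b, borel_subalgebra (complexify g) b & (b <= complexify p)%VS].

(* P is the normalizer in G of a parabolic subalgebra p of Lie(G), i.e. of a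
   subalgebra whose complexification contains a Borel subalgebra *)
Definition parabolic (P : set G) :=
  exists g p : {vspace 'M[R]_n},
    [/\ forall X, X \in g <-> lie_mx rho setT X,
        parabolic_subalgebra g p &
        P = [set x | forall X, X \in p <-> rho x *m X *m rho x^-1%g \in p]].

Definition unipotent_radical (P N : set G) :=
  largest_connected_normal_unipotent
    (fun x y : G => (x * y)%g) (fun x : G => x^-1%g) 1%g rho P N.

(* The algebraic scales are the functions polynomially equivalent to the one
   given by rho; they all define the same category [Rep]. *)
Definition scale_of (g : G) : R :=
  \tr (rho g *m (rho g)^T) + \tr (rho g^-1%g *m (rho g^-1%g)^T).

Definition algebraic_scale (s : G -> R) :=
  (forall g, 0 < s g) /\
  exists (C : R) (m : nat), forall g,
    s g <= C * scale_of g ^+ m /\ scale_of g <= C * s g ^+ m.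

End Parabolic.

(** ** Smooth Frechet representations of moderate growth *)

Section Frechet.
Context (R : realType).
Local Notation C := R[i].
Implicit Type V : topologicalLmodType C.

Definition seminorm V (p : V -> R) :=
  (forall v w, p (v + w) <= p v + p w) /\
  (forall (a : C) v, p (a *: v) = Normc.normc a * p v).

Record frechet V : Prop := Frechet {
  frechet_hausdorff : hausdorff_space V;
  frechet_seminorms : exists2 p : nat -> V -> R, (forall k, seminorm (p k)) &
    forall A : set V, nbhs (0 : V) A <->
      exists (m : nat) (eps : R),
        0 < eps /\ [set v | forall k, (k <= m)%N -> p k v < eps] `<=` A;
  frechet_complete : forall u : nat -> V,
    (forall A : set V, nbhs (0 : V) A -> exists m0 : nat,
       forall m k, (m0 <= m)%N -> (m0 <= k)%N -> A (u m - u k)) ->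
    exists l : V, u @ \oo --> l
}.

Definition derivative_at0 V (c : R -> V) (w : V) :=
  (fun t : R => (t^-1)%:C%C *: (c t - c 0)) @ (0 : R)^' --> w.

End Frechet.

(* An action map on a topological vector space, without axioms: those are in
   [Rep], relative to a subgroup H of G; the values of the action off H are
   irrelevant there. *)
Record representation (R : realType) (G : Type) := Representation {
  rep_space :> topologicalLmodType R[i];
  rep_act : G -> rep_space -> rep_space
}.

Section Representations.
Context (R : realType) (G : topologicalGroupType).
Implicit Types (H : set G) (V : representation R G).

(* C^k on H: the iterated derivatives of order at most k along left-invariant
   vector fields of H, which form a global frame, exist and are continuous *)
Fixpoint class_C H (V : topologicalLmodType R[i]) (k : nat) (f : G -> V) : Prop :=
  {within H, continuous f} /\
  if k is k'.+1 then
    forall c : R -> G, one_param H c ->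
      exists2 f' : G -> V,
        (forall h, H h -> derivative_at0 (fun t => f (h * c t)%g) (f' h)) &
        class_C H k' f'
  else True.

(* objects of Rep^{oo,F}(H) *)
Record Rep H (s : G -> R) V : Prop := MkRep {
  Rep_frechet : frechet V;
  Rep_linear : forall h, H h -> linear (@rep_act _ _ V h);
  Rep_one : forall v : V, rep_act 1%g v = v;
  Rep_mul : forall g h (v : V), H g -> H h ->
    rep_act (g * h)%g v = rep_act g (rep_act h v);
  Rep_continuous : {within H `*` setT,
    continuous (fun x : G * V => rep_act x.1 x.2)};
  Rep_smooth : forall (v : V) k, class_C H k (fun g => rep_act g v);
  Rep_moderate : forall p1 : V -> R, seminorm p1 -> continuous p1 ->
    exists (r : nat) (p2 : V -> R), [/\ seminorm p2, continuous p2 &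
      forall h v, H h -> p1 (rep_act h v) <= s h ^+ r * p2 v]
}.

Record morphism H (V1 V2 : representation R G) (f : V1 -> V2) : Prop :=
  Morphism {
    mor_linear : linear f;
    mor_continuous : continuous f;
    mor_equivariant : forall h v, H h -> f (rep_act h v) = rep_act h (f v)
  }.

Definition epimorphism H (V1 V2 : representation R G) (f : V1 -> V2) :=
  morphism H f /\ dense (range f).

Definition isomorphic H (V1 V2 : representation R G) :=
  exists (f : V1 -> V2) (g : V2 -> V1),
    [/\ morphism H f, morphism H g, cancel f g & cancel g f].

(* 0 -> V1 -> V2 -> V3 -> 0 in Rep^{oo,F}(H) *)
Record strict_short_exact H (s : G -> R) (V1 V2 V3 : representation R G)
    (i : V1 -> V2) (p : V2 -> V3) : Prop := StrictShortExact {
  sse_Rep : [/\ Rep H s V1, Rep H s V2 & Rep H s V3];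
  sse_morphism : morphism H i /\ morphism H p;
  sse_injective : injective i;
  sse_exact : range i = [set v | p v = 0];
  sse_surjective : range p = setT;
  sse_strict : closed (range i) /\ closed (range p)
}.

(** ** The functors CJ_s and CJ *)

(* [N] stands for the unipotent radical of P, and Lie(N) for [one_param N]. *)
Section CasselmanJacquet.
Variables (N : set G) (V : representation R G).

(* all the X.v with X in Lie(N) and v in A, where X.v is the derivative at 0
   of exp(tX).v *)
Definition ndot (A : set V) : set V :=
  [set w | exists (c : R -> G) (v : V),
     [/\ one_param N c, A v & derivative_at0 (fun t => rep_act (c t) v) w]].

Definition npow (k : nat) : set V := lspan (iter k ndot setT).

Definition CJs_set : set V := \bigcap_k closure (npow k).

Definition npow_cl (k : nat) : {pred V} := [pred v : V | v \in closure (npow k)].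

Lemma npow_cl_submod k : submod_closed (npow_cl k).
Proof. exact/linear_set_submod/closure_linear/lspan_linear. Qed.

HB.instance Definition _ k :=
  GRing.isSubmodClosed.Build _ _ (npow_cl k) (npow_cl_submod k).

Definition CJs_pred : {pred V} := [pred v : V | v \in CJs_set].

Lemma CJs_submod : submod_closed CJs_pred.
Proof.
apply: linear_set_submod; split=> [k _|a v w Av Aw k _].
  by have [] := closure_linear (lspan_linear (iter k ndot setT)).
by have [_] := closure_linear (lspan_linear (iter k ndot setT)); apply;
  [exact: Av|exact: Aw].
Qed.

HB.instance Definition _ := GRing.isSubmodClosed.Build _ _ CJs_pred CJs_submod.

Definition nquot (k : nat) : topologicalLmodType R[i] := quot_space (npow_cl k).

Definition npi (k : nat) (v : V) : nquot k := qpi (npow_cl k) v.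

(* sequences compatible with the maps V / n^{k+1}V -> V / n^k V *)
Definition coherent : {pred prod_space nquot} :=
  [pred x : prod_space nquot |
    `[< forall k v, npi k.+1 v = x k.+1 -> npi k v = x k >]].

Lemma ndot_mono (A B : set V) : A `<=` B -> ndot A `<=` ndot B.
Proof. by move=> AB w [c [v [Nc Av]]]; exists c, v; split=> //; exact: AB. Qed.

Lemma npow_decr k : npow k.+1 `<=` npow k.
Proof.
apply: lspan_mono; elim: k => [|k IH] //=; exact: ndot_mono.
Qed.

Lemma npi_decr k (v w : V) : npi k.+1 v = npi k.+1 w -> npi k v = npi k w.
Proof.
move=> /qpi_eq h; apply/qpi_eq; move: h; rewrite !inE/=.
exact: (closure_subset (@npow_decr k)).
Qed.

Lemma coherent_submod : submod_closed coherent.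
Proof.
split=> [|a x y /asboolP cx /asboolP cy].
  apply/asboolP => k v h; rewrite -[RHS](linear0 (qpi (npow_cl k))).
  by apply: npi_decr; rewrite h /npi linear0.
apply/asboolP => k v h.
have [vx ex] := qpi_surj (x k.+1); have [vy ey] := qpi_surj (y k.+1).
have e j : (a *: x + y) j = a *: x j + y j by [].
rewrite e -(cx k vx (esym ex)) -(cy k vy (esym ey)) -(qpi_linear (npow_cl k)).
by apply: npi_decr; rewrite h e ex ey -(qpi_linear (npow_cl k.+1)).
Qed.

HB.instance Definition _ :=
  GRing.isSubmodClosed.Build _ _ coherent coherent_submod.

Definition CJs_space : topologicalLmodType R[i] := sub_space CJs_pred.
Definition CJ_space : topologicalLmodType R[i] := sub_space coherent.

Lemma npi_coherent (v : V) : ((fun k => npi k v) : prod_space nquot) \in coherent.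
Proof. by apply/asboolP => k w /npi_decr. Qed.

Definition CJ_proj (v : V) : CJ_space :=
  Sub ((fun k => npi k v) : prod_space nquot) (npi_coherent v).

End CasselmanJacquet.

Section Functoriality.
Variable N : set G.

Section Maps.
Variables (V1 V2 : representation R G) (f : V1 -> V2).

(* The defaults [0] below are never used for a continuous linear f which is
   compatible with N in the sense of [N_compatible]: see [CJs_mapE] and
   [CJ_mapE]. *)
Definition CJs_map (x : CJs_space N V1) : CJs_space N V2 :=
  insubd 0 (f (val x)).

Definition CJ_map (x : CJ_space N V1) : CJ_space N V2 :=
  xget 0 [set y : CJ_space N V2 |
    forall k v, npi N k v = val x k -> val y k = npi N k (f v)].

Definition N_compatible :=
  [/\ linear f, continuous f &
      forall c, one_param N c -> exists2 c' : R -> G, one_param N c' &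
        forall t v, f (rep_act (c t) v) = rep_act (c' t) (f v)].

Hypothesis fN : N_compatible.

Lemma N_compatible_iter_ndot k v :
  iter k (ndot N (V := V1)) setT v -> iter k (ndot N (V := V2)) setT (f v).
Proof.
have [fl fc fNc] := fN; elim: k v => [//|k IH] w [c [v [Nc Av dw]]].
have [c' Nc' cc'] := fNc c Nc; exists c', (f v); split=> //; first exact: IH.
have fZB a (x y : V1) : f (a *: (x - y)) = a *: (f x - f y).
  have f0 : f 0 = 0 by have := fl (-1) 0 0; rewrite scaler0 addr0 scaleN1r addNr.
  have fZ b x' : f (b *: x') = b *: f x'.
    by rewrite -[b *: x']addr0 fl f0 addr0.
  by rewrite fZ -scaleN1r addrC fl scaleN1r addrC.
rewrite /derivative_at0.
have -> : (fun t : R => (t^-1)%:C%C *: (rep_act (c' t) (f v) - rep_act (c' 0) (f v)))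
  = f \o (fun t : R => (t^-1)%:C%C *: (rep_act (c t) v - rep_act (c 0) v)).
  by apply/funext => t /=; rewrite fZB !cc'.
by apply: cvg_comp; [exact: dw|exact: fc].
Qed.

Lemma N_compatible_npow_cl k v :
  closure (npow N k) v -> closure (npow N k) (f v).
Proof.
have [fl fc _] := fN; move=> cv B /fc nB; have [x [[u uA ->] Bx]] := cv _ nB.
exists (f (\sum_(z <- u) z.1 *: z.2)); split=> //.
exists [seq (z.1, f z.2) | z <- u] => [z /mapP[y yu ->]|].
  by apply: N_compatible_iter_ndot; exact: uA.
have f0 : f 0 = 0 by have := fl (-1) 0 0; rewrite scaler0 addr0 scaleN1r addNr.
rewrite big_map; elim: (u) => [|z u' IH]; first by rewrite !big_nil.
by rewrite !big_cons fl IH.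
Qed.

Lemma CJs_mapE x : val (CJs_map x) = f (val x).
Proof.
rewrite /CJs_map insubdK//; move: (valP x); rewrite !inE => Ax k _.
exact/N_compatible_npow_cl/Ax.
Qed.

Lemma N_compatible_npi k v w : npi N k v = npi N k w -> npi N k (f v) = npi N k (f w).
Proof.
have [fl _ _] := fN.
move=> /qpi_eq; rewrite inE/= => /N_compatible_npow_cl h; apply/qpi_eq.
rewrite inE/=; move: h; rewrite -[v - w]addrC -scaleN1r fl scaleN1r.
by rewrite [_ + f v]addrC.
Qed.

Lemma CJ_mapE x k v : npi N k v = val x k -> val (CJ_map x) k = npi N k (f v).
Proof.
rewrite /CJ_map; case: xgetP => [y _ hy|/forallNP no]; first exact: hy.
pose y : prod_space (@nquot N V2) := fun k => npi N k (f (repr (val x k))).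
have yE j w : npi N j w = val x j -> y j = npi N j (f w).
  by move=> hw; apply: N_compatible_npi; rewrite hw /npi /qpi reprK.
move: y yE => y yE.
have yc : y \in @coherent N V2.
  apply/asboolP => j w h.
  have [u eu] := qpi_surj (val x j.+1).
  have /asboolP cx := valP x.
  rewrite (yE j u (cx j u (esym eu))); apply: npi_decr; rewrite h.
  exact: (yE j.+1 u (esym eu)).
by case: no; exists (Sub y yc : CJ_space N V2) => j w; exact: yE.
Qed.

End Maps.

Variable V : representation R G.

Definition CJs : representation R G :=
  Representation (fun g : G => CJs_map (rep_act (r := V) g)).

Definition CJs_incl (x : CJs) : V := val (x : CJs_space N V).

Definition CJ : representation R G :=
  Representation (fun g : G => CJ_map (rep_act (r := V) g)).

End Functoriality.

Lemma morphism_N_compatible (N : set G) (V1 V2 : representation R G)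
    (f : V1 -> V2) : morphism setT f -> N_compatible N f.
Proof. by move=> [fl fc fG]; split=> // c Nc; exists c => // t v; exact: fG. Qed.

Lemma rep_act_N_compatible (P N : set G) s (V : representation R G) g :
    Rep P s V -> is_subgroup (fun x y : G => (x * y)%g) (fun x : G => x^-1%g) 1%g P ->
    is_normal_in (fun x y : G => (x * y)%g) (fun x : G => x^-1%g) P N -> P g ->
  N_compatible N (rep_act (r := V) g).
Proof.
move=> rP [P1 PM PV] [NP nN] Pg; split; first exact: (Rep_linear rP).
- move=> v A nA; have /subspace_continuousP := Rep_continuous rP.
  move=> /(_ (g, v)) /(_ (conj Pg I)) /(_ A nA) [[B D]/= [nB nD] BD].
  apply: filterS nD => w Dw; apply: (BD (g, w)) => //=.
  by split=> //; exact: nbhs_singleton.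
- move=> c [cc cD Nc].
  exists (fun t => (g * c t * g^-1)%g); first split=> [|x y|t].
  + apply: (continuous_comp2 (f := fun t => (g * c t)%g) (g := fun=> (g^-1)%g)
      _ _ (@mulg_continuous G)); last by move=> x; exact: cvg_cst.
    apply: (continuous_comp2 (f := fun=> g) (g := c) _ cc (@mulg_continuous G)).
    by move=> x; exact: cvg_cst.
  + by rewrite cD !mulgA mulgVK.
  + exact: nN.
  + move=> t v; have Pc : P (c t) by exact: NP.
    rewrite -(Rep_mul rP v Pg Pc) -(Rep_mul rP v (PM _ _ (PM _ _ Pg Pc) (PV _ Pg)) Pg).
    by rewrite mulgVK.
Qed.

End Representations.

Arguments CJs_set {R G} N V _.
Arguments CJ_proj {R G} N V v.
Arguments CJs_incl {R G} N V x.

(* Main.v *)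
(** Write F_k for the closure of n^k.V.  For g = exp X with X in n, the operator
    g - 1 maps F_k to F_(k+1), and g^u - 1 is congruent to u(g - 1) modulo
    F_(k+2).  Hence a product of k operators g_i^u - 1 is congruent to u^k times
    the product of the g_i - 1 modulo F_(k+1).  On the other hand, by Kolchin's
    theorem the matrix entries of g_1^u ... g_l^u are O(u^d) with d independent
    of l, so moderate growth bounds, for a continuous seminorm p, the p-norm of
    the former product by O(u^D) with D independent of k.  Letting u tend to
    infinity, F_k lies in the p-closure of F_(k+1) for all k > D: for every
    continuous seminorm the closures of the F_k stabilize.  The Mittag-Leffler
    argument then shows that the intersection CJ_s is p-dense in F_k for large k,
    and that V -> CJ is surjective and open, so that CJ = V / CJ_s as topological
    representations; (1), (2) and (3) follow.

    For (4), N_P is shown to be contained, up to one-parameter subgroups, in N_Q: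
    if b is a Borel subalgebra contained in the complexification of Lie(Q), then
    b + Lie(N_P)_C is a solvable subalgebra, so Lie(N_P) lies in b by
    maximality.  Thus CJ_(s,P) lies in CJ_(s,Q), and both CJ_Q (CJ_P V) and CJ_Q V
    are the quotient of V by CJ_(s,Q). *)

Require Import Defs.
From HB Require Import structures.
From mathcomp Require Import all_boot all_order all_algebra.
From mathcomp Require Import all_classical all_reals all_analysis.
From mathcomp Require Import complex perm falgebra ring lra.

Set Implicit Arguments.
Unset Strict Implicit.
Unset Printing Implicit Defensive.

Import Order.TTheory GRing.Theory Num.Theory numFieldNormedType.Exports.

Local Open Scope classical_set_scope.
Local Open Scope ring_scope.

(** * Seminorms and Frechet spaces *)

(** The F_k themselves need not stabilize: only their closures for one seminorm do, from a rank that
    depends on the seminorm. So no single quotient V / F_k can stand for CJ, and most statements are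
    phrased with the distances [pdist p (Fil N k)]. Elements g = exp X replace X because moderate
    growth bounds the action of a whole product of group elements by one exponent r and one seminorm
    p2, whereas each application of an element of the Lie algebra may change the seminorm. The
    degree d is uniform for an algebraic reason. The matrices g - 1, with g in rho(N), span an
    algebra I with I^d = 0. When every g_i^u is expanded in powers of g_i - 1, all monomials of
    degree at least d vanish, and the coefficient of a monomial of degree e is at most (u + 1)^e,
    whatever the number of factors. Lie(N) appears as a set of one-parameter subgroups, on which no
    addition is given; where a space of matrices is wanted, its image is replaced by its span. *)

Section Seminorms.
Context (R : realType).
Local Notation C := R[i].
Implicit Types V W : topologicalLmodType C.

Definition csemi V (p : V -> R) := seminorm p /\ continuous p.

Lemma normc_real (t : R) : Normc.normc (t%:C%C) = `|t|.
Proof. by rewrite /Normc.normc /= expr0n /= addr0 sqrtr_sqr. Qed.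

Lemma normc_nat (k : nat) : Normc.normc (k%:R : C) = k%:R.
Proof. by rewrite -(rmorph_nat (real_complex R)) normc_real normr_nat. Qed.

Lemma normc_ge0 (a : C) : 0 <= Normc.normc a.
Proof. by case: a => a b; exact: sqrtr_ge0. Qed.

Section OneSeminorm.
Variables (V : topologicalLmodType C) (p : V -> R).
Hypothesis sp : seminorm p.

Lemma seminorm0 : p 0 = 0.
Proof. by have := sp.2 0 0; rewrite scale0r Normc.normc0 mul0r. Qed.

Lemma seminormN v : p (- v) = p v.
Proof.
rewrite -scaleN1r sp.2.
by rewrite (_ : Normc.normc _ = 1) ?mul1r// -(rmorphN1 (real_complex R)) normc_real normrN1.
Qed.

Lemma seminormB v w : p (v - w) = p (w - v).
Proof. by rewrite -seminormN opprB. Qed.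

Lemma seminorm_ge0 v : 0 <= p v.
Proof.
have := sp.1 v (- v); rewrite subrr seminorm0 seminormN -mulr2n.
by rewrite pmulrn_lge0.
Qed.

Lemma seminorm_triB v w : p (v - w) <= p v + p w.
Proof. by rewrite -(seminormN w); exact: sp.1. Qed.

Lemma seminorm_dist u v w : p (u - w) <= p (u - v) + p (v - w).
Proof. by rewrite (_ : u - w = (u - v) + (v - w)) ?sp.1// addrA subrK. Qed.

Lemma seminorm_lip v w : `|p v - p w| <= p (v - w).
Proof.
rewrite ler_norml; apply/andP; split.
  by rewrite lerNl opprB lerBlDr seminormB -{1}(subrK v w) sp.1.
by rewrite lerBlDr -{1}(subrK w v) sp.1.
Qed.

Lemma seminorm_real (t : R) v : p (t%:C%C *: v) = `|t| * p v.
Proof. by rewrite sp.2 normc_real. Qed.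

End OneSeminorm.

Lemma seminormD V (p q : V -> R) : seminorm p -> seminorm q ->
  seminorm (fun v => p v + q v).
Proof.
move=> [pD pZ] [qD qZ]; split=> [v w|a v]; last by rewrite pZ qZ mulrDr.
by rewrite addrACA lerD.
Qed.

Lemma seminormM V (p : V -> R) (c : R) : 0 <= c -> seminorm p ->
  seminorm (fun v => c * p v).
Proof.
move=> c0 [pD pZ]; split=> [v w|a v]; last by rewrite pZ mulrCA.
by rewrite -mulrDr ler_wpM2l.
Qed.

Lemma csemiD V (p q : V -> R) : csemi p -> csemi q -> csemi (fun v => p v + q v).
Proof.
move=> [sp cp] [sq cq]; split; first exact: seminormD.
by move=> v; apply: cvgD; [exact: cp|exact: cq].
Qed.

Lemma shift_continuous V (a : V) : continuous (fun v : V => v + a).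
Proof.
apply: (continuous_comp2 (f := id) (g := fun=> a) _ _ (@add_continuous V)).
  by move=> x; exact: cvg_id.
by move=> x; exact: cvg_cst.
Qed.

Lemma lmod_scale_continuous V (a : C) : continuous (fun v : V => a *: v).
Proof.
apply: (continuous_comp2 (f := fun=> (a : C^o)) (g := id) _ _ (@scale_continuous _ V)).
  by move=> x; exact: cvg_cst.
by move=> x; exact: cvg_id.
Qed.

Lemma nbhs_shift V (v : V) (A : set V) : nbhs v A <-> nbhs 0 [set w | A (w + v)].
Proof.
split=> [nA|nA].
  by apply: (@shift_continuous V v 0); rewrite add0r.
have := @shift_continuous V (- v) v [set w | A (w + v)].
rewrite subrr => /(_ nA) h.
by apply: (@filterS _ (nbhs v) _ _ _ _ h) => w /=; rewrite subrK.
Qed.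

Lemma csemi_nbhs V (p : V -> R) (v : V) (e : R) : csemi p -> 0 < e ->
  nbhs v [set w | p (w - v) < e].
Proof.
move=> [sp cp] e0; apply/nbhs_shift; have /cvgrPdist_lt /(_ e e0) := cp 0.
by apply: filterS => w /=; rewrite seminorm0// sub0r normrN addrK => /(le_lt_trans (ler_norm _)).
Qed.

Lemma continuous_seminorm V (p : V -> R) : seminorm p ->
  (forall e : R, 0 < e -> nbhs 0 [set w | p w < e]) -> continuous p.
Proof.
move=> sp h v; apply/cvgrPdist_lt => e e0; apply/nbhs_shift.
apply: filterS (h e e0) => w /= pw.
rewrite (le_lt_trans (seminorm_lip sp _ _))// seminormB// addrK//.
Qed.

Lemma csemi_le V (p q : V -> R) (c : R) : csemi p -> seminorm q ->
  (forall v, q v <= c * p v) -> csemi q.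
Proof.
move=> cp sq qp; split=> //; apply: continuous_seminorm => // e e0.
have c0 : 0 < `|c| + 1 by rewrite ltr_wpDl.
have := csemi_nbhs 0 cp (divr_gt0 e0 c0); apply: filterS => w /=.
rewrite subr0 ltr_pdivlMr// mulrC => h; apply: le_lt_trans h.
rewrite (le_trans (qp w))// ler_wpM2r ?(seminorm_ge0 cp.1)//.
by rewrite (le_trans (ler_norm _))// lerDl.
Qed.

Lemma csemi_comp V W (f : V -> W) (p : W -> R) : linear f -> continuous f ->
  csemi p -> csemi (p \o f).
Proof.
move=> fl fc [[pD pZ] cp].
have f0 : f 0 = 0 by have := fl (-1) 0 0; rewrite scaler0 addr0 scaleN1r addNr.
split; last by move=> v; apply: continuous_comp; [exact: fc|exact: cp].
split=> [v w|a v] /=; first by rewrite -{1}(scale1r v) fl scale1r.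
by rewrite -[a *: v]addr0 fl f0 addr0 pZ.
Qed.

Lemma csemi0 V : csemi (fun _ : V => 0 : R).
Proof.
split; last by move=> v; exact: cvg_cst.
by split=> [v w|a v]; rewrite ?addr0 ?mulr0.
Qed.

Lemma csemi_bigsum V (I : Type) (r : seq I) (p : I -> V -> R) : (forall k, csemi (p k)) ->
  csemi (fun v => \sum_(k <- r) p k v).
Proof.
move=> cp; elim: r => [|k r IH].
  rewrite (_ : (fun v => _) = (fun _ : V => 0)); first exact: csemi0.
  by apply/funext => v; rewrite big_nil.
rewrite (_ : (fun v => _) = (fun v => p k v + \sum_(k <- r) p k v)).
  exact: csemiD.
by apply/funext => v; rewrite big_cons.
Qed.

(** [frechet] describes a neighbourhood by finitely many seminorms. With an increasing sequence a
    single one is enough, so that the j-th step of an approximation has only [p j] to control. *)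
Definition semi_basis V (p : nat -> V -> R) :=
  [/\ forall k, csemi (p k), forall k v, p k v <= p k.+1 v &
   forall A : set V, nbhs (0 : V) A <->
      exists (m : nat) (eps : R), 0 < eps /\ [set v | p m v < eps] `<=` A].

Lemma semi_basis_le V (p : nat -> V -> R) : semi_basis p ->
  forall k l v, (k <= l)%N -> p k v <= p l v.
Proof.
move=> [_ pS _] k l v; elim: l => [|l IH]; first by rewrite leqn0 => /eqP ->.
rewrite leq_eqVlt => /predU1P[->//|]; rewrite ltnS => /IH /le_trans; apply.
exact: pS.
Qed.

Lemma frechet_semi_basis V : frechet V -> exists p, @semi_basis V p.
Proof.
move=> [_ [p sp pA] _].
have cp k : csemi (p k).
  split=> //; apply: continuous_seminorm => // e e0; apply/pA.
  by exists k, e; split=> // v /= /(_ k (leqnn k)).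
exists (fun m v => \sum_(0 <= k < m.+1) p k v); split.
- by move=> k; exact: csemi_bigsum.
- move=> k v; rewrite [leRHS]big_nat_recr //= lerDl; exact: seminorm_ge0.
- move=> A; rewrite pA; split=> -[m [e [e0 h]]]; last first.
    exists m, (e / m.+1%:R); split; first by rewrite divr_gt0// ltr0n.
    move=> v /= pv; apply: h => /=.
    rewrite (@lt_le_trans _ _ (\sum_(0 <= k < m.+1) (e / m.+1%:R)))//.
      by apply: ltr_sum_nat => // k /andP[_ km]; exact: pv.
    by rewrite big_mkord sumr_const card_ord -[leLHS]mulr_natr divfK// pnatr_eq0.
  exists m, e; split=> // v /= pv; apply: h => /= k km.
  apply: le_lt_trans pv; rewrite big_mkord.
  have km' : (k < m.+1)%N by [].
  rewrite (bigD1 (Ordinal km'))//= lerDl sumr_ge0// => i _.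
  exact: seminorm_ge0.
Qed.

Lemma nbhs_semi_basis V p (v : V) A : semi_basis p -> nbhs v A <->
  exists (m : nat) (eps : R), 0 < eps /\ [set w | p m (w - v) < eps] `<=` A.
Proof.
move=> [cp pS pA]; split=> [/nbhs_shift/pA|] [m [e [e0 h]]].
  by exists m, e; split=> // w /= /h /=; rewrite subrK.
by apply: filterS h _; exact: csemi_nbhs.
Qed.

Lemma csemi_dominated V p (q : V -> R) : semi_basis p -> csemi q ->
  exists m, exists2 c : R, 0 < c & forall v, q v <= c * p m v.
Proof.
move=> [cp pS pA] cq; have := csemi_nbhs 0 cq ltr01.
move=> /pA[m [e [e0 h]]]; exists m, (2 / e); first by rewrite divr_gt0.
have sq := cq.1; have sp := (cp m).1.
move=> v; apply/ler_addgt0Pr => d d0.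
(* The vector v is rescaled into the ball of radius e of [p m], where q is less than 1. The slack d
   keeps the denominator positive when [p m v] is 0, and 1 / t is exactly (2 / e) p m v + d. *)
pose t := e / (2 * (p m v + d * e / 2)).
have pm0 := seminorm_ge0 sp v.
have s0 : 0 < p m v + d * e / 2 by rewrite ltr_wpDl// divr_gt0// mulr_gt0.
have t0 : 0 < t by rewrite divr_gt0// mulr_gt0.
have /h : p m (t%:C%C *: v) < e.
  rewrite seminorm_real// gtr0_norm// /t mulrAC ltr_pdivrMr ?mulr_gt0//.
  rewrite ltr_pM2l//; nra.
rewrite /= subr0 seminorm_real// gtr0_norm// => /ltW.
rewrite -ler_pdivlMl// mulr1 /t invf_div => /le_trans; apply.
by rewrite le_eqVlt; apply/orP; left; apply/eqP; field; rewrite gt_eqF.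
Qed.

Section Frechet.
Variable V : topologicalLmodType C.
Hypothesis fV : frechet V.

Lemma nbhs_csemi (v : V) (A : set V) : nbhs v A <->
  exists2 p, csemi p & exists2 e : R, 0 < e & forall w, p (w - v) < e -> A w.
Proof.
have [p bp] := frechet_semi_basis fV; have [cp _ _] := bp.
split=> [/(nbhs_semi_basis _ _ bp)|].
  by move=> [m [e [e0 h]]]; exists (p m) => //; exists e.
move=> [q cq [e e0 h]]; by apply: filterS h _; exact: csemi_nbhs.
Qed.

Lemma closure_csemi (A : set V) v : closure A v <->
  forall p, csemi p -> forall e : R, 0 < e -> exists2 w, A w & p (v - w) < e.
Proof.
split=> [cA p cp e e0|h B /nbhs_csemi[p cp [e e0 pB]]].
  have [w [Aw /= pw]] := cA _ (csemi_nbhs v cp e0).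
  by exists w => //; rewrite seminormB//; exact: cp.1.
have [w Aw pw] := h p cp e e0; exists w; split=> //.
by apply: pB; rewrite seminormB//; exact: cp.1.
Qed.

Lemma cvg_csemi (T : Type) {F : set_system T} {FF : Filter F} (f : T -> V) (l : V) :
  f @ F --> l <-> forall p, csemi p -> forall e : R, 0 < e -> F [set x | p (f x - l) < e].
Proof.
split=> [h p cp e e0|h A /nbhs_csemi[p cp [e e0 pA]]].
  exact: h _ (csemi_nbhs l cp e0).
by apply: filterS (h p cp e e0) => x; exact: pA.
Qed.

Lemma frechet_cvg_unique (T : Type) {F : set_system T} {FF : ProperFilter F}
    (f : T -> V) (l l' : V) :
  f @ F --> l -> f @ F --> l' -> l = l'.
Proof. exact: (cvg_unique (frechet_hausdorff fV)). Qed.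

End Frechet.

Section Distance.
Variables (V : topologicalLmodType C) (p : V -> R) (W : set V).
Hypotheses (sp : seminorm p) (lW : linear_set W).

(** This is the quotient seminorm of V / W pulled back to V. It turns approximation into equations:
    v is in the closure of W when all these distances vanish ([closure_pdist]). *)
Definition pdist v : R := inf [set p (v - w) | w in W].

Let W0 : W 0. Proof. exact: lW.1. Qed.

Let img_inf v : has_inf [set p (v - w) | w in W].
Proof.
split; first by exists (p (v - 0)), 0.
by exists 0 => _ [w _ <-]; exact: seminorm_ge0.
Qed.

Lemma pdist_le_dist v w : W w -> pdist v <= p (v - w).
Proof. by move=> Ww; apply: ge_inf; [exact: (img_inf v).2|exists w]. Qed.

Lemma pdist_le v : pdist v <= p v.
Proof. by rewrite -{2}(subr0 v); exact: pdist_le_dist. Qed.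

Lemma pdist_lt v e : pdist v < e -> exists2 w, W w & p (v - w) < e.
Proof. by move=> /(inf_lt (img_inf v).1)[_ [w Ww <-] h]; exists w. Qed.

Lemma pdist_ge0 v : 0 <= pdist v.
Proof.
apply: lb_le_inf; first exact: (img_inf v).1.
by move=> _ [w _ <-]; exact: seminorm_ge0.
Qed.

Lemma pdist_ge v e : (forall w, W w -> e <= p (v - w)) -> e <= pdist v.
Proof.
move=> h; apply: lb_le_inf; first exact: (img_inf v).1.
by move=> _ [w Ww <-]; exact: h.
Qed.

Lemma pdist_eq0 v : W v -> pdist v = 0.
Proof.
move=> Wv; apply/eqP; rewrite eq_le pdist_ge0 andbT.
by rewrite (le_trans (pdist_le_dist v Wv))// subrr seminorm0.
Qed.

Lemma linear_setD v w : W v -> W w -> W (v + w).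
Proof. by move=> Wv Ww; rewrite -(scale1r v); exact: lW.2. Qed.

Lemma linear_setZ a v : W v -> W (a *: v).
Proof. by move=> Wv; rewrite -[_ *: _]addr0; exact: lW.2. Qed.

Lemma linear_setB v w : W v -> W w -> W (v - w).
Proof. by move=> Wv Ww; rewrite addrC -scaleN1r; exact: lW.2. Qed.

Lemma linear_set_sum (I : eqType) (s : seq I) (F : I -> V) :
  (forall i, i \in s -> W (F i)) -> W (\sum_(i <- s) F i).
Proof.
move=> h; rewrite big_seq; elim/big_ind: _ => //; exact: linear_setD.
Qed.

Lemma pdist_seminorm : seminorm pdist.
Proof.
have D v w : pdist (v + w) <= pdist v + pdist w.
  apply/ler_addgt0Pr => e e0.
  have e2 : 0 < e / 2 by rewrite divr_gt0.
  have [a Wa pa] : exists2 a, W a & p (v - a) < pdist v + e / 2.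
    by apply: pdist_lt; rewrite ltrDl.
  have [b Wb pb] : exists2 b, W b & p (w - b) < pdist w + e / 2.
    by apply: pdist_lt; rewrite ltrDl.
  apply: le_trans (pdist_le_dist _ (linear_setD Wa Wb)) _.
  rewrite opprD addrACA (le_trans (sp.1 _ _))//.
  by rewrite [e]splitr addrACA ltW// ltrD.
(* The opposite inequality is this one for a^-1 and a v. Dividing by normc a + 1 covers a = 0. *)
have Zle (a : C) v : pdist (a *: v) <= Normc.normc a * pdist v.
  apply/ler_addgt0Pr => e e0; have na := normc_ge0 a.
  have [w Ww pw] : exists2 w, W w & p (v - w) < pdist v + e / (Normc.normc a + 1).
    by apply: pdist_lt; rewrite ltrDl divr_gt0// ltr_wpDl.
  apply: le_trans (pdist_le_dist _ (linear_setZ a Ww)) _.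
  rewrite -scalerBr sp.2 (@le_trans _ _ (Normc.normc a * (pdist v + e / (Normc.normc a + 1))))//.
    by rewrite ler_wpM2l// ltW.
  rewrite mulrDr lerD2l mulrCA ler_piMr ?ltW// ltr_pdivrMr ?mul1r ?ltrDl//.
  by rewrite ltr_wpDl.
split=> // a v; apply/eqP; rewrite eq_le Zle/=.
have [->|a0] := eqVneq a 0; first by rewrite Normc.normc0 mul0r pdist_ge0.
have := Zle a^-1 (a *: v); rewrite scalerA mulVf// scale1r Normc.normcV.
rewrite ler_pdivlMl// lt_neqAle normc_ge0 andbT eq_sym.
by apply: contra a0 => /eqP/Normc.eq0_normc ->.
Qed.

End Distance.

Lemma pdist_csemi V (p : V -> R) (S : set V) : csemi p -> linear_set S -> csemi (pdist p S).
Proof.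
move=> cp lW; apply: (csemi_le (c := 1) cp); first exact: pdist_seminorm cp.1 lW.
by move=> v; rewrite mul1r; apply: pdist_le => //; exact: cp.1.
Qed.

Lemma closure_pdist V (S : set V) v : frechet V -> linear_set S ->
  closure S v <-> forall p, csemi p -> pdist p S v = 0.
Proof.
move=> fV lW; rewrite closure_csemi//; split=> h p cp.
  apply/eqP; rewrite eq_le pdist_ge0//; last exact: cp.1.
  rewrite andbT; apply/ler_addgt0Pr => e e0; rewrite add0r.
  have [w Ww /ltW pw] := h p cp e e0.
  by apply: le_trans (pdist_le_dist cp.1 lW _ Ww) pw.
move=> e e0; apply: (pdist_lt cp.1 lW); rewrite h//.
Qed.

Lemma null_linear V (q : V -> R) : seminorm q -> linear_set [set v | q v = 0].
Proof.
move=> sq; split=> [|a u w /= qu qw]; first exact: seminorm0.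
apply/eqP; rewrite eq_le seminorm_ge0// andbT (le_trans (sq.1 _ _))//.
by rewrite sq.2 qu qw mulr0 addr0.
Qed.

Lemma null_closed V (q : V -> R) : frechet V -> csemi q -> closed [set v | q v = 0].
Proof.
move=> fV cq w cw /=; have sq := cq.1; apply/eqP; rewrite eq_le seminorm_ge0// andbT.
apply/ler_addgt0Pr => e e0; rewrite add0r.
have [u qu wu] := (closure_csemi fV _ _).1 cw q cq e e0.
by rewrite -(subrK u w) (le_trans (sq.1 _ _))// qu addr0 ltW.
Qed.

End Seminorms.

(** * The filtration by powers of the Lie algebra *)

Section Calculus.
Context (R : realType).
Local Notation C := R[i].
Implicit Types V W : topologicalLmodType C.

Lemma is_derive_cvg (f : R -> R) (x l : R) :
  (fun h => h^-1 * (f (h + x) - f x)) @ 0^' --> l -> is_derive x (1 : R) f l.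
Proof.
move=> h.
have h' : (fun h : R => h^-1 *: (f (h *: (1 : R) + x) - f x)) @ 0^' --> l.
  by rewrite (_ : (fun h => _) = (fun h => h^-1 * (f (h + x) - f x)))//;
    apply/funext => y; rewrite [y *: 1]mulr1.
apply: DeriveDef; first by apply/cvg_ex; exists l.
exact: cvg_lim.
Qed.

Lemma linear_map0 V W (f : V -> W) : linear f -> f 0 = 0.
Proof. by move=> fl; have := fl (-1) 0 0; rewrite scaler0 addr0 scaleN1r addNr. Qed.

Lemma linear_mapZ V W (f : V -> W) : linear f -> forall a v, f (a *: v) = a *: f v.
Proof. by move=> fl a v; rewrite -[a *: v]addr0 fl linear_map0// addr0. Qed.

Lemma linear_mapD V W (f : V -> W) : linear f -> forall v w, f (v + w) = f v + f w.
Proof. by move=> fl v w; rewrite -[v in LHS]scale1r fl scale1r. Qed.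

Lemma linear_mapB V W (f : V -> W) : linear f -> forall v w, f (v - w) = f v - f w.
Proof. by move=> fl v w; rewrite linear_mapD// -scaleN1r linear_mapZ// scaleN1r. Qed.

Lemma linear_map_sum V W (f : V -> W) : linear f -> forall (I : Type) (r : seq I) (F : I -> V),
  f (\sum_(i <- r) F i) = \sum_(i <- r) f (F i).
Proof.
move=> fl I r F; elim: r => [|i r IH]; first by rewrite !big_nil linear_map0.
by rewrite !big_cons linear_mapD// IH.
Qed.

(** Each F_k is the closure of a span; through this lemma inclusions between such spaces are checked
    on generators only. *)
Lemma lin_closure_sub V W (f : V -> W) (A : set V) (S : set W) :
  linear f -> continuous f -> linear_set S -> closed S ->
  (forall v, A v -> S (f v)) -> forall v, closure (lspan A) v -> S (f v).
Proof.
move=> fl fc lS cS fA v cv; apply: cS => B /fc nB.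
have [_ [[r rA ->] Bx]] := cv _ nB; exists (f (\sum_(z <- r) z.1 *: z.2)); split=> //.
rewrite linear_map_sum//; apply: linear_set_sum => // z zr.
by rewrite linear_mapZ//; apply: linear_setZ => //; apply: fA; exact: rA.
Qed.

Lemma closure_lspan_sub V (A S : set V) : linear_set S -> closed S ->
  A `<=` S -> closure (lspan A) `<=` S.
Proof.
by move=> lS cS AS v; apply: (@lin_closure_sub V V id) => // x; exact: cvg_id.
Qed.

Lemma derivative_at0_lin V W (f : V -> W) (c : R -> V) v :
  linear f -> continuous f -> derivative_at0 c v -> derivative_at0 (f \o c) (f v).
Proof.
move=> fl fc cv; rewrite /derivative_at0.
have -> : (fun t : R => (t^-1)%:C%C *: ((f \o c) t - (f \o c) 0))
    = f \o (fun t : R => (t^-1)%:C%C *: (c t - c 0)).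
  by apply/funext => t /=; rewrite (linear_mapZ fl) (linear_mapB fl).
by apply: cvg_comp; [exact: cv|exact: fc].
Qed.

Lemma dnbhs0P (A : set R) : (0 : R)^' A <->
  exists2 d : R, 0 < d & forall t, t != 0 -> `|t| < d -> A t.
Proof.
split=> [/nbhs_ballP[d d0 h]|[d d0 h]]; last first.
  apply/nbhs_ballP; exists d => // t; rewrite -ball_normE /= sub0r normrN => td t0.
  exact: h.
exists d => // t t0 td; apply: h => //.
by rewrite -ball_normE /= sub0r normrN.
Qed.

Lemma derivative_at0P V (c : R -> V) w : frechet V -> derivative_at0 c w <->
  forall p, csemi p -> forall e : R, 0 < e -> exists2 d : R, 0 < d &
    forall t, t != 0 -> `|t| < d -> p ((t^-1)%:C%C *: (c t - c 0) - w) < e.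
Proof.
move=> fV; rewrite /derivative_at0 (@cvg_csemi _ _ fV _ _ (dnbhs_filter _)).
by split=> h p cp e e0; apply/dnbhs0P; exact: h.
Qed.

(** Take for q the distance to S. As q kills f' x, the q-size of the increments of f is o(t), so the
    real function t -> q (f t - f y) has derivative zero and keeps its value 0 at y. This takes the
    place of a vector-valued integral. *)
Lemma mean_value V (S : set V) (f f' : R -> V) : frechet V -> linear_set S -> closed S ->
  (forall x, derivative_at0 (fun t => f (x + t)) (f' x)) -> (forall x, S (f' x)) ->
  forall x y, S (f x - f y).
Proof.
move=> fV lS cS df fS x y; apply: cS; apply/closure_pdist => // p cp.
have cq := pdist_csemi cp lS; set q := pdist p S in cq *.
have sq := cq.1.
have -> : q (f x - f y) = q (f y - f y).
  apply: (@is_derive_0_is_cst _ (fun t => q (f t - f y))) => z.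
  apply: is_derive_cvg; apply/cvgrPdist_lt => e e0.
  have [d d0 nq] := (derivative_at0P _ _ fV).1 (df z) q cq e e0.
  apply/dnbhs0P; exists d => // t t0 td; have h := nq t t0 td.
  rewrite /= sub0r normrN normrM [t + z]addrC; move: h; rewrite addr0 => h.
  apply: le_lt_trans h; set u := _%:C%C *: _.
  have -> : `|t^-1| * `|q (f (z + t) - f y) - q (f z - f y)| <= q (u - f' z).
    apply: (@le_trans _ _ (q u)).
      rewrite /u seminorm_real// ler_wpM2l//.
      apply: (le_trans (seminorm_lip sq _ _)).
      by rewrite opprB addrA subrK.
    have -> : u = (u - f' z) + f' z by rewrite subrK.
    rewrite (le_trans (sq.1 _ _))// addrK gerDl.
    by rewrite /q pdist_eq0//; exact: cp.1.
  by [].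
by rewrite subrr seminorm0.
Qed.

End Calculus.

(** * The operators g - 1 and the filtration F_k *)

Section Augmentation.
Context (R : realType) (G : topologicalGroupType).
Variables (P N : set G) (s : G -> R).
Local Notation mul := (fun x y : G => (x * y)%g).
Local Notation inv := (fun x : G => x^-1%g).
Hypotheses (subP : is_subgroup mul inv 1%g P) (nN : is_normal_in mul inv P N).

Lemma one_param0 (H : set G) (c : R -> G) : one_param H c -> c 0 = 1%g.
Proof.
by move=> [_ cD _]; apply: (mulgI (c 0)); rewrite -cD addr0 mulg1.
Qed.

Lemma one_paramS (H K : set G) (c : R -> G) : H `<=` K -> one_param H c -> one_param K c.
Proof. by move=> HK [cc cD cH]; split=> // t; exact: HK. Qed.

Lemma one_param_scale (H : set G) (c : R -> G) (a : R) : one_param H c ->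
  one_param H (fun t : R => c (a * t)).
Proof.
move=> [cc cD cH]; split=> [|x y|t]; last exact: cH.
- move=> t; apply: continuous_comp; last exact: cc.
  by apply: continuousM; [exact: cst_continuous|exact: cvg_id].
- by rewrite mulrDr cD.
Qed.

(** For H = N this is exp(n), a subset of N that is stable under powers. *)
Definition exp_of (H : set G) : set G :=
  [set g | exists2 c : R -> G, one_param H c & g = c 1].

Lemma exp_of_sub H g : exp_of H g -> H g.
Proof. by move=> [c [_ _ cH] ->]. Qed.

Lemma exp_of_one_param H (c : R -> G) t : one_param H c -> exp_of H (c t).
Proof. by move=> Hc; exists (fun x => c (t * x)); [exact: one_param_scale|rewrite mulr1]. Qed.

Lemma one_param_natmul H (c : R -> G) (t : R) u : one_param H c -> c (u%:R * t) = (c t ^+ u)%g.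
Proof.
move=> Hc; elim: u => [|u IH]; first by rewrite mul0r (one_param0 Hc).
by rewrite expgS -IH; case: Hc => _ <- _; rewrite -natr1 mulrDl mul1r addrC.
Qed.

Lemma exp_ofX H g u : exp_of H g -> exp_of H (g ^+ u)%g.
Proof.
move=> [c Hc ->]; rewrite -(one_param_natmul _ _ Hc); exact: exp_of_one_param.
Qed.

Variable V : representation R G.
Hypothesis rP : Rep P s V.
Let fV : frechet V := Rep_frechet rP.

Let NP g : N g -> P g. Proof. exact: nN.1. Qed.

Definition Fil k : set V := closure (npow N k).

Lemma Fil_linear k : linear_set (Fil k).
Proof. exact/closure_linear/lspan_linear. Qed.

Lemma Fil_closed k : closed (Fil k).
Proof. exact: closed_closure. Qed.

Lemma Fil0 v : Fil 0 v.
Proof. exact/subset_closure/sub_lspan. Qed.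

Lemma FilS k v : Fil k.+1 v -> Fil k v.
Proof. exact/closure_subset/npow_decr. Qed.

Lemma Fil_le k l v : (k <= l)%N -> Fil l v -> Fil k v.
Proof.
elim: l => [|l IH]; first by rewrite leqn0 => /eqP ->.
by rewrite leq_eqVlt => /predU1P[->//|]; rewrite ltnS => /IH h /FilS /h.
Qed.

Lemma act_compat g : P g -> N_compatible N (rep_act (r := V) g).
Proof. exact: rep_act_N_compatible rP subP nN. Qed.

Lemma act_linear g : P g -> linear (rep_act (r := V) g).
Proof. by case/act_compat. Qed.

Lemma act_continuous g : P g -> continuous (rep_act (r := V) g).
Proof. by case/act_compat. Qed.

Lemma act_Fil g k v : P g -> Fil k v -> Fil k (rep_act g v).
Proof. by move=> Pg; exact: N_compatible_npow_cl (act_compat Pg) k v. Qed.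

Definition act1 g (v : V) : V := rep_act g v - v.

Lemma act1_linear g : P g -> linear (act1 g).
Proof.
move=> Pg a v w; rewrite /act1 (act_linear Pg) scalerBr opprD addrACA.
by [].
Qed.

Lemma act1_continuous g : P g -> continuous (act1 g).
Proof.
move=> Pg; apply: (continuous_comp2 (f := rep_act (r := V) g) (g := fun v => - v)
  _ _ (@add_continuous V)); first exact: act_continuous.
move=> v; rewrite (_ : (fun v => - v) = (fun v : V => (-1 : R[i]) *: v)).
  exact: lmod_scale_continuous.
by apply/funext => w; rewrite scaleN1r.
Qed.

Lemma orbit_derivative (c : R -> G) (v : V) : one_param P c ->
  exists w, derivative_at0 (fun t => rep_act (c t) v) w.
Proof.
move=> Pc; have [_ /(_ c Pc)[f' hf' _]] := Rep_smooth rP v 1.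
exists (f' 1%g); have := hf' 1%g; case: subP => P1 _ _ /(_ P1).
by rewrite (_ : (fun t => rep_act (1 * c t)%g v) = (fun t => rep_act (c t) v))//;
  apply/funext => t; rewrite mul1g.
Qed.

(** The derivative of t -> c(t) v at x is c(x) w, which stays in S by stability, so [mean_value]
    applies between 0 and t. *)
Lemma act1_in (S : set V) (c : R -> G) v w t : one_param P c -> linear_set S -> closed S ->
  (forall x u, S u -> S (rep_act (c x) u)) ->
  derivative_at0 (fun t => rep_act (c t) v) w -> S w -> S (act1 (c t) v).
Proof.
move=> Pc lS cS SS dv Sw; have [_ cD cP] := Pc.
have := @mean_value R V S (fun t => rep_act (c t) v) (fun t => rep_act (c t) w) fV lS cS.
move=> /(_ _ _ t 0); rewrite (one_param0 Pc) (Rep_one rP); apply=> [x|x]; last exact: SS.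
have := derivative_at0_lin (act_linear (cP x)) (@act_continuous _ (cP x)) dv.
rewrite (_ : _ \o _ = (fun t => rep_act (c (x + t)) v))//.
by apply/funext => y /=; rewrite cD (Rep_mul rP).
Qed.

Lemma act1_Fil g k v : exp_of N g -> Fil k v -> Fil k.+1 (act1 g v).
Proof.
move=> [c Nc ->]; have Pc := one_paramS nN.1 Nc; have [_ _ cP] := Pc.
apply: lin_closure_sub; [exact: act1_linear|exact: act1_continuous|
  exact: Fil_linear|exact: Fil_closed|].
move=> {}v Av; have [w dw] := orbit_derivative v Pc.
apply: (act1_in 1 Pc _ _ _ dw); [exact: Fil_linear|exact: Fil_closed| |].
  by move=> x u; exact: act_Fil.
by apply/subset_closure/sub_lspan; exists c, v.
Qed.

Lemma derivative_in_closure (S : set V) (c : R -> G) v w : linear_set S -> 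
  (forall t, S (act1 (c t) v)) -> c 0 = 1%g ->
  derivative_at0 (fun t => rep_act (c t) v) w -> closure S w.
Proof.
move=> lS Sc c0 dw; apply/closure_csemi => // p cp e e0.
have [d d0 pd] := (derivative_at0P _ _ fV).1 dw p cp e e0.
have d2 : 0 < d / 2 by rewrite divr_gt0.
have := pd (d / 2); rewrite gt_eqF// gtr0_norm// ltr_pdivrMr// ltr_pMr// ltr1n.
move=> /(_ isT isT); set t := d / 2 => pt.
exists ((t^-1)%:C%C *: act1 (c t) v); first exact: linear_setZ.
by move: pt; rewrite c0 (Rep_one rP) seminormB//; exact: cp.1.
Qed.

(** Converse of [act1_Fil]: X.w is a limit of the quotients t^-1 (c(t) - 1) w, so the vectors (g -
    1) w generate F_(k+1) topologically. *)
Lemma Fil_step k : Fil k.+1 `<=`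
  closure (lspan [set u | exists g w, [/\ exp_of N g, Fil k w & u = act1 g w]]).
Proof.
apply: closure_lspan_sub; first exact/closure_linear/lspan_linear.
  exact: closed_closure.
move=> w [c [v [Nc Av dv]]].
apply: derivative_in_closure dv; [exact: lspan_linear| |exact: one_param0 Nc].
move=> t; apply: sub_lspan; exists (c t), v; split=> //.
  exact: exp_of_one_param.
exact/subset_closure/sub_lspan.
Qed.

(** The product (g_1 - 1) ... (g_k - 1) applied to v, that is, an element of the k-th power of the
    augmentation ideal of the group algebra. *)
Definition aug (gs : seq G) (v : V) : V := foldr act1 v gs.

Lemma Fil_aug k : Fil k `<=`
  closure (lspan [set u | exists (gs : seq G) v,
    [/\ size gs = k, forall g, g \in gs -> exp_of N g & u = aug gs v]]).
Proof.
elim: k => [|k IH].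
  move=> v _; apply/subset_closure/sub_lspan; by exists [::], v; split.
move=> v /Fil_step; apply: closure_lspan_sub.
- exact/closure_linear/lspan_linear.
- exact: closed_closure.
move=> _ [g [w [Eg /IH Fw ->]]]; have Pg : P g := NP (exp_of_sub Eg).
move: Fw; apply: lin_closure_sub; [exact: act1_linear|exact: act1_continuous|
  exact/closure_linear/lspan_linear|exact: closed_closure|].
move=> _ [gs [u [sgs Egs ->]]]; apply/subset_closure/sub_lspan.
exists (g :: gs), u; split=> //=; first by rewrite sgs.
by move=> h; rewrite inE => /predU1P[->//|]; exact: Egs.
Qed.

Lemma aug_Fil gs v : (forall g, g \in gs -> exp_of N g) -> Fil (size gs) (aug gs v).
Proof.
elim: gs => [|g gs IH] h; first exact: Fil0.
apply: act1_Fil; first by apply: h; exact: mem_head.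
by apply: IH => g' g'gs; apply: h; rewrite inE g'gs orbT.
Qed.

(** Induction on u from g^(u+1) - 1 - (u+1)(g - 1) = (g - 1)(g^u - 1) + (g^u - 1 - u(g - 1)), whose
    first term raises the filtration by two. *)
Lemma act1X_Fil g u k v : exp_of N g -> Fil k v ->
  Fil k.+2 (act1 (g ^+ u)%g v - u%:R *: act1 g v).
Proof.
move=> Eg Fv; have Pg : P g := NP (exp_of_sub Eg).
elim: u => [|u IH].
  by rewrite /act1 expg0 (Rep_one rP) subrr scale0r subrr; exact: (Fil_linear _).1.
have Pgu : P (g ^+ u)%g := NP (exp_of_sub (exp_ofX u Eg)).
rewrite (_ : _ - _ = act1 g (act1 (g ^+ u)%g v) + (act1 (g ^+ u)%g v - u%:R *: act1 g v)).
  apply: (linear_setD (Fil_linear k.+2)); last exact: IH.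
  by apply: act1_Fil => //; apply: act1_Fil => //; exact: exp_ofX.
rewrite -natr1 scalerDl scale1r opprD [- _ - _]addrC !addrA; congr (_ - _).
rewrite /act1 expgS (Rep_mul rP)// (linear_mapB (act_linear Pg)).
by rewrite !opprB !addrA !subrK addrK.
Qed.

Lemma aug_expg gs u v : (forall g, g \in gs -> exp_of N g) ->
  Fil (size gs).+1 (aug [seq (g ^+ u)%g | g <- gs] v - (u ^ size gs)%:R *: aug gs v).
Proof.
elim: gs => [|g gs IH] h.
  by rewrite /= expn0 scale1r subrr; exact: (Fil_linear _).1.
have Eg : exp_of N g by apply: h; exact: mem_head.
have Egs g' : g' \in gs -> exp_of N g' by move=> g'gs; apply: h; rewrite inE g'gs orbT.
have lg := act1_linear (NP (exp_of_sub Eg)).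
have {}IH := IH Egs; move: IH; rewrite /=.
set a := aug _ v; set b := aug _ v; set k := size gs => IH.
have Fa : Fil k a.
  rewrite /a /k -(size_map (fun g => (g ^+ u)%g)); apply: aug_Fil.
  by move=> _ /mapP[g' /Egs Eg' ->]; exact: exp_ofX.
(* The head factor g^u - 1 is first replaced by u(g - 1), which costs an error two steps deeper than
   a; then the tail is replaced by induction, and g - 1 lifts its error by one step. *)
rewrite (_ : _ - _ = (act1 (g ^+ u)%g a - u%:R *: act1 g a)
                   + u%:R *: act1 g (a - (u ^ k)%:R *: b)).
  apply: (linear_setD (Fil_linear _)); first exact: act1X_Fil.
  by apply: (linear_setZ (Fil_linear _)); exact: act1_Fil.
rewrite (linear_mapB lg) (linear_mapZ lg) [X in _ = _ + X]scalerBr addrA subrK scalerA.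
by rewrite -natrM -expnS.
Qed.

Definition gprod u (gs : seq G) : G := foldr (fun g h => (g ^+ u * h)%g) 1%g gs.

Lemma gprod_rcons u gs g : gprod u (rcons gs g) = (gprod u gs * g ^+ u)%g.
Proof. by elim: gs => [|h gs IH] /=; rewrite ?mulg1 ?mul1g// IH mulgA. Qed.

Lemma subgroup_expg (H : set G) g u : is_subgroup mul inv 1%g H -> H g -> H (g ^+ u)%g.
Proof.
move=> [H1 HM _] Hg; elim: u => [|u IH]; first by rewrite expg0.
by rewrite expgS; exact: HM.
Qed.

Lemma subgroup_gprod (H : set G) gs u : is_subgroup mul inv 1%g H ->
  (forall g, g \in gs -> H g) -> H (gprod u gs).
Proof.
move=> sH; have [H1 HM _] := sH; elim: gs => [//|g gs IH] h /=.
apply: HM; first by apply: subgroup_expg => //; apply: h; exact: mem_head.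
by apply: IH => g' g'gs; apply: h; rewrite inE g'gs orbT.
Qed.

Hypothesis s0 : forall g, 0 < s g.
(** The order of the quantifiers matters: D is chosen before gs and hence before its length, while C
    may depend on gs. [scale_growth] establishes this for unipotent N. *)
Hypothesis grow : exists D : nat, forall gs : seq G, (forall g, g \in gs -> N g) ->
  exists C : R, forall u : nat, s (gprod u gs) <= C * u.+1%:R ^+ D.

Lemma seminorm_growth (p : V -> R) : csemi p -> exists D : nat,
  forall (gs : seq G) v, (forall g, g \in gs -> N g) ->
  exists C : R, forall u : nat, p (rep_act (gprod u gs) v) <= C * u.+1%:R ^+ D.
Proof.
move=> [sp cp]; have [r [p2 [sp2 cp2 h]]] := Rep_moderate rP sp cp.
have [D hD] := grow; exists (D * r)%N => gs v Ngs.
have [C hC] := hD gs Ngs; exists (C ^+ r * p2 v) => u.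
have Pg : P (gprod u gs) by apply: subgroup_gprod => // g /Ngs /NP.
rewrite (le_trans (h _ v Pg))// mulrAC ler_wpM2r ?(seminorm_ge0 sp2)//.
rewrite exprM -exprMn lerXn2r// ?nnegrE ?(ltW (s0 _))//.
exact: le_trans (ltW (s0 _)) (hC u).
Qed.

(* D does not depend on the length of gs. *)
Lemma aug_growth (p : V -> R) : csemi p -> exists D : nat,
  forall (gs : seq G) v, (forall g, g \in gs -> N g) ->
  exists C : R, forall u : nat,
    p (aug [seq (g ^+ u)%g | g <- gs] v) <= C * u.+1%:R ^+ D.
Proof.
move=> cp; have [D hD] := seminorm_growth cp; exists D => gs v Ngs.
(* The list hs holds the factors already multiplied out on the left. Expanding g^u - 1 gives two
   terms, one in which g joins hs and one in which it disappears; both keep the same D. *)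
suff H hs : (forall g, g \in hs -> N g) -> exists C : R, forall u : nat,
    p (rep_act (gprod u hs) (aug [seq (g ^+ u)%g | g <- gs] v)) <= C * u.+1%:R ^+ D.
  have [|C hC] := H [::]; first by [].
  by exists C => u; have := hC u; rewrite /= (Rep_one rP).
elim: gs hs Ngs => [|g gs IH] hs Ngs Nhs; first exact: hD.
have Ng : N g by apply: Ngs; exact: mem_head.
have Ngs' g' : g' \in gs -> N g' by move=> g'gs; apply: Ngs; rewrite inE g'gs orbT.
have [|C1 h1] := IH (rcons hs g) Ngs'.
  by move=> g'; rewrite mem_rcons inE => /predU1P[->//|]; exact: Nhs.
have [C2 h2] := IH hs Ngs' Nhs; exists (C1 + C2) => u /=.
have Pgu : P (g ^+ u)%g by apply: subgroup_expg => //; exact: NP.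
have Ph : P (gprod u hs) by apply: subgroup_gprod => // g' /Nhs /NP.
rewrite {1}/act1 (linear_mapB (act_linear Ph)) -(Rep_mul rP)// -gprod_rcons.
by rewrite (le_trans (seminorm_triB cp.1 _ _))// mulrDl lerD.
Qed.

Lemma le0_of_growth (k D : nat) (x C : R) : (D < k)%N ->
  (forall u : nat, u%:R ^+ k * x <= C * u.+1%:R ^+ D) -> x <= 0.
Proof.
move=> Dk h; rewrite leNgt; apply/negP => x0.
(* As u + 1 <= 2u, the right side is at most C 2^D u^D, and u > C 2^D / x makes this less than
   u^(D+1) x, hence than u^k x. The case u = 0 of the assumption gives C >= 0. *)
pose y := C * 2 ^+ D / x; pose u := (Num.trunc `|y|).+1.
have yu : y < u%:R by rewrite (le_lt_trans (ler_norm _))// truncnS_gt.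
have u1 : 1 <= u%:R :> R by rewrite ler1n.
have := h u; apply/negP; rewrite -ltNge.
have C0 : 0 <= C.
  have := h 0; rewrite expr0n; case: k Dk {h} => // k _.
  by rewrite mul0r expr1n mulr1.
apply: (@le_lt_trans _ _ (C * 2 ^+ D * u%:R ^+ D)).
  rewrite -mulrA ler_wpM2l// -exprMn lerXn2r// ?nnegrE ?mulr_ge0//.
  by rewrite -natr1; lra.
move: yu; rewrite ltr_pdivrMr// => yu.
apply: (@lt_le_trans _ _ (u%:R * x * u%:R ^+ D)).
  by rewrite ltr_pM2r// exprn_gt0// ltr0n.
rewrite mulrAC -exprS ler_wpM2r ?(ltW x0)//.
by rewrite ler_weXn2l.
Qed.

Lemma Fil_stable_step (p : V -> R) : csemi p -> exists D : nat, forall k, (D < k)%N ->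
  forall v, Fil k v -> pdist p (Fil k.+1) v = 0.
Proof.
move=> cp; have [D hD] := aug_growth cp; exists D => k Dk v Fv.
have cq := pdist_csemi cp (Fil_linear k.+1); set q := pdist _ _ in cq *.
have sq := cq.1.
apply: (closure_lspan_sub (null_linear sq) (null_closed fV cq) _ (Fil_aug Fv)).
move=> _ [gs [{Fv}v [sgs Egs ->]]] /=.
have [C hC] := hD gs v (fun g gg => exp_of_sub (Egs g gg)).
apply/eqP; rewrite eq_le seminorm_ge0// andbT; apply: (le0_of_growth Dk (C := C)) => u.
have -> : u%:R ^+ k * q (aug gs v) = q ((u ^ k)%:R *: aug gs v).
  by rewrite sq.2 normc_nat natrX.
have Fd := @aug_expg gs u v Egs; rewrite sgs in Fd.
set a := aug [seq _ | _ <- _] v in hC Fd; set b := _ *: _ in Fd *.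
(* By [aug_expg] the difference a - b lies in F_(k+1), where q vanishes, so the multiple b of the
   generator may be traded for a, whose growth is known. *)
have -> : b = a - (a - b) by rewrite subKr.
rewrite (le_trans (seminorm_triB sq _ _))// [X in _ + X]pdist_eq0//; last 2 first.
- exact: cp.1.
- exact: Fil_linear.
rewrite addr0 (le_trans _ (hC u))//.
exact: (pdist_le cp.1 (Fil_linear _)).
Qed.

(** Induction on l. Up to rank D.+1 the filtration is decreasing and there is nothing to
    approximate; beyond it v is approximated in F_l, and [Fil_stable_step] passes from F_l to
    F_(l+1). *)
Lemma Fil_stable (p : V -> R) : csemi p -> exists m : nat, forall l v,
  Fil m v -> pdist p (Fil l) v = 0.
Proof.
move=> cp; have [D hD] := Fil_stable_step cp; exists D.+1.
have sp := cp.1.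
elim=> [|l IH] v Fv; first by apply: pdist_eq0; [| exact: Fil_linear|exact: Fil0].
have [lD|Dl] := leqP l.+1 D.+1.
  by apply: pdist_eq0; [| exact: Fil_linear|exact: Fil_le Fv].
apply/eqP; rewrite eq_le (pdist_ge0 sp (Fil_linear _)) andbT.
apply/ler_addgt0Pr => e e0; rewrite add0r.
have /pdist_lt : pdist p (Fil l) v < e by rewrite IH.
move=> /(_ sp (Fil_linear _))[w Fw vw].
have sq := pdist_seminorm sp (Fil_linear l.+1).
rewrite -(subrK w v) (le_trans (sq.1 _ _))// (hD l _ w)// addr0.
by rewrite (le_trans (pdist_le sp (Fil_linear _) _))// ltW.
Qed.

End Augmentation.

(** * The Mittag-Leffler argument *)

Section MittagLeffler.
Context (R : realType).
Local Notation C := R[i].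
Variable V : topologicalLmodType C.
Hypothesis fV : frechet V.
Variable p : nat -> V -> R.
Hypothesis bp : semi_basis p.

(** Lets an approximation start at a seminorm that already dominates a prescribed one. *)
Lemma semi_basis_shift j0 : semi_basis (fun j => p (j0 + j)%N).
Proof.
have [cp pS pA] := bp; split=> [k|k v|A]; [exact: cp|by rewrite addnS|].
rewrite pA; split=> -[m [e [e0 h]]]; last by exists (j0 + m)%N, e.
exists m, e; split=> // v /= pv; apply: h => /=; apply: le_lt_trans pv.
by apply: semi_basis_le => //; exact: leq_addl.
Qed.

Lemma exp2_small (d e : R) : 0 < e -> exists m, d / 2 ^+ m < e.
Proof.
move=> e0; exists (Num.trunc `|d / e|).+1.
rewrite ltr_pdivrMr ?exprn_gt0// mulrC -ltr_pdivrMr//.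
apply: (le_lt_trans (ler_norm _)); apply: (lt_trans (truncnS_gt _)).
by rewrite -natrX ltr_nat ltn_expl.
Qed.

Lemma telescope_cvg (w : nat -> V) (d : R) : 0 < d ->
  (forall j, p j (w j - w j.+1) <= d / 2 ^+ j.+1) ->
  exists l : V, w @ \oo --> l /\ forall j, p j (w j - l) <= d.
Proof.
move=> d0 hw; have [cp pS pA] := bp.
(* The exact partial sum of the geometric series is kept so that the induction on k closes. *)
have h2 i j k : (i <= j)%N -> p i (w j - w (j + k)%N) <= d / 2 ^+ j - d / 2 ^+ (j + k).
  move=> ij; elim: k => [|k IH].
    by rewrite addn0 !subrr seminorm0//; exact: (cp i).1.
  rewrite addnS (le_trans (seminorm_dist (cp i).1 _ (w (j + k)%N) _))//.
  have : p i (w (j + k)%N - w (j + k).+1) <= d / 2 ^+ (j + k).+1.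
    apply: le_trans (hw _); apply: semi_basis_le => //.
    by rewrite (leq_trans ij)// leq_addr.
  have E : d / 2 ^+ (j + k) = 2 * (d / 2 ^+ (j + k).+1).
    by rewrite exprS; field; rewrite expf_neq0.
  by move: IH; rewrite E; lra.
have h3 i j k : (i <= j)%N -> (j <= k)%N -> p i (w j - w k) <= d / 2 ^+ j.
  move=> ij jk; rewrite -(subnKC jk) (le_trans (h2 i j _ ij))// gerBl.
  by rewrite divr_ge0 ?exprn_ge0// ltW.
have [l wl] : exists l : V, w @ \oo --> l.
  apply: (frechet_complete fV) => A /pA[m [e [e0 h]]].
  have [m1 hm1] := exp2_small (2 * d) e0.
  exists (maxn m m1) => j k; rewrite !geq_max => /andP[mj m1j] /andP[mk m1k].
  apply: h => /=; have mm := leq_maxl m m1; set m0 := maxn m m1 in mm *.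
  have m0j : (m0 <= j)%N by rewrite geq_max mj.
  have m0k : (m0 <= k)%N by rewrite geq_max mk.
  apply: (le_lt_trans _ hm1).
  apply: (le_trans (seminorm_dist (cp m).1 _ (w m0) _)).
  rewrite (seminormB (cp m).1 (w j)).
  have H : d / 2 ^+ m0 <= d / 2 ^+ m1.
    rewrite ler_pM2l// lef_pV2 ?posrE ?exprn_gt0//.
    by rewrite ler_weXn2l ?ler1n//; exact: leq_maxr.
  rewrite -mulrA mulr_natl mulr2n lerD// (le_trans _ H)//; exact: h3.
exists l; split=> // j; apply/ler_addgt0Pr => e e0.
have [m _ hm] := (cvg_csemi fV _ _).1 wl _ (cp j) e e0.
apply: (le_trans (seminorm_dist (cp j).1 _ (w (maxn j m)) _)).
apply: lerD; last by rewrite ltW//; apply: hm => /=; exact: leq_maxr.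
apply: (le_trans (h3 _ _ _ (leqnn j) (leq_maxl _ _))).
by rewrite ler_pdivrMr ?exprn_gt0// ler_peMr ?(ltW d0)// exprn_ege1// ler1n.
Qed.

End MittagLeffler.

Lemma cvg_closed_seq (T : topologicalType) (w : nat -> T) (l : T) (S : set T) k :
  closed S -> (forall i, (k <= i)%N -> S (w i)) -> w @ \oo --> l -> S l.
Proof.
move=> cS wS wl; apply: cS => B /wl[m _ hm].
exists (w (maxn k m)); split; first by apply: wS; exact: leq_maxl.
by apply: hm => /=; exact: leq_maxr.
Qed.

Lemma monotone_choice (Q : nat -> nat -> Prop) :
  (forall j k l, (k <= l)%N -> Q j k -> Q j l) -> (forall j, exists m, Q j m) ->
  exists M : nat -> nat, [/\ forall j, Q j (M j), forall j, (j <= M j)%N &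
    forall j k, (j <= k)%N -> (M j <= M k)%N].
Proof.
(* Partial sums are monotone and dominate each M j; the successors make the j-th one at least j. *)
move=> QS /choice[M hM]; exists (fun j => (\sum_(0 <= i < j.+1) (M i).+1)%N).
split=> [j|j|j k jk].
- apply: QS (hM j); rewrite big_nat_recr//= addnS ltnW// ltnS; exact: leq_addl.
- elim: j => [//|j IH]; rewrite big_nat_recr//= addnS ltnS.
  by rewrite (leq_trans IH)// leq_addr.
- rewrite -(subnKC jk); elim: (k - j)%N => [|d IH]; first by rewrite addn0.
  by rewrite addnS [X in (_ <= X)%N]big_nat_recr//= (leq_trans IH)// leq_addr.
Qed.

(** * The natural map from V to the inverse limit *)

Section Projection.
Context (R : realType) (G : topologicalGroupType).
Variables (N : set G) (V : representation R G).

Lemma CJ_eqP (x y : CJ_space N V) : (forall k, val x k = val y k) -> x = y.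
Proof. by move=> h; apply: val_inj; apply: functional_extensionality_dep. Qed.

Lemma CJ_projE v k : val (CJ_proj N V v) k = npi N k v.
Proof. by []. Qed.

Lemma CJ_proj_linear : linear (CJ_proj N V).
Proof.
move=> a v w; apply: CJ_eqP => k.
rewrite CJ_projE /npi (qpi_linear (npow_cl N k)); by [].
Qed.

Lemma CJ_proj_continuous : continuous (CJ_proj N V).
Proof.
apply: continuous_sub_space; apply: continuous_prod_space => k.
exact: (@qpi_continuous _ _ (npow_cl N k)).
Qed.

Lemma CJ_coord_continuous k : continuous (fun x : CJ_space N V => val x k).
Proof.
move=> x A nA; have := @prod_space_proj_continuous _ _ (@nquot R G N V) k (val x) A nA.
exact: (@sub_space_val_continuous _ _ (@coherent R G N V) x).
Qed.

Lemma npi_eq k (v w : V) : npi N k v = npi N k w <-> Fil N k (v - w).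
Proof.
rewrite /npi; split=> [/qpi_eq|h]; first by rewrite inE.
by apply/qpi_eq; rewrite inE.
Qed.

Lemma CJ_proj_eq v w : CJ_proj N V v = CJ_proj N V w <-> CJs_set N V (v - w).
Proof.
split=> [h k _|h]; first by apply/npi_eq; rewrite -!CJ_projE h.
by apply: CJ_eqP => k; rewrite !CJ_projE; apply/npi_eq/h.
Qed.

Lemma CJ_proj0 : CJ_proj N V 0 = 0.
Proof. exact: linear_map0 CJ_proj_linear. Qed.

Lemma CJ_proj_ker v : CJ_proj N V v = 0 <-> CJs_set N V v.
Proof. by rewrite -{1}CJ_proj0 CJ_proj_eq subr0. Qed.

Lemma CJs_set_linear : linear_set (CJs_set N V).
Proof.
split=> [k _|a v w hv hw k _]; first exact: (@Fil_linear R G N V _).1.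
by apply: (@Fil_linear R G N V _).2; [exact: hv|exact: hw].
Qed.

Lemma CJs_set_closed : closed (CJs_set N V).
Proof. by apply: closed_bigI => k _; exact: Fil_closed. Qed.

Hypothesis fV : frechet V.
Hypothesis stable : forall p : V -> R, csemi p -> exists m : nat, forall l v,
  Fil N m v -> pdist p (Fil N l) v = 0.

Lemma Fil_approx (p : V -> R) : csemi p -> exists m : nat, forall l v (e : R), 0 < e ->
  Fil N m v -> exists2 w, Fil N l w & p (v - w) < e.
Proof.
move=> cp; have [m hm] := stable cp; exists m => l v e e0 Fv.
by apply: (pdist_lt cp.1 (@Fil_linear R G N V _)); rewrite hm.
Qed.

(** From v one moves successively into F_(M 1), F_(M 2), ... with errors that are summable for the
    increasing seminorms. The limit lies in every F_k because M j >= j, and it has stayed close to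
    v. *)
Lemma Fil_CJs_dense (q : V -> R) : csemi q -> exists m : nat, forall v (e : R), 0 < e ->
  Fil N m v -> exists2 z, CJs_set N V z & q (v - z) < e.
Proof.
move=> cq; have [p0 bp0] := frechet_semi_basis fV.
have [j0 [c c0 qp]] := csemi_dominated bp0 cq.
have {bp0} bp := semi_basis_shift bp0 j0; set p := fun j => _ in bp.
have qp0 v : q v <= c * p 0 v by rewrite /p addn0.
have [cp _ _] := bp.
have [M [hM jM _]] := @monotone_choice
  (fun j m => forall l v (e : R), 0 < e -> Fil N m v -> exists2 w, Fil N l w & p j (v - w) < e)
  (fun j k l kl h i v e e0 Fv => h i v e e0 (Fil_le kl Fv)) (fun j => Fil_approx (cp j)).
(* Since q <= c p_0, a total displacement of at most d gives q (v - l) <= e / 2. *)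
exists (M 0) => v e e0 Fv; pose d := e / c / 2.
have d0 : 0 < d by rewrite !divr_gt0.
(* Choosing for all pairs at once, with the irrelevant value 0 outside F_(M j), makes the sequence a
   plain recursion; membership is proved afterwards. *)
have /choice[f hf] : forall ju : nat * V, exists w, Fil N (M ju.1) ju.2 ->
    Fil N (M ju.1.+1) w /\ p ju.1 (ju.2 - w) < d / 2 ^+ ju.1.+1.
  move=> [j u]; have [Fu|nFu] := pselect (Fil N (M j) u); last by exists 0.
  have [|w Fw pw] := hM j (M j.+1) u (d / 2 ^+ j.+1) _ Fu.
    by rewrite divr_gt0// exprn_gt0.
  by exists w.
pose w := fix w j := if j is j'.+1 then f (j', w j') else v.
have wF j : Fil N (M j) (w j).
  by elim: j => [//|j IH] /=; exact: (hf (j, w j) IH).1.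
have [l [wl pl]] : exists l : V, w @ \oo --> l /\ forall j, p j (w j - l) <= d.
  apply: telescope_cvg => // j; apply: ltW; exact: (hf (j, w j) (wF j)).2.
exists l => [k _|].
  apply: (cvg_closed_seq (k := k) _ _ wl); first exact: Fil_closed.
  by move=> i ki; apply: Fil_le (wF i); exact: leq_trans ki (jM i).
apply: (le_lt_trans (qp0 _)); rewrite mulrC -ltr_pdivlMr//.
apply: (le_lt_trans (pl 0)); rewrite /d ltr_pdivrMr// ltr_pMr ?ltr1n// divr_gt0//.
Qed.

(** Representatives v_k of the coordinates of x need not converge. They may be corrected by elements
    of CJ_s without changing any coordinate, and the density of CJ_s makes the corrected sequence
    Cauchy. *)
Lemma CJ_proj_surj (x : CJ_space N V) : exists v, CJ_proj N V v = x.
Proof.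
have /choice[v hv] : forall k, exists v, npi N k v = val x k.
  by move=> k; have [v ->] := qpi_surj (val x k); exists v.
have vS k d : Fil N k (v (k + d)%N - v k).
  elim: d => [|d IH]; first by rewrite addn0 subrr; exact: (@Fil_linear R G N V _).1.
  rewrite addnS -[X in Fil _ _ X](subrKA (v (k + d)%N)).
  apply: (linear_setD (@Fil_linear R G N V k)) => //.
  apply: (@Fil_le _ _ _ _ _ (k + d)%N); first exact: leq_addr.
  apply/npi_eq; rewrite hv; have /asboolP := valP x; apply.
  exact: hv.
have vSl k l : (k <= l)%N -> Fil N k (v l - v k) by move=> /subnKC <-; exact: vS.
have [p bp] := frechet_semi_basis fV; have [cp _ _] := bp.
have [M [hM jM Mm]] := @monotone_choice
  (fun j m => forall v (e : R), 0 < e -> Fil N m v -> exists2 z, CJs_set N V z & p j (v - z) < e)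
  (fun j k l kl h v e e0 Fv => h v e e0 (Fil_le kl Fv)) (fun j => Fil_CJs_dense (cp j)).
have /choice[f hf] : forall ju : nat * V, exists z, Fil N (M ju.1) ju.2 ->
    CJs_set N V z /\ p ju.1 (ju.2 - z) < 1 / 2 ^+ ju.1.+1.
  move=> [j u]; have [Fu|nFu] := pselect (Fil N (M j) u); last by exists 0.
  have [|w Fw pw] := hM j u (1 / 2 ^+ j.+1) _ Fu.
    by rewrite divr_gt0// exprn_gt0.
  by exists w.
(* The difference v (M j) - w j' lies in F_(M j'); subtracting its approximation in CJ_s leaves a
   new term that is p_j'-close to w j' and still congruent to v (M j) modulo CJ_s. *)
pose w := fix w j := if j is j'.+1 then v (M j) - f (j', v (M j) - w j') else v (M 0).
have step j : CJs_set N V (w j - v (M j)) -> Fil N (M j) (v (M j.+1) - w j).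
  move=> h; rewrite -[X in Fil _ _ X](subrKA (v (M j))).
  apply: (linear_setD (@Fil_linear R G N V _)); first by apply: vSl; exact: Mm.
  by rewrite -opprB -scaleN1r; apply: (linear_setZ (@Fil_linear R G N V _)); exact: h.
have wC j : CJs_set N V (w j - v (M j)).
  elim: j => [|j IH] /=; first by rewrite subrr; exact: CJs_set_linear.1.
  rewrite addrAC subrr sub0r -scaleN1r; apply: (linear_setZ CJs_set_linear).
  exact: (hf (j, _) (step j IH)).1.
have [l [wl _]] : exists l : V, w @ \oo --> l /\ forall j, p j (w j - l) <= 1.
  apply: telescope_cvg => // j; apply: ltW; rewrite seminormB; last exact: (cp j).1.
  have := (hf (j, _) (step j (wC j))).2; congr (p j _ < _).
  by rewrite /= addrAC.
exists l; apply: CJ_eqP => k; rewrite CJ_projE -hv; apply/npi_eq.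
have cl : closed [set u | Fil N k (u - v k)].
  by apply: (@closed_comp _ _ (fun u => u - v k) (Fil N k)) => [u _|];
    [exact: shift_continuous|exact: Fil_closed].
apply: (cvg_closed_seq (k := k) cl _ wl) => i ki /=.
rewrite -(subrKA (v (M i))); apply: (linear_setD (@Fil_linear R G N V _)); first exact: wC.
by apply: vSl; exact: leq_trans ki (jM i).
Qed.

(** One coordinate m suffices. If x is close to the image of v there, then x has a lift u with u - w
    in F_m for some w near v; subtracting from u an element of CJ_s close to u - w gives a lift of x
    near v. *)
Lemma CJ_proj_open v (A : set V) : nbhs v A -> nbhs (CJ_proj N V v) (CJ_proj N V @` A).
Proof.
move=> /(nbhs_csemi fV)[p cp [e e0 pA]].
have [m hm] := Fil_CJs_dense cp.
have e2 : 0 < e / 2 by rewrite divr_gt0.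
have nB : nbhs (npi N m v) (npi N m @` [set w | p (w - v) < e / 2]).
  exact: qpi_nbhs (csemi_nbhs v cp e2).
have nC := @CJ_coord_continuous m (CJ_proj N V v) _ nB.
refine (@filterS _ (nbhs (CJ_proj N V v)) _ _ _ _ nC) => x [w pw] wx.
have [u ux] := CJ_proj_surj x.
have Fuw : Fil N m (u - w) by apply/npi_eq; rewrite wx -ux.
have [z zC pz] := hm _ _ e2 Fuw.
exists (u - z).
  apply: pA; have -> : u - z - v = (u - w - z) + (w - v).
    by rewrite addrA [u - w - z]addrAC subrK.
  by rewrite (le_lt_trans (cp.1.1 _ _))// [e]splitr ltrD.
rewrite -ux; apply/CJ_proj_eq; rewrite addrAC subrr sub0r -scaleN1r.
exact: (linear_setZ CJs_set_linear).
Qed.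

End Projection.

(** * Subrepresentations and quotient representations *)

Lemma within_continuousP (T U : topologicalType) (A : set T) (f : T -> U) :
  {within A, continuous f} <->
  forall x, A x -> forall B, nbhs (f x) B ->
    exists2 D, nbhs x D & forall y, D y -> A y -> B (f y).
Proof.
split=> [/subspace_continuousP h x Ax B nB|h].
  by exists [set y | A y -> B (f y)] => //; exact: (h x Ax B nB).
apply/subspace_continuousP => x Ax B nB; have [D nD hD] := h x Ax B nB.
rewrite /nbhs/= /within/=; apply: filterS nD => y Dy Ay; exact: hD.
Qed.

Section ClassC.
Context (R : realType) (G : topologicalGroupType).
Implicit Types V W : topologicalLmodType R[i].

Lemma within_continuous_sub (T U : topologicalType) (A B : set T) (f : T -> U) :
  A `<=` B -> {within B, continuous f} -> {within A, continuous f}.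
Proof.
move=> AB /within_continuousP h; apply/within_continuousP => x Ax D nD.
have [E nE hE] := h x (AB _ Ax) D nD; exists E => // y Ey /AB; exact: hE.
Qed.

Lemma derivative_at0_ext V (c d : R -> V) w : c =1 d -> derivative_at0 c w -> derivative_at0 d w.
Proof. by move=> /funext ->. Qed.

Lemma one_paramM (H : set G) (h : G) (c : R -> G) t :
  is_subgroup (fun x y : G => (x * y)%g) (fun x : G => x^-1%g) 1%g H -> H h ->
  one_param H c -> H (h * c t)%g.
Proof. by move=> [_ HM _] Hh [_ _ Hc]; exact: HM. Qed.

Variable H : set G.
Hypothesis sH : is_subgroup (fun x y : G => (x * y)%g) (fun x : G => x^-1%g) 1%g H.

(** Actions are arbitrary off H, so orbit maps are compared on H only; this is harmless because h
    c(t) stays in H. *)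
Lemma class_C_ext V k (f g : G -> V) : (forall h, H h -> f h = g h) ->
  class_C H k f -> class_C H k g.
Proof.
have ext (a b : G -> V) : (forall h, H h -> a h = b h) ->
    {within H, continuous a} -> {within H, continuous b}.
  move=> ab /within_continuousP h; apply/within_continuousP => x Hx B.
  rewrite -ab// => /(h x Hx)[D nD hD]; exists D => // y Dy Hy.
  by rewrite -ab//; exact: hD.
case: k => [|k] fg /=.
  by move=> [cf _]; split=> //; exact: ext cf.
move=> [cf hf]; split=> [|c Hc]; first exact: ext cf.
have [f' df' Cf'] := hf c Hc; exists f' => // h Hh.
apply: derivative_at0_ext (df' h Hh) => t /=; apply: fg; exact: one_paramM sH Hh Hc.
Qed.

Lemma class_C_lin V W (p : V -> W) k (f : G -> V) : linear p -> continuous p ->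
  class_C H k f -> class_C H k (p \o f).
Proof.
move=> lp cp.
have comp (a : G -> V) : {within H, continuous a} -> {within H, continuous (p \o a)}.
  move=> /within_continuousP h; apply/within_continuousP => x Hx B /cp /(h x Hx).
  by move=> [D nD hD]; exists D.
elim: k f => [|k IH] f /= [cf hf]; split=> //; first exact: comp.
  exact: comp.
move=> c Hc; have [f' df' Cf'] := hf c Hc; exists (p \o f'); last exact: IH.
by move=> h Hh; exact: derivative_at0_lin lp cp (df' h Hh).
Qed.

Lemma class_C_subgroup V k (K : set G) (f : G -> V) : H `<=` K ->
  class_C K k f -> class_C H k f.
Proof.
move=> HK; elim: k f => [|k IH] f /= [cf hf]; split=> //.
- exact: within_continuous_sub cf.
- exact: within_continuous_sub cf.
- move=> c Hc; have [f' df' Cf'] := hf c (one_paramS HK Hc).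
  by exists f'; [move=> h /HK; exact: df'|exact: IH].
Qed.

Lemma Rep_subgroup (K : set G) (s : G -> R) (V : representation R G) :
  H `<=` K -> Rep K s V -> Rep H s V.
Proof.
move=> HK rK; split.
- exact: Rep_frechet rK.
- by move=> h /HK; exact: (Rep_linear rK).
- exact: Rep_one rK.
- by move=> g h v /HK Kg /HK Kh; exact: (Rep_mul rK v Kg Kh).
- apply: within_continuous_sub (Rep_continuous rK) => -[g v] [Hg _].
  by split=> //; exact: HK.
- by move=> v k; exact: class_C_subgroup HK (Rep_smooth rK v k).
- move=> p1 s1 c1; have [r [p2 [s2 c2 h]]] := Rep_moderate rK s1 c1.
  by exists r, p2; split=> // g v /HK; exact: h.
Qed.

End ClassC.

(** * Closed subspaces with the induced topology *)

Section Subobject.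
Context (R : realType).
Variables (U V : topologicalLmodType R[i]) (i : U -> V).
Hypotheses (li : linear i) (ci : continuous i) (ii : injective i) (cl : closed (range i)).
Hypothesis ini : forall u A, nbhs u A -> exists2 B, nbhs (i u) B & forall w, B (i w) -> A w.
Hypothesis fV : frechet V.

Lemma sub_semi_basis (p : nat -> V -> R) : semi_basis p -> semi_basis (fun k => p k \o i).
Proof.
move=> [cp pS pA]; split=> [k|k v|A].
- exact: csemi_comp.
- exact: pS.
- split=> [/ini[B nB hB]|[m [e [e0 h]]]].
    rewrite (linear_map0 li) in nB; have /pA[m [e [e0 h]]] := nB.
    by exists m, e; split=> // u /= pu; apply: hB; exact: h.
  have := csemi_nbhs 0 (csemi_comp li ci (cp m)) e0; apply: filterS => u /=.
  by rewrite subr0; exact: h.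
Qed.

Lemma sub_frechet : frechet U.
Proof.
have [p bp] := frechet_semi_basis fV; have bq := sub_semi_basis bp.
split.
- move=> x y cxy; apply: ii; apply: (frechet_hausdorff fV) => A B /ci nA /ci nB.
  by have [z [Az Bz]] := cxy _ _ nA nB; exists (i z).
- exists (fun k => p k \o i); first by move=> k; case: bq => /(_ k) [].
  move=> A; have [_ _ ->] := bq; split=> -[m [e [e0 h]]]; exists m, e; split=> // u /= pu.
    by apply: h => /=; exact: pu.
  by apply: h => k km /=; apply: le_lt_trans pu; exact: semi_basis_le.
- move=> u cu.
  have [l ul] : exists l : V, (i \o u) @ \oo --> l.
    apply: (frechet_complete fV) => A nA.
    have /ci nA' : nbhs (i 0) A by rewrite linear_map0.
    have [m hm] := cu _ nA'; exists m => j k mj mk.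
    by have := hm j k mj mk; rewrite /= linear_mapB.
  have [x _ xl] : range i l.
    by apply: (cvg_closed_seq (k := 0) cl _ ul) => j _; exists (u j).
  exists x => A /ini[B]; rewrite xl => /ul nB hB.
  by refine (@filterS _ (nbhs \oo) _ _ _ _ nB) => j /=; exact: hB.
Qed.

End Subobject.

Section Subrepresentation.
Context (R : realType) (G : topologicalGroupType).
Variables (U V : representation R G) (i : U -> V) (H : set G) (s : G -> R).
Hypotheses (li : linear i) (ci : continuous i) (ii : injective i) (cl : closed (range i)).
Hypothesis ini : forall u A, nbhs u A -> exists2 B, nbhs (i u) B & forall w, B (i w) -> A w.
Hypothesis sH : is_subgroup (fun x y : G => (x * y)%g) (fun x : G => x^-1%g) 1%g H.
Hypothesis ei : forall h u, H h -> i (rep_act h u) = rep_act h (i u).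
Hypothesis rV : Rep H s V.

Lemma sub_derivative (c : R -> U) w : derivative_at0 (i \o c) (i w) -> derivative_at0 c w.
Proof.
move=> dc A /ini[B /dc nB hB]; refine (@filterS _ (0 : R)^' _ _ _ _ nB) => t /=.
by rewrite -(linear_mapB li) -(linear_mapZ li) => /hB.
Qed.

Lemma sub_class_C k (f : G -> U) : class_C H k (i \o f) -> class_C H k f.
Proof.
have comp (a : G -> U) : {within H, continuous (i \o a)} -> {within H, continuous a}.
  move=> /within_continuousP h; apply/within_continuousP => x Hx A /ini[B nB hB].
  by have [D nD hD] := h x Hx B nB; exists D => // y Dy Hy; apply: hB; exact: hD.
elim: k f => [|k IH] f /= [cf hf]; split=> //; [exact: comp|exact: comp|].
move=> c Hc; have [f' df' Cf'] := hf c Hc.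
have fV := Rep_frechet rV.
(* For h in H the derivative is a limit of difference quotients in the closed range of i, so it
   lifts to U. Off H the lift is set to 0. *)
have /choice[g hg] : forall h, exists u, H h -> i u = f' h.
  move=> h; have [Hh|nHh] := pselect (H h); last by exists 0.
  suff [u _ ui] : range i (f' h) by exists u.
  apply: cl; apply/(closure_csemi fV) => p cp e e0.
  have [d d0 hd] := (derivative_at0P _ _ fV).1 (df' h Hh) p cp e e0.
  have d2 : 0 < d / 2 by rewrite divr_gt0.
  have := hd (d / 2); rewrite gt_eqF// gtr0_norm// ltr_pdivrMr// ltr_pMr// ltr1n.
  move=> /(_ isT isT) /=; rewrite -(linear_mapB li) -(linear_mapZ li) => pu.
  by rewrite seminormB in pu; [eexists; [|exact: pu]; eexists|exact: cp.1].
exists g; first by move=> h Hh; apply: sub_derivative; rewrite hg//; exact: df'.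
apply: IH; apply: (class_C_ext sH) Cf' => h Hh /=; by rewrite hg.
Qed.

Lemma sub_Rep : Rep H s U.
Proof.
have fV := Rep_frechet rV; have [H1 HM _] := sH.
split.
- exact: sub_frechet ci ii cl ini fV.
- by move=> h Hh a u v; apply: ii; rewrite ei// !li !ei// (Rep_linear rV).
- by move=> u; apply: ii; rewrite ei// (Rep_one rV).
- by move=> g h u Hg Hh; apply: ii; rewrite !ei// ?(Rep_mul rV)//; exact: HM.
- apply/within_continuousP => -[g u] [/= Hg _] A /ini[B nB hB].
  rewrite ei// in nB; have /within_continuousP rc := Rep_continuous rV.
  have [D [[D1 D2]/= [nD1 nD2] DD] hD] := rc (g, i u) (conj Hg I) B nB.
  exists (D1 `*` (i @^-1` D2)); first by exists (D1, i @^-1` D2) => //=; split=> //; exact: ci.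
  move=> [h w] /= [D1h D2w] [Hh _]; apply: hB; rewrite ei//.
  by apply: (hD (h, i w)) => //; exact: DD.
- move=> u k; apply: sub_class_C; apply: (class_C_ext sH) (Rep_smooth rV (i u) k).
  by move=> h Hh /=; rewrite ei.
(* The seminorm p1 lives on U only. It is dominated by c times the restriction of a seminorm of V,
   to which moderate growth applies; the factor c goes into the second seminorm. *)
- move=> p1 s1 c1; have [p bp] := frechet_semi_basis fV.
  have bq := sub_semi_basis li ci ini bp.
  have [m [c c0 hc]] := csemi_dominated bq (conj s1 c1).
  have [cp _ _] := bp; have [spm cpm] := cp m.
  have [r [p2 [s2 c2 h2]]] := Rep_moderate rV spm cpm.
  have cs : csemi (fun u => c * (p2 \o i) u).
    apply: (csemi_le (p := p2 \o i) (c := c)) => //; first exact: csemi_comp.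
    by apply: seminormM (ltW c0) _; exact: (csemi_comp li ci (conj s2 c2)).1.
  exists r, (fun u => c * (p2 \o i) u); split; [exact: cs.1|exact: cs.2|].
  move=> h u Hh; rewrite (le_trans (hc _))// mulrCA ler_wpM2l ?(ltW c0)//=.
  by rewrite ei//; exact: h2.
Qed.

End Subrepresentation.

(** * Open quotients with closed kernel *)

Section Quotient.
Context (R : realType).
Variables (V W : topologicalLmodType R[i]) (q : V -> W).
Hypotheses (lq : linear q) (cq : continuous q) (sq : forall x, exists v, q v = x).
Hypothesis oq : forall v A, nbhs v A -> nbhs (q v) (q @` A).
Hypothesis clq : closed [set v | q v = 0].
Hypothesis fV : frechet V.

Let K := [set v | q v = 0].

Let lK : linear_set K.
Proof.
split=> [|a v w]; rewrite /K /=; first exact: linear_map0.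
by move=> qv qw; rewrite lq qv qw scaler0 addr0.
Qed.

(** A mere set-theoretic section of q; surjectivity excludes the default 0. *)
Definition quot_lift (x : W) : V := xget 0 [set v | q v = x].

Lemma quot_liftK x : q (quot_lift x) = x.
Proof. by rewrite /quot_lift; case: xgetP => [v _ //|no]; have [v qv] := sq x; case: (no v). Qed.

Definition quot_semi (p : V -> R) (x : W) : R := pdist p K (quot_lift x).

Lemma quot_semiE p v : seminorm p -> quot_semi p (q v) = pdist p K v.
Proof.
move=> sp; have sd := pdist_seminorm sp lK; apply/eqP; rewrite -subr_eq0 -normr_le0.
rewrite (le_trans (seminorm_lip sd _ _))// pdist_eq0//.
by rewrite /K /= (linear_mapB lq) quot_liftK subrr.
Qed.

Lemma quot_semi_le p v : seminorm p -> quot_semi p (q v) <= p v.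
Proof. by move=> sp; rewrite quot_semiE// pdist_le. Qed.

Lemma quot_semi_lt p x e : seminorm p -> quot_semi p x < e -> exists2 v, q v = x & p v < e.
Proof.
move=> sp /(pdist_lt sp lK)[w Kw h]; exists (quot_lift x - w) => //.
by rewrite (linear_mapB lq) quot_liftK Kw subr0.
Qed.

Lemma quot_semi_seminorm p : seminorm p -> seminorm (quot_semi p).
Proof.
move=> sp; have [dD dZ] := pdist_seminorm sp lK.
split=> [x y|a x]; have [v <-] := sq x.
  by have [w <-] := sq y; rewrite -(linear_mapD lq) !quot_semiE.
by rewrite -(linear_mapZ lq) !quot_semiE.
Qed.

Lemma quot_nbhs (A : set W) v p (e : R) : csemi p -> 0 < e ->
  (forall x, quot_semi p (x - q v) < e -> A x) -> nbhs (q v) A.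
Proof.
move=> cp e0 h; have := oq (csemi_nbhs v cp e0); apply: filterS => _ [w /= pw <-].
by apply: h; rewrite -(linear_mapB lq) (le_lt_trans (quot_semi_le _ cp.1)).
Qed.

Lemma quot_semi_csemi p : csemi p -> csemi (quot_semi p).
Proof.
move=> cp; have sp := quot_semi_seminorm cp.1; split=> //.
apply: continuous_seminorm => // e e0; rewrite -(linear_map0 lq).
by apply: (quot_nbhs cp e0) => x; rewrite (linear_map0 lq) subr0.
Qed.

Lemma quot_nbhsP (A : set W) v p : semi_basis p -> nbhs (q v) A ->
  exists m, exists2 e : R, 0 < e & forall x, quot_semi (p m) (x - q v) < e -> A x.
Proof.
move=> bp /cq /(nbhs_semi_basis _ _ bp)[m [e [e0 h]]].
have [cp _ _] := bp; exists m, e => // x.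
move=> /(quot_semi_lt (cp m).1)[w qw pw].
have -> : x = q (w + v) by rewrite (linear_mapD lq) qw subrK.
by apply: h; rewrite /= addrK.
Qed.

Lemma quot_frechet : frechet W.
Proof.
have [p bp] := frechet_semi_basis fV; have [cp pS pA] := bp.
have qle j k x : (j <= k)%N -> quot_semi (p j) x <= quot_semi (p k) x.
  move=> jk; apply: (pdist_ge (cp k).1 lK) => w Kw.
  by rewrite (le_trans (pdist_le_dist (cp j).1 lK _ Kw))// semi_basis_le.
split.
- move=> x y cxy; apply/eqP; apply: contrapT => /negP xy.
  have [v vx] := sq x; have [w wy] := sq y.
  (* A ball around v - w that misses the closed kernel yields half-size balls around v and w with
     disjoint images. *)
  have nK : nbhs (v - w) (~` K).
    apply: open_nbhs_nbhs; split; first exact: closed_openC.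
    by rewrite /K /= (linear_mapB lq) vx wy => /eqP; rewrite subr_eq0; apply/negP.
  have [p1 cp1 [e e0 h]] := (nbhs_csemi fV _ _).1 nK.
  have e2 : 0 < e / 2 by rewrite divr_gt0.
  have := oq (csemi_nbhs v cp1 e2); rewrite vx => nx.
  have := oq (csemi_nbhs w cp1 e2); rewrite wy => ny.
  have [_ [[a /= pa <-] [b /= pb ab]]] := cxy _ _ nx ny.
  have /h : p1 (a - b - (v - w)) < e.
    have -> : a - b - (v - w) = (a - v) - (b - w).
      by rewrite !opprB addrACA [RHS]addrACA [- b - v]addrC.
    by rewrite (le_lt_trans (seminorm_triB cp1.1 _ _))// [e]splitr ltrD.
  by apply; rewrite /K /= (linear_mapB lq) ab subrr.
- exists (fun k => quot_semi (p k)).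
    by move=> k; exact: quot_semi_seminorm (cp k).1.
  move=> A; split=> [|[m [e [e0 h]]]].
    rewrite -(linear_map0 lq) => /(quot_nbhsP bp)[m [e e0 h]].
    exists m, e; split=> // x /= px; apply: h.
    by rewrite (linear_map0 lq) subr0; exact: px.
  rewrite -(linear_map0 lq); apply: (quot_nbhs (cp m) e0) => x.
  rewrite (linear_map0 lq) subr0 => qx; apply: h => k km.
  by apply: le_lt_trans qx; exact: qle.
- move=> u cu.
  (* Completeness passes through a subsequence with increments below 2^-(j+1) for the j-th quotient
     seminorm: each increment then has an equally small lift, and the lifted series converges in
     V. *)
  have cu' j : exists m, forall k l, (m <= k)%N -> (m <= l)%N ->
      quot_semi (p j) (u k - u l) < 1 / 2 ^+ j.+1.
    apply: (cu [set x | quot_semi (p j) x < 1 / 2 ^+ j.+1]).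
    have e0 : 0 < 1 / 2 ^+ j.+1 :> R by rewrite divr_gt0// exprn_gt0.
    have := csemi_nbhs 0 (quot_semi_csemi (cp j)) e0.
    by apply: filterS => x /=; rewrite subr0.
  have [M [hM jM Mm]] := monotone_choice
    (fun j k l kl h a b la lb => h a b (leq_trans kl la) (leq_trans kl lb)) cu'.
  have /choice[f hf] : forall j, exists v, q v = u (M j.+1) - u (M j) /\ p j v < 1 / 2 ^+ j.+1.
    move=> j; have [||v qv pv] := quot_semi_lt (cp j).1 (hM j (M j.+1) (M j) _ _).
    - exact: Mm.
    - exact: leqnn.
    - by exists v.
  pose w := fix w j := if j is j'.+1 then w j' + f j' else quot_lift (u (M 0)).
  have qw j : q (w j) = u (M j).
    elim: j => [|j IH] /=; first exact: quot_liftK.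
    by rewrite (linear_mapD lq) IH (hf j).1 addrC subrK.
  have [l [wl pl]] : exists l, w @ \oo --> l /\ forall j, p j (w j - l) <= 1.
    apply: (telescope_cvg fV bp ltr01) => j /=.
    rewrite opprD addrA subrr sub0r seminormN; last exact: (cp j).1.
    exact: ltW (hf j).2.
  exists (q l) => A /(quot_nbhsP bp)[m [e e0 h]].
  have sm := (quot_semi_csemi (cp m)).1.
  have e2 : 0 < e / 2 by rewrite divr_gt0.
  have [m1 _ hm1] := (cvg_csemi fV _ _).1 wl _ (cp m) (e / 2) e2.
  have [m2 hm2] := @exp2_small R 1 _ e2.
  pose j := maxn m (maxn m1 m2).
  have mj : (m <= j)%N := leq_maxl _ _.
  have m1j : (m1 <= j)%N by rewrite /j !leq_max leqnn orbT.
  have m2j : (m2 <= j)%N by rewrite /j !leq_max leqnn !orbT.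
  exists (M j) => // k /= Mk; apply: h.
  rewrite (le_lt_trans (seminorm_dist sm _ (u (M j)) _))// [e]splitr ltrD//.
    apply: (le_lt_trans (qle _ _ _ mj)).
    apply: (lt_trans (hM j k (M j) Mk (leqnn _))); apply: le_lt_trans hm2.
    rewrite ler_pM2l// lef_pV2 ?posrE ?exprn_gt0//.
    by rewrite ler_weXn2l ?ler1n// ltnW.
  rewrite -qw -(linear_mapB lq) (le_lt_trans (quot_semi_le _ (cp m).1))//.
  exact: hm1.
Qed.

End Quotient.

Section QuotientRepresentation.
Context (R : realType) (G : topologicalGroupType).
Variables (V W : representation R G) (q : V -> W) (H : set G) (s : G -> R).
Hypotheses (lq : linear q) (cq : continuous q) (sq : forall x, exists v, q v = x).
Hypothesis oq : forall v A, nbhs v A -> nbhs (q v) (q @` A).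
Hypothesis clq : closed [set v | q v = 0].
Hypothesis sH : is_subgroup (fun x y : G => (x * y)%g) (fun x : G => x^-1%g) 1%g H.
Hypothesis eqv : forall h v, H h -> q (rep_act h v) = rep_act h (q v).
Hypothesis rV : Rep H s V.
Hypothesis s0 : forall g, 0 < s g.

Lemma quot_Rep : Rep H s W.
Proof.
have fV := Rep_frechet rV; have [H1 HM _] := sH.
split.
- exact: (quot_frechet lq cq sq oq clq fV).
- move=> h Hh a x y; have [v <-] := sq x; have [w <-] := sq y.
  by rewrite -lq -!eqv// (Rep_linear rV Hh) lq.
- by move=> x; have [v <-] := sq x; rewrite -eqv// (Rep_one rV).
- move=> g h x Hg Hh; have [v <-] := sq x; rewrite -!eqv//; last exact: HM.
  by rewrite (Rep_mul rV).
- apply/within_continuousP => -[g x] [/= Hg _] A; have [v <-] := sq x.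
  rewrite -eqv// => /cq nB; have /within_continuousP rc := Rep_continuous rV.
  have [D [[D1 D2]/= [nD1 nD2] DD] hD] := rc (g, v) (conj Hg I) _ nB.
  exists (D1 `*` (q @` D2)); first by exists (D1, q @` D2) => //=; split=> //; exact: oq.
  move=> [h _] /= [D1h [w D2w <-]] [Hh _]; rewrite -eqv//.
  by apply: (hD (h, w)) => //; exact: DD.
- move=> x k; have [v <-] := sq x.
  apply: (class_C_ext sH) (class_C_lin lq cq (Rep_smooth rV v k)).
  by move=> h Hh /=; rewrite eqv.
- move=> p1 s1 c1; have cs : csemi (p1 \o q) by exact: csemi_comp.
  have [r [p2 [s2 c2 h2]]] := Rep_moderate rV cs.1 cs.2.
  have c2' := quot_semi_csemi lq sq oq (conj s2 c2).
  exists r, (quot_semi q p2); split; [exact: c2'.1|exact: c2'.2|].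
  (* The bound holds with p2 v for every lift v of x; after division by s(h)^r > 0 it passes to the
     infimum over the lifts. *)
  move=> h x Hh; have sr : 0 < s h ^+ r by rewrite exprn_gt0.
  rewrite -ler_pdivrMl//; apply/ler_addgt0Pr => e e0.
  have [|v <- pv] := @quot_semi_lt _ _ _ q lq sq p2 x (quot_semi q p2 x + e) s2.
    by rewrite ltrDl.
  rewrite ler_pdivrMl// -eqv//; apply: (le_trans (h2 h v Hh)).
  by rewrite ler_pM2l// ltW.
Qed.

End QuotientRepresentation.

(** * Groups of unipotent matrices *)

Section Trace.
Context (F : numFieldType) (n : nat).
Implicit Types A e x : 'M[F]_n.+1.

(** In the full-rank factorization e = C R, idempotence cancels to R C = 1, and tr(C R) = tr(R
    C). *)
Lemma mxtrace_idempotent e : e * e = e -> \tr e = (\rank e)%:R.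
Proof.
move=> ee; have : col_base e *m (row_base e *m col_base e) *m row_base e =
    col_base e *m 1%:M *m row_base e.
  by rewrite mulmx1 (mulmxA (col_base e)) mulmx_base -mulmxA mulmx_base; exact: ee.
move=> /(row_free_inj (row_base_free e)) /(row_full_inj (col_base_full e)) h.
by rewrite -{1}(mulmx_base e) mxtrace_mulC h mxtrace1.
Qed.

(** Over polynomials X - A divides X^k - A^k = X^k; taking determinants, the characteristic
    polynomial divides a power of X and is itself one, so its trace coefficient is 0. *)
Lemma mxtrace_nilpotent A k : A ^+ k = 0 -> \tr A = 0.
Proof.
move=> Ak; pose Ap : 'M[{poly F}]_n.+1 := map_mx polyC A.
have Apk : Ap ^+ k = 0.
  by rewrite -(rmorphXn (map_mx (polyC (R:=F)))) Ak; exact: map_mx0.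
have cXA : GRing.comm ('X%:M : 'M[{poly F}]_n.+1) Ap by exact: (esym (scalar_mxC _ _)).
have := subrXX_comm k cXA; rewrite Apk subr0 -(rmorphXn (@scalar_mx {poly F} n.+1)).
move=> /(congr1 (fun M : 'M[{poly F}]_n.+1 => \det M)); rewrite det_scalar -exprM.
rewrite -mulmxE det_mulmx => dE.
have : char_poly A %| ('X - 0%:P) ^+ (k * n.+1).
  by rewrite subr0 dE; exact: dvdp_mulIl.
move=> /dvdp_exp_XsubCP[m _]; rewrite eqp_monic ?char_poly_monic ?monic_exp ?monicXsubC//.
rewrite subr0 => /eqP cA; have := size_char_poly A; rewrite cA size_polyXn => -[mn].
have := char_poly_trace A isT; rewrite cA mn coefXn /= ltn_eqF// => /eqP.
by rewrite eq_sym oppr_eq0 => /eqP.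
Qed.

(* Some polynomial in x without constant term is an idempotent e which vanishes
   only if x is nilpotent; the rank of e is its trace, hence 0. *)
Lemma nilpotent_of_trace (I : {vspace 'M[F]_n.+1}) x : (I * I <= I)%VS ->
  (forall y, y \in I -> \tr y = 0) -> x \in I -> exists k, x ^+ k = 0.
Proof.
move=> II tI xI.
have Ip (q : {poly F}) : x * horner_mx x q \in I.
  elim/poly_ind: q => [|q c IH]; first by rewrite rmorph0 mulr0 mem0v.
  rewrite rmorphD rmorphM /= horner_mx_X horner_mx_C mulrDr mulrA memvD//.
    by apply: (subvP II); rewrite memv_mul.
  by rewrite -[x * _]/(x *m _) mul_mx_scalar memvZ.
have [m [g gX cE]] := multiplicity_XsubC (char_poly x) 0.
rewrite monic_neq0 ?char_poly_monic//= in gX.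
rewrite subr0 in cE.
(* With m.+1 in place of m, the idempotent e is a multiple of x even if x is invertible. This puts e
   in I, which may not contain 1. *)
have cop : coprimep ('X ^+ m.+1) g.
  by rewrite coprimep_expl// coprimep_sym -[X in coprimep _ X]subr0 coprimep_XsubC.
have /Bezout_eq1_coprimepP[[u v] /= uv] := cop.
have xg : horner_mx x ('X ^+ m.+1 * g) = 0.
  by rewrite exprS -mulrA ['X^m * g]mulrC -cE rmorphM /= Cayley_Hamilton mulr0.
pose e := horner_mx x (u * 'X ^+ m.+1).
have eI : e \in I.
  by rewrite /e exprS mulrCA rmorphM /= horner_mx_X; exact: Ip.
have e1 : e - 1 = - horner_mx x (v * g).
  by rewrite /e -[1](rmorph1 (horner_mx x)) -uv rmorphD opprD addrA subrr add0r.
have ee : e * e = e.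
  apply/eqP; rewrite -subr_eq0 -{3}[e]mulr1 -mulrBr e1 mulrN oppr_eq0 /e -rmorphM /=.
  by rewrite mulrACA [u * v]mulrC rmorphM /= xg mulr0.
have e0 : e = 0.
  have := mxtrace_idempotent ee; rewrite (tI e eI) => /eqP.
  by rewrite eq_sym pnatr_eq0 mxrank_eq0 => /eqP.
exists m.+1; have := e1; rewrite e0 sub0r => /oppr_inj h1.
rewrite -[LHS]mulr1 h1 -{1}(horner_mx_X x) -rmorphXn -rmorphM /=.
by rewrite mulrCA rmorphM /= xg mulr0.
Qed.

End Trace.

Lemma leq_bin_exp u k : ('C(u, k) <= u.+1 ^ k)%N.
Proof.
elim: u k => [|u IH] [|k]; rewrite ?bin0 ?expn_gt0//.
rewrite binS (leq_trans (leq_add (IH _) (IH _)))//.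
rewrite [X in (X + _)%N]expnS -[X in (_ + X)%N]mul1n -mulnDl addn1 expnS leq_mul//.
by case: k => [//|k]; rewrite leq_exp2r.
Qed.

Section NilAlgebra.
Context (F : fieldType) (A : falgType F) (I : {vspace A}).
Hypotheses (II : (I * I <= I)%VS) (nil : forall x, x \in I -> exists k, x ^+ k = 0).

(** The powers of I stabilize at some J = J J. If J is nonzero, take L = J x nonzero of least
    dimension; as J L = L, some y in L has J y nonzero, so J y = L by minimality. Then y = a y with
    a in J, and y = a^k y = 0, a contradiction. *)
Lemma nil_algebra_nilpotent : exists d, (I ^+ d = 0)%VS.
Proof.
have IS k : (I ^+ k.+2 <= I ^+ k.+1)%VS.
  elim: k => [|k IH]; first by rewrite expv2 expv1.
  by rewrite expvSl [X in (_ <= X)%VS]expvSl prodvSr.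
pose P d := `[< exists k, \dim (I ^+ k.+1)%VS = d >].
have exP : exists d, P d by exists (\dim (I ^+ 1)%VS); apply/asboolP; exists 0%N.
case: (ex_minnP exP) => d /asboolP[k dk] dmin.
have Ik j : (I ^+ (k.+1 + j) = I ^+ k.+1)%VS.
  elim: j => [|j IH]; first by rewrite addn0.
  apply/eqP; rewrite eqEdim; rewrite addnS; apply/andP; split.
    by rewrite -IH addSn; exact: IS.
  by rewrite dk; apply: dmin; apply/asboolP; exists (k.+1 + j)%N.
pose J := (I ^+ k.+1)%VS.
have JJ : (J * J = J)%VS by rewrite -expvD Ik.
have JI : (J <= I)%VS.
  by rewrite /J; elim: (k) => [|j IH]; [rewrite expv1|exact: subv_trans (IS j) IH].
exists k.+1; apply/eqP; apply: contrapT => /negP J0.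
pose Q d := `[< exists x, (J * <[x]> != 0)%VS /\ \dim (J * <[x]>)%VS = d >].
have exQ : exists d, Q d.
  exists (\dim (J * <[1]>)%VS); apply/asboolP; exists 1; split=> //.
  by rewrite prodv1.
case: (ex_minnP exQ) => e /asboolP[x [Jx0 dx]] emin.
pose L := (J * <[x]>)%VS.
have JL : (J * L = L)%VS by rewrite /L prodvA JJ.
have [y yL Jy0] : exists2 y, y \in L & (J * <[y]> != 0)%VS.
  apply: contrapT => no; move: Jx0; rewrite -/L -JL => /negP; apply.
  rewrite -subv0; apply/prodvP => a y aJ yL; rewrite memv0.
  have [Jy|Jy] := boolP (J * <[y]> == 0)%VS; last by case: no; exists y.
  by rewrite -memv0 -(eqP Jy) memv_mul// memv_line.
have JyL : (J * <[y]> = L)%VS.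
  apply/eqP; rewrite eqEdim -{1}JL prodvSr -?memvE//=.
  by rewrite -/L in dx; rewrite dx; apply: emin; apply/asboolP; exists y.
have /memv_cosetP[a aJ ya] : y \in (J * <[y]>)%VS by rewrite JyL.
have yk k' : y = a ^+ k' * y.
  by elim: k' => [|k' IH]; [rewrite mul1r|rewrite exprSr -mulrA -ya].
have [k' ak] := nil (subvP JI _ aJ).
move: Jy0; rewrite (yk k') ak mul0r => /negP; apply.
by rewrite -subv0; apply/prodvP => b z _; rewrite !memv0 => /eqP ->; rewrite mulr0.
Qed.

End NilAlgebra.

(** The spanning family is drawn from S itself, so linear properties of the span can be tested on
    members of S. *)
Lemma finite_span (F : fieldType) (vT : vectType F) (S : vT -> Prop) :
  exists xs : seq vT, (forall x, x \in xs -> S x) /\ forall x, S x -> x \in <<xs>>%VS.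
Proof.
pose P d := `[< exists xs : seq vT, (forall x, x \in xs -> S x) /\ \dim <<xs>>%VS = d >].
have exP : exists d, P d by exists (\dim <<([::] : seq vT)>>%VS); apply/asboolP; exists [::].
have bP d : P d -> (d <= \dim {:vT})%N.
  by move=> /asboolP[l [_ <-]]; rewrite dimvS// subvf.
case: (ex_maxnP exP bP) => d /asboolP[xs [xsS dxs]] dmax.
exists xs; split=> // x Sx; have sub : (<<xs>> <= <<x :: xs>>)%VS.
  by apply: sub_span => y yxs; rewrite inE yxs orbT.
have -> : <<xs>>%VS = <<x :: xs>>%VS.
  apply/eqP; rewrite eqEdim sub/= dxs; apply: dmax; apply/asboolP.
  by exists (x :: xs); split=> // h; rewrite inE => /predU1P[->|/xsS].
by apply: memv_span; rewrite mem_head.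
Qed.

(** * Kolchin's theorem and the growth of unipotent products *)

Section Kolchin.
Context (F : numFieldType) (n : nat) (S : 'M[F]_n.+1 -> Prop).
Hypothesis SM : forall g h, S g -> S h -> S (g * h).
Hypothesis Su : forall g, S g -> exists k, (g - 1) ^+ k = 0.

(** The span of the g - 1 is an algebra by (g - 1)(h - 1) = (gh - 1) - (g - 1) - (h - 1). Nilpotence
    cannot be tested on generators, but the vanishing of the trace can, and [nilpotent_of_trace]
    recovers nilpotence from it. *)
Lemma unipotent_augmentation : exists I : {vspace 'M[F]_n.+1},
  [/\ (I * I <= I)%VS, forall g, S g -> g - 1 \in I &
   forall x, x \in I -> \tr x = 0].
Proof.
have [xs [xsS inI]] := finite_span (fun x => exists2 g, S g & x = g - 1).
exists <<xs>>%VS; split=> //.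
- apply/prodvP => x y xI yI.
  have xt : x \in <<in_tuple xs>>%VS by [].
  have yt : y \in <<in_tuple xs>>%VS by [].
  rewrite (coord_span xt) (coord_span yt).
  rewrite mulr_suml memv_suml// => i _; rewrite mulr_sumr memv_suml// => j _.
  rewrite -scalerAl -scalerAr !memvZ//.
  have [g Sg ->] := xsS _ (mem_nth 0 (ltn_ord i : (i < size (in_tuple xs))%N)).
  have [h Sh ->] := xsS _ (mem_nth 0 (ltn_ord j : (j < size (in_tuple xs))%N)).
  have -> : (g - 1) * (h - 1) = (g * h - 1) - (g - 1) - (h - 1).
    rewrite mulrBl mul1r mulrBr mulr1; congr (_ - _).
    by rewrite opprB addrA subrK.
  apply: memvB; [apply: memvB|]; apply: inI; [exists (g * h)|exists g|exists h] => //.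
  exact: SM.
- by move=> g Sg; apply: inI; exists g.
- move=> x xI; have xt : x \in <<in_tuple xs>>%VS by [].
  rewrite (coord_span xt) raddf_sum big1// => i _ /=.
  have [g Sg ->] := xsS _ (mem_nth 0 (ltn_ord i : (i < size (in_tuple xs))%N)).
  by rewrite linearZ /=; have [k /mxtrace_nilpotent ->] := Su Sg; rewrite mulr0.
Qed.

(** Kolchin's theorem with a nilpotent algebra instead of an invariant flag: d bounds at once the
    length of all nonzero products of matrices g - 1. *)
Lemma kolchin : exists d (I : {vspace 'M[F]_n.+1}),
  [/\ (I * I <= I)%VS, (I ^+ d = 0)%VS & forall g, S g -> g - 1 \in I].
Proof.
have [I [II SI tI]] := unipotent_augmentation.
have [d Id] := nil_algebra_nilpotent II (fun x => nilpotent_of_trace II tI).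
by exists d, I.
Qed.

Lemma unipotent_growth : exists d : nat, forall gs, (forall g, g \in gs -> S g) ->
  exists C : F, forall (u : nat) i j, `|(\prod_(g <- gs) g ^+ u) i j| <= C * u.+1%:R ^+ d.
Proof.
have [d [I [_ Id SI]]] := kolchin; exists d => gs Sgs.
(* B collects the powers of g - 1 already expanded on the left. Being in I^a it leaves room for
   degree d - a only, which is why the exponent does not grow with the list. *)
suff H a (B : 'M[F]_n.+1) : (a <= d)%N -> B \in (I ^+ a)%VS ->
    exists C : F, forall (u : nat) i j,
      `|(B * \prod_(g <- gs) g ^+ u) i j| <= C * u.+1%:R ^+ (d - a).
  have [|C hC] := H 0 1 (leq0n _); first by rewrite expv0 memv_line.
  by exists C => u i j; have := hC u i j; rewrite mul1r subn0.
elim: gs Sgs a B => [|g gs IH] Sgs a B ad Ba.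
  exists (\sum_i \sum_j `|B i j|) => u i j; rewrite big_nil mulr1.
  apply: (@le_trans _ _ (\sum_i \sum_j `|B i j|)).
    rewrite (bigD1 i)//= (bigD1 j)//= -addrA lerDl addr_ge0 ?sumr_ge0// => k _.
    by rewrite sumr_ge0.
  rewrite ler_peMr ?exprn_ege1 ?ler1n//.
  by apply: sumr_ge0 => k _; apply: sumr_ge0.
have Sg : S g by apply: Sgs; exact: mem_head.
have {}IH := IH (fun h hgs => Sgs h (mem_behead (s := g :: gs) hgs)).
pose Y := g - 1.
have BY k : B * Y ^+ k \in (I ^+ (a + k))%VS.
  rewrite expvD memv_mul//; elim: k => [|k IHk]; first by rewrite expv0 memv_line.
  by rewrite exprSr expvSr memv_mul// SI.
have z k : (d - a < k)%N -> B * Y ^+ k = 0.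
  move=> dk; have dak : (d <= a + k)%N by rewrite -leq_subLR ltnW.
  have := BY k; rewrite (_ : (I ^+ (a + k))%VS = 0%VS) ?memv0 => [/eqP //|].
  by rewrite -(subnK dak) expvD Id prodv0.
have expg u : B * g ^+ u = \sum_(0 <= k < (d - a).+1) (B * Y ^+ k) *+ 'C(u, k).
  rewrite -{1}(subrK 1 g) exprD1n mulr_sumr.
  under eq_bigr do rewrite mulrnAr.
  rewrite -(big_mkord xpredT (fun k => (B * Y ^+ k) *+ 'C(u, k))).
  have [ud|du] := leqP u (d - a).
    rewrite [RHS](big_cat_nat (n := u.+1))//= [X in _ + X]big_nat_cond.
    rewrite [X in _ + X]big1 ?addr0// => k /andP[/andP[uk _] _].
    by rewrite bin_small// mulr0n.
  rewrite [LHS](big_cat_nat (n := (d - a).+1))//=; last exact: ltnW.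
  rewrite [X in _ + X = _]big_nat_cond [X in _ + X = _]big1 ?addr0// => k /andP[/andP[dk _] _].
  by rewrite z// mul0rn.
have /choice[C hC] : forall k, exists C : F, (k <= d - a)%N -> forall (u : nat) i j,
    `|(B * Y ^+ k * \prod_(h <- gs) h ^+ u) i j| <= C * u.+1%:R ^+ (d - (a + k)).
  move=> k; have [kd|_] := leqP k (d - a); last by exists 0.
  have [|C hC] := IH (a + k)%N _ _ (BY k); last by exists C.
  by rewrite -leq_subRL.
exists (\sum_(0 <= k < (d - a).+1) C k) => u i j.
rewrite big_cons mulrA expg mulr_suml summxE mulr_suml.
rewrite (le_trans (ler_norm_sum _ _ _))// big_nat [leRHS]big_nat ler_sum// => k /andP[_ kd].
rewrite mulrnAl mulmxnE normrMn -[leLHS]mulr_natr.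
have C0 : 0 <= C k * u.+1%:R ^+ (d - (a + k)) by exact: le_trans (hC k kd u i j).
have -> : C k * u.+1%:R ^+ (d - a) = (C k * u.+1%:R ^+ (d - (a + k))) * u.+1%:R ^+ k.
  rewrite -mulrA -exprD; congr (_ * _ ^+ _); rewrite subnDA subnK//.
apply: ler_pM => //; first exact: hC.
by rewrite -natrX ler_nat leq_bin_exp.
Qed.

End Kolchin.

(** * One-parameter groups of matrices *)

Section Derivatives.
Context (R : realType).
Local Notation der f t l := (is_derive (t : R) (1 : R) (f : R -> R) (l : R)).

Lemma is_derive_unique (f : R -> R) (t a b : R) : der f t a -> der f t b -> a = b.
Proof. by move=> fa fb; rewrite -(@derive_val _ _ _ _ _ _ _ fa) (@derive_val _ _ _ _ _ _ _ fb). Qed.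

Lemma is_derive_prod (f g : R -> R) (t a b : R) : der f t a -> der g t b ->
  der (fun x => f x * g x) t (a * g t + f t * b).
Proof.
move=> fa gb; have := is_deriveM fa gb; rewrite addrC [g t *: a]mulrC; exact.
Qed.

Lemma is_derive_bigsum (I : Type) (r : seq I) (h : I -> R -> R) (dh : I -> R) (t : R) :
  (forall i, der (h i) t (dh i)) ->
  der (fun x => \sum_(i <- r) h i x) t (\sum_(i <- r) dh i).
Proof.
move=> hd; elim: r => [|i r IH].
  rewrite big_nil (_ : (fun x => _) = cst 0); first exact: is_derive_cst.
  by apply/funext => x; rewrite big_nil.
rewrite big_cons (_ : (fun x => _) = (h i) + (fun x => \sum_(i <- r) h i x)).
  exact: is_deriveD.
by apply/funext => x; rewrite big_cons.
Qed.

Lemma is_derive_affine (a b t : R) : der (fun x => a * x + b) t a.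
Proof.
have := is_deriveD (is_derive_prod (is_derive_cst a t (1 : R)) (is_derive_id t (1 : R)))
  (is_derive_cst b t (1 : R)).
by rewrite mul0r add0r mulr1 addr0.
Qed.

Lemma is_derive_comp_affine (f : R -> R) (a b t l : R) : der f (a * t + b) l ->
  der (fun x => f (a * x + b)) t (l * a).
Proof.
move=> fl.
exact: (@is_derive1_comp R f (fun x => a * x + b) t l a fl (is_derive_affine a b t)).
Qed.

Lemma is_derive_continuous (f : R -> R) (t l : R) : der f t l -> {for t, continuous f}.
Proof.
move=> fl; apply: differentiable_continuous; apply/derivable1_diffP.
exact: (@ex_derive _ _ _ _ _ _ _ fl).
Qed.

Lemma is_derive_cvg0 (f : R -> R) l : der f 0 l ->
  (fun h => h^-1 * (f h - f 0)) @ 0^' --> l.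
Proof.
move=> fl; have := @ex_derive _ _ _ _ _ _ _ fl.
move=> /cvg_ex[l' h].
have ll' : l' = l.
  rewrite -(@derive_val _ _ _ _ _ _ _ fl); apply/esym; exact: cvg_lim.
move: h; rewrite ll' (_ : (fun h => _) = (fun h => h^-1 * (f h - f 0)))//.
by apply/funext => h; rewrite /= addr0 [h *: 1]mulr1.
Qed.

Lemma is_derive0P (f : R -> R) l : der f 0 l <-> forall e : R, 0 < e ->
  exists2 d : R, 0 < d & forall t, t != 0 -> `|t| < d -> `|l - t^-1 * (f t - f 0)| < e.
Proof.
split=> [/is_derive_cvg0 /cvgrPdist_lt h e e0|h].
  by apply/dnbhs0P; exact: h.
apply: is_derive_cvg; apply/cvgrPdist_lt => e e0; apply/dnbhs0P.
have [d d0 hd] := h e e0; exists d => // t t0 td.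
by rewrite addr0; exact: hd.
Qed.

Lemma is_derive0_local (f h : R -> R) (r l : R) : 0 < r ->
  (forall t, `|t| < r -> f t = h t) -> der h 0 l -> der f 0 l.
Proof.
move=> r0 fh /is_derive0P dh; apply/is_derive0P => e e0.
have [d d0 hd] := dh e e0; exists (Num.min d r); first by rewrite lt_min d0.
move=> t t0; rewrite lt_min => /andP[td tr]; rewrite !fh ?normr0//.
exact: hd.
Qed.

Lemma derive0_cst (f : R -> R) (a b : R) : a <= b ->
  (forall x, a <= x <= b -> der f x 0) -> f b = f a.
Proof.
rewrite le_eqVlt => /predU1P[->//|ab] df.
have [||c _] := @MVT R f (fun=> 0) a b ab.
- by move=> x /[!in_itv]/= /andP[/ltW ax /ltW xb]; apply: df; rewrite ax.
- apply: continuous_in_subspaceT => x /[!inE]/= /[!in_itv]/= axb.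
  exact: is_derive_continuous (df x axb).
by rewrite mul0r => /eqP; rewrite subr_eq0 => /eqP.
Qed.

Lemma local_primitive (f : R -> R) (a b : R) : a < b -> continuous f ->
  exists F : R -> R, forall x, a < x < b -> der F x (f x).
Proof.
move=> ab cf; pose F y := (\int[lebesgue_measure]_(t in [set` `[a, y]]) (f t))%R.
exists F => x /andP[ax xb].
have [|dF F'] := @continuous_FTC1_closed R f a x b xb _ ax (cf x).
- apply: continuous_compact_integrable; first exact: segment_compact.
  by apply: continuous_subspaceT.
by apply: DeriveDef => //; rewrite -F' derive1E.
Qed.

(* Energy method: E := \sum_i F_i^2 satisfies E' <= K E. *)
Lemma linear_ode_ge0 (I : finType) (F : I -> R -> R) (a : I -> I -> R) :
  (forall i t, der (F i) t (\sum_j a i j * F j t)) -> (forall i, F i 0 = 0) ->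
  forall i t, 0 <= t -> F i t = 0.
Proof.
move=> dF F0 i t t0; pose S := \sum_i \sum_j `|a i j|; pose K := S + S.
pose E x := \sum_i F i x * F i x.
have dE x : der E x (\sum_i ((\sum_j a i j * F j x) * F i x + F i x * (\sum_j a i j * F j x))).
  by apply: is_derive_bigsum => j; exact: is_derive_prod.
have E0 x : 0 <= E x by apply: sumr_ge0 => j _; rewrite -expr2 sqr_ge0.
have FE j x : F j x * F j x <= E x.
  by rewrite /E (bigD1 j)//= lerDl sumr_ge0// => k _; rewrite -expr2 sqr_ge0.
have bE x : \sum_i ((\sum_j a i j * F j x) * F i x + F i x * (\sum_j a i j * F j x)) <= K * E x.
  have b k j : a k j * F j x * F k x <= `|a k j| * E x.
    rewrite -mulrA (le_trans (ler_norm _))// normrM ler_wpM2l//.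
    have := FE j x; have := FE k x; rewrite ler_norml.
    move: (F j x) (F k x) (E x) => u v e; nra.
  have b' k : (\sum_j a k j * F j x) * F k x <= (\sum_j `|a k j|) * E x.
    by rewrite !mulr_suml ler_sum.
  have -> : K * E x = \sum_k ((\sum_j `|a k j|) * E x + (\sum_j `|a k j|) * E x).
    by rewrite /K /S big_split/= -!mulr_suml mulrDl.
  by apply: ler_sum => k _; rewrite [F k x * _]mulrC lerD.
(* By E' <= K E this function is nonincreasing; it is nonnegative and starts at 0. The summand 0
   gives the exponent the affine shape of [is_derive_comp_affine]. *)
pose g x := expR (- K * x + 0) * E x.
have dg x : der g x (expR (- K * x + 0) * - K * E x + expR (- K * x + 0) *
    (\sum_i ((\sum_j a i j * F j x) * F i x + F i x * (\sum_j a i j * F j x)))).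
  apply: is_derive_prod (dE x); apply: is_derive_comp_affine; exact: is_derive_expR.
have g0 : g 0 = 0.
  by rewrite /g /E big1 ?mulr0// => j _; rewrite F0 mulr0.
have : g t <= g 0.
  apply: (@ler0_derive1_nincry _ g 0) => //.
  - move=> x _; rewrite derive1E (@derive_val _ _ _ _ _ _ _ (dg x)).
    rewrite -mulrA -mulrDr pmulr_rle0 ?expR_gt0// mulNr addrC subr_le0.
    exact: bE.
  - by apply: continuous_subspaceT => x; exact: is_derive_continuous (dg x).
rewrite g0 /g pmulr_rle0 ?expR_gt0// => Et.
apply/eqP; rewrite -sqrf_eq0 expr2 eq_le (le_trans (FE i t) Et)/=.
by rewrite -expr2 sqr_ge0.
Qed.

Lemma linear_ode (I : finType) (F : I -> R -> R) (a : I -> I -> R) :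
  (forall i t, der (F i) t (\sum_j a i j * F j t)) -> (forall i, F i 0 = 0) ->
  forall i t, F i t = 0.
Proof.
move=> dF F0 i t; have [t0|t0] := leP 0 t; first exact: linear_ode_ge0 dF F0 i t t0.
have H : forall j x, 0 <= x -> F j (-1 * x + 0) = 0.
  apply: (@linear_ode_ge0 I (fun j x => F j (-1 * x + 0)) (fun j k => - a j k)).
  - move=> j x; have -> : \sum_k - a j k * F k (-1 * x + 0) =
        (\sum_k a j k * F k (-1 * x + 0)) * -1.
      by rewrite mulr_suml; apply: eq_bigr => k _; rewrite mulrN1 (mulNr (a j k)).
    exact: is_derive_comp_affine.
  - by move=> j; rewrite mulr0 addr0.
have t' : 0 <= - t by rewrite oppr_ge0 ltW.
by have := H i _ t'; rewrite mulN1r opprK addr0.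
Qed.

Section Matrices.
Implicit Types (m n p : nat).

Definition mderiv m n (M : R -> 'M[R]_(m, n)) (t : R) (M' : 'M[R]_(m, n)) :=
  forall i j, der (fun x => M x i j) t (M' i j).

Lemma mderiv_cst m n (A : 'M[R]_(m, n)) t : mderiv (fun=> A) t 0.
Proof. by move=> i j; rewrite mxE; exact: is_derive_cst. Qed.

Lemma mderivM m n p (M : R -> 'M[R]_(m, n)) (L : R -> 'M[R]_(n, p)) t M' L' :
  mderiv M t M' -> mderiv L t L' ->
  mderiv (fun x => M x *m L x) t (M' *m L t + M t *m L').
Proof.
move=> dM dL i j; rewrite !mxE -big_split /=.
rewrite (_ : (fun x => _) = (fun x => \sum_k M x i k * L x k j)).
  by apply: is_derive_bigsum => k; exact: is_derive_prod.
by apply/funext => x; rewrite mxE.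
Qed.

Lemma mderiv_lin m n p q (f : {linear 'M[R]_(m, n) -> 'M[R]_(p, q)}) M t M' :
  mderiv M t M' -> mderiv (f \o M) t (f M').
Proof.
move=> dM k l.
have fE (A : 'M[R]_(m, n)) : f A k l = \sum_i \sum_j A i j * f (delta_mx i j) k l.
  rewrite {1}(matrix_sum_delta A) linear_sum summxE; apply: eq_bigr => i _.
  by rewrite linear_sum summxE; apply: eq_bigr => j _; rewrite linearZ mxE.
rewrite fE (_ : (fun x => _) = (fun x => \sum_i \sum_j M x i j * f (delta_mx i j) k l)).
  apply: is_derive_bigsum => i; apply: is_derive_bigsum => j.
  have := is_derive_prod (dM i j) (is_derive_cst (f (delta_mx i j) k l) t (1 : R)).
  by rewrite mulr0 addr0.
by apply/funext => x; rewrite fE.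
Qed.

Lemma mderiv_unique m n (M : R -> 'M[R]_(m, n)) t A B : mderiv M t A -> mderiv M t B -> A = B.
Proof. by move=> MA MB; apply/matrixP => i j; exact: is_derive_unique (MA i j) (MB i j). Qed.

(** A linear projection onto W fixes the path, hence fixes its derivative. *)
Lemma mderiv_in n (W : {vspace 'M[R]_n}) M t A : mderiv M t A ->
  (forall x, M x \in W) -> A \in W.
Proof.
move=> dM MW; have dP := mderiv_lin (projv W) dM.
have -> : A = projv W A.
  apply: (mderiv_unique dM); rewrite (_ : M = projv W \o M)//.
  by apply/funext => x /=; rewrite projv_id.
exact: memv_proj.
Qed.

End Matrices.

Section OneParameterMatrices.
Variables (n : nat) (g : R -> 'M[R]_n).
Hypotheses (gD : forall s t, g (s + t) = g s *m g t) (g0 : g 0 = 1%:M).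

(* A primitive Phi of g satisfies g s (Phi t - Phi 0) = Phi (s + t) - Phi s, and
   Phi t - Phi 0 is invertible for small t > 0. *)
Lemma one_param_mx_derivable : (forall i j, continuous (fun t => g t i j)) ->
  exists A, mderiv g 0 A.
Proof.
(* The interval must contain s + t for |s| < 1 and 0 < t < 1. *)
move=> cg; have ab : (- 2 : R) < 2 by lra.
have /choice[F hF] : forall ij : 'I_n * 'I_n, exists F : R -> R,
    forall x, - 2 < x < 2 -> der F x (g x ij.1 ij.2).
  by move=> ij; exact: local_primitive ab (cg ij.1 ij.2).
pose Phi x : 'M[R]_n := \matrix_(i, j) F (i, j) x.
have dPhi x : - 2 < x < 2 -> mderiv Phi x (g x).
  move=> hx i j; rewrite (_ : (fun y => _) = F (i, j)); first exact: (hF (i, j)).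
  by apply/funext => y; rewrite mxE.
pose D t : 'M[R]_n := \matrix_(i, j) (t^-1 * (Phi t i j - Phi 0 i j)).
(* The difference quotients of Phi at 0 tend to g 0 = 1, so their determinant is nonzero for small
   t. *)
have D1 : \det (D t) @[t --> (0 : R)^'] --> \det (1%:M : 'M[R]_n).
  apply: cvg_big => [|s _]; first exact: add_continuous.
  apply: cvgM; first exact: cvg_cst.
  apply: cvg_big => [|i _]; first exact: mul_continuous.
  have h00 : - 2 < (0 : R) < 2 by lra.
  have := is_derive_cvg0 (dPhi 0 h00 i (s i)); rewrite g0.
  have -> : (fun t => D t i (s i)) = (fun h => h^-1 * (Phi h i (s i) - Phi 0 i (s i))).
    by apply/funext => t; rewrite mxE.
  exact.
have [t [t0 t1 Dt]] : exists t, [/\ 0 < t, t < 1 & D t \in unitmx].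
  move: D1; rewrite det1 => /cvgrPdist_lt /(_ 1 ltr01) /dnbhs0P[d d0 hd].
  pose t := Num.min (d / 2) 2^-1.
  have t0 : 0 < t by rewrite lt_min divr_gt0//= invr_gt0.
  exists t; split=> //; first by rewrite gt_min; apply/orP; right; lra.
  have := hd t; rewrite gt_eqF// gtr0_norm//.
  have -> : t < d by rewrite gt_min; apply/orP; left; lra.
  move=> /(_ isT isT); rewrite unitmxE unitfE; apply: contraTneq => ->.
  by rewrite subr0 normr1 ltxx.
have Mu : Phi t - Phi 0 \in unitmx.
  have -> : Phi t - Phi 0 = t *: D t.
    by apply/matrixP => i j; rewrite !mxE mulrA divff ?mul1r// gt_eqF.
  by rewrite unitmxZ// unitfE gt_eqF.
(* For fixed s, the functions Phi (x + s) and g s Phi x of x have the same derivative g (x + s). The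
   right side is differentiable in s because Phi is. *)
have key s : `|s| < 1 -> g s = (Phi (s + t) - Phi s) *m invmx (Phi t - Phi 0).
  rewrite ltr_norml => /andP[s1 s2].
  suff <- : g s *m (Phi t - Phi 0) = Phi (s + t) - Phi s by rewrite mulmxK.
  apply/matrixP => i j.
  have := @derive0_cst (fun x => Phi (1 * x + s) i j - (g s *m Phi x) i j) 0 t (ltW t0).
  have dH x : 0 <= x <= t ->
      der (fun x => Phi (1 * x + s) i j - (g s *m Phi x) i j) x 0.
    move=> /andP[x0 xt].
    have d1 : der (fun x => Phi (1 * x + s) i j) x (g (1 * x + s) i j).
      have := @is_derive_comp_affine (fun x => Phi x i j) 1 s x (g (1 * x + s) i j).
      by rewrite mulr1; apply; apply: dPhi; lra.
    have x2 : - 2 < x < 2 by lra.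
    have := mderivM (mderiv_cst (g s) x) (dPhi x x2); rewrite mul0mx add0r => /(_ i j) d2.
    have := is_deriveB d1 d2; rewrite mul1r [x + s]addrC gD subrr; exact.
  move=> /(_ dH); rewrite mulr0 add0r mul1r [t + s]addrC => h.
  rewrite mulmxBr !mxE in h *; move: h; move: (\sum_k _) (\sum_k _) => a b.
  by move=> h; lra.
exists ((g t - g 0) *m invmx (Phi t - Phi 0)) => i j.
apply: (is_derive0_local ltr01
  (h := fun s => ((Phi (s + t) - Phi s) *m invmx (Phi t - Phi 0)) i j)).
  by move=> s /key ->.
have dd : mderiv (fun s => Phi (s + t) - Phi s) 0 (g t - g 0).
  move=> k l; have t2 : - 2 < t < 2 by lra.
  have h00 : - 2 < (0 : R) < 2 by lra.
  have d1 : der (fun x => Phi (1 * x + t) k l) 0 (g t k l).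
    have := @is_derive_comp_affine (fun x => Phi x k l) 1 t 0 (g t k l).
    by rewrite mulr1 mulr0 add0r; apply; exact: dPhi.
  have := is_deriveB d1 (dPhi 0 h00 k l).
  rewrite !mxE; congr (is_derive _ _ _ _); apply/funext => x.
  by rewrite -[LHS]/(Phi (1 * x + t) k l - Phi x k l) mul1r !mxE.
have := mderivM dd (mderiv_cst (invmx (Phi t - Phi 0)) 0); rewrite mulmx0 addr0.
exact.
Qed.

Variable A : 'M[R]_n.
Hypothesis gA : mderiv g 0 A.

Lemma one_param_mx_derive t : mderiv g t (g t *m A).
Proof.
have dg : mderiv (fun x => g (1 * x - t)) t A.
  move=> i j; have := @is_derive_comp_affine (fun x => g x i j) 1 (- t) t (A i j).
  rewrite mulr1; apply; rewrite mul1r subrr; exact: gA.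
have := mderivM (mderiv_cst (g t) t) dg; rewrite mul0mx add0r.
rewrite (_ : (fun x => _) = g)//; apply/funext => x.
by rewrite -gD mul1r addrC subrK.
Qed.

Lemma one_param_mx_deriveN t : mderiv (fun x => g (- x)) t (- (A *m g (- t))).
Proof.
have dg : mderiv (fun x => g (-1 * x + t)) t (- A).
  move=> i j; have := @is_derive_comp_affine (fun x => g x i j) (-1) t t (A i j).
  rewrite mulrN1 mxE; apply; rewrite mulN1r addNr; exact: gA.
have := mderivM dg (mderiv_cst (g (- t)) t); rewrite mulmx0 addr0 mulNmx.
rewrite (_ : (fun x => _) = (fun x => g (- x)))//; apply/funext => x.
by rewrite -gD mulN1r addrK.
Qed.

Lemma conj_derive Y t : mderiv (fun x => g x *m Y *m g (- x)) t
  (g t *m lie_bracket A Y *m g (- t)).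
Proof.
have := mderivM (mderivM (one_param_mx_derive t) (mderiv_cst Y t)) (one_param_mx_deriveN t).
rewrite mulmx0 addr0; congr (mderiv _ _ _).
by rewrite /lie_bracket mulmxBr mulmxBl mulmxN !mulmxA.
Qed.

Lemma conj_derive0 Y : mderiv (fun x => g x *m Y *m g (- x)) 0 (lie_bracket A Y).
Proof. by have := conj_derive Y 0; rewrite oppr0 g0 mul1mx mulmx1. Qed.

(** Stability under ad A integrates to conjugation without a matrix exponential: the components
    transverse to q of the conjugates of a basis of q solve a homogeneous linear system and vanish
    at time 0. *)
Lemma conj_in (q : {vspace 'M[R]_n}) : (forall Y, Y \in q -> lie_bracket A Y \in q) ->
  forall Y t, Y \in q -> g t *m Y *m g (- t) \in q.
Proof.
move=> Aq Y t Yq; pose X := vbasis q.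
have Xq b : X`_b \in q.
  have [bX|bX] := ltnP b (size X); first by apply: vbasis_mem; exact: mem_nth.
  by rewrite nth_default ?mem0v.
pose f (Z : 'M[R]_n) := Z - projv q Z.
have fl : linear f.
  by move=> a u v; rewrite /f linearP scalerBr opprD addrACA.
pose f' : {linear 'M[R]_n -> 'M[R]_n} := HB.pack f (GRing.isLinear.Build _ _ _ _ f fl).
pose conj x Z := g x *m Z *m g (- x).
have fX b k l x : f' (conj x X`_b) k l = 0.
  pose F (b : 'I_(\dim q)) x := f' (conj x X`_b) k l.
  have H b' : F b' x = 0.
    apply: (@linear_ode _ F (fun b c => coord X c (lie_bracket A X`_b))).
      move=> i t'; have := mderiv_lin f' (conj_derive X`_i t') k l.
      congr (is_derive _ _ _ _).
      rewrite {1}(coord_vbasis (Aq _ (Xq i))) mulmx_sumr mulmx_suml linear_sum summxE.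
      apply: eq_bigr => c _.
      by rewrite -scalemxAr -scalemxAl linearZ mxE.
    by move=> i; rewrite /F /conj oppr0 g0 mul1mx mulmx1 /= /f projv_id ?subrr ?mxE// Xq.
  have [bX|bX] := ltnP b (\dim q); first exact: (H (Ordinal bX)).
  rewrite nth_default ?size_tuple// /conj mulmx0 mul0mx linear0 mxE//.
have fY : f' (conj t Y) = 0.
  apply/matrixP => k l; rewrite (coord_vbasis Yq) /conj mulmx_sumr mulmx_suml linear_sum summxE.
  rewrite mxE big1// => c _; rewrite -scalemxAr -scalemxAl linearZ mxE.
  by have := fX c k l t; rewrite /conj => ->; rewrite mulr0.
by move/eqP: fY; rewrite /= subr_eq0 /conj => /eqP ->; exact: memv_proj.
Qed.

End OneParameterMatrices.
End Derivatives.

(** * Borel subalgebras *)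

Section Brackets.
Context (K : fieldType) (n : nat).
Implicit Types (X Y : 'M[K]_n) (U V T : {vspace 'M[K]_n}).

Lemma lie_bracket_linearl Y : linear (fun X => lie_bracket X Y).
Proof.
move=> a X Z; rewrite /lie_bracket mulmxDl mulmxDr -scalemxAl -scalemxAr.
by rewrite scalerBr opprD addrACA.
Qed.

Lemma lie_bracketN X Y : lie_bracket Y X = - lie_bracket X Y.
Proof. by rewrite /lie_bracket opprB. Qed.

Lemma lie_bracket_linearr X : linear (lie_bracket X).
Proof.
move=> a Y Z; rewrite !(lie_bracketN _ X) (lie_bracket_linearl X) opprD.
by rewrite -scalerN.
Qed.

Lemma span_ind (V W : vectType K) (f : V -> W) (xs : seq V) (T : {vspace W}) : linear f ->
  (forall x, x \in xs -> f x \in T) -> forall x, x \in <<xs>>%VS -> f x \in T.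
Proof.
move=> lf h x xxs; have xt : x \in <<in_tuple xs>>%VS by [].
pose f' : {linear V -> W} := HB.pack f (GRing.isLinear.Build _ _ _ _ f lf).
rewrite (coord_span xt) -[f]/(f' : V -> W) linear_sum memv_suml// => i _.
by rewrite linearZ memvZ//; apply: h; apply: mem_nth.
Qed.

Lemma bracket_spaceP U V T :
  (bracket_space U V <= T)%VS <-> forall X Y, X \in U -> Y \in V -> lie_bracket X Y \in T.
Proof.
split=> [h X Y XU YV|h].
  have bU x : x \in vbasis U -> forall y, y \in V -> lie_bracket x y \in T.
    move=> xU; rewrite -(span_basis (vbasisP V)); apply: (span_ind (lie_bracket_linearr x)).
    by move=> y yV; apply: (subvP h); apply: memv_span; apply: allpairs_f.
  have XU' : X \in <<vbasis U>>%VS by rewrite (span_basis (vbasisP U)).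
  by apply: (span_ind (lie_bracket_linearl Y) _ XU') => x /bU; apply.
apply/span_subvP => _ /allpairsP[[x y] /= [xU yV ->]].
by apply: h; exact: vbasis_mem.
Qed.

End Brackets.

Section Complexification.
Context (R : realType) (n : nat).
Local Notation C := R[i].
Implicit Types (X Y : 'M[R]_n) (U V T W : {vspace 'M[R]_n}).

Definition cplx X : 'M[C]_n := map_mx (fun x : R => x%:C%C) X.

Lemma cplxM X Y : cplx (X *m Y) = cplx X *m cplx Y.
Proof. exact: (map_mxM (real_complex R)). Qed.

Lemma cplx_bracket X Y : lie_bracket (cplx X) (cplx Y) = cplx (lie_bracket X Y).
Proof. by rewrite /lie_bracket -!cplxM -(map_mxB (real_complex R)). Qed.

Lemma cplx_in U X : X \in U -> cplx X \in complexify U.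
Proof.
move=> XU; rewrite (coord_vbasis XU).
have -> : cplx (\sum_i coord (vbasis U) i X *: (vbasis U)`_i) =
    \sum_i (coord (vbasis U) i X)%:C%C *: cplx (vbasis U)`_i.
  apply/matrixP => k l; rewrite mxE !summxE (raddf_sum (real_complex R)).
  by apply: eq_bigr => i _; rewrite !mxE -(rmorphM (real_complex R)).
apply: memv_suml => i _; apply: memvZ; apply: memv_span; apply: map_f.
by apply: mem_nth; rewrite size_tuple.
Qed.

Lemma complexify_ind (f : 'M[C]_n -> 'M[C]_n) U (T : {vspace 'M[C]_n}) : linear f ->
  (forall X, X \in U -> f (cplx X) \in T) -> forall Z, Z \in complexify U -> f Z \in T.
Proof.
move=> lf h; apply: (span_ind lf) => _ /mapP[X XU ->].
by apply: h; exact: vbasis_mem.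
Qed.

Lemma complexify_sub U (T : {vspace 'M[C]_n}) :
  (forall X, X \in U -> cplx X \in T) -> (complexify U <= T)%VS.
Proof. by move=> h; apply/subvP => Z; apply: (complexify_ind (f := id)). Qed.

Lemma complexifyS U V : (U <= V)%VS -> (complexify U <= complexify V)%VS.
Proof. by move=> /subvP UV; apply: complexify_sub => X /UV; exact: cplx_in. Qed.

Lemma complexify_bracket U V T :
  (forall X Y, X \in U -> Y \in V -> lie_bracket X Y \in T) ->
  forall Z A, Z \in complexify U -> A \in complexify V -> lie_bracket Z A \in complexify T.
Proof.
move=> h Z A ZU AV; apply: (complexify_ind (lie_bracket_linearl A) _ ZU) => X XU.
apply: (complexify_ind (lie_bracket_linearr (cplx X)) _ AV) => Y YV.
by rewrite cplx_bracket; apply: cplx_in; exact: h.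
Qed.

Lemma complexify_Re U Z : Z \in complexify U -> map_mx (@complex.Re R) Z \in U.
Proof.
move=> ZU; have Zt : Z \in <<in_tuple [seq cplx X | X <- vbasis U]>>%VS by [].
rewrite (coord_span Zt).
have -> : forall (m : nat) (F : 'I_m -> 'M[C]_n),
    map_mx (@complex.Re R) (\sum_i F i) = \sum_i map_mx (@complex.Re R) (F i).
  move=> m F; apply/matrixP => k l; rewrite mxE !summxE raddf_sum.
  by apply: eq_bigr => i _; rewrite mxE.
apply: memv_suml => i _.
have : (in_tuple [seq cplx X | X <- vbasis U])`_i \in [seq cplx X | X <- vbasis U].
  by apply: mem_nth.
move=> /mapP[X XU ->]; set z := coord _ _ _.
have -> : map_mx (@complex.Re R) (z *: cplx X) = complex.Re z *: X.
  apply/matrixP => k l; rewrite !mxE; case: z => a b /=.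
  by rewrite mulr0 subr0.
by apply: memvZ; exact: vbasis_mem.
Qed.

Lemma cplx_complexify U X : cplx X \in complexify U -> X \in U.
Proof.
move=> /complexify_Re; rewrite (_ : map_mx _ _ = X)//.
by apply/matrixP => i j; rewrite !mxE.
Qed.

End Complexification.

Section BorelAbsorption.
Context (R : realType) (n : nat).
Implicit Types (g q W I : {vspace 'M[R]_n.+1}).

Lemma complexify_prodv (U V : {vspace 'M[R]_n.+1}) :
  (complexify U * complexify V <= complexify (U * V))%VS.
Proof.
apply/prodvP => Z Y ZU YV.
have lr (A : 'M[R[i]]_n.+1) : linear (fun B => A * B).
  by move=> a B D; rewrite mulrDr scalerAr.
have ll (A : 'M[R[i]]_n.+1) : linear (fun B => B * A).
  by move=> a B D; rewrite mulrDl scalerAl.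
apply: (complexify_ind (ll Y) _ ZU) => X XU.
apply: (complexify_ind (lr (cplx X)) _ YV) => A AV.
by rewrite -[_ * _]/(_ *m _) -cplxM; apply: cplx_in; apply: memv_mul.
Qed.

(** Each step of the derived series doubles the power of J, so a nilpotent J forces U to be
    solvable. *)
Lemma nilpotent_bracket_iter (K : fieldType) (U J : {vspace 'M[K]_n.+1}) k :
  (U <= J)%VS -> (iter k (fun V => bracket_space V V) U <= J ^+ (2 ^ k))%VS.
Proof.
move=> UJ; elim: k => [|k IH] /=; first by rewrite expv1.
apply/bracket_spaceP => X Y /(subvP IH) XJ /(subvP IH) YJ.
by rewrite expnS mul2n -addnn expvD memvB// memv_mul.
Qed.

Lemma borel_absorbs g q W I d : parabolic_subalgebra g q -> (W <= g)%VS ->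
  (forall X Y, X \in q -> Y \in W -> lie_bracket X Y \in W) ->
  (forall X Y, X \in W -> Y \in W -> lie_bracket X Y \in W) ->
  (W <= I)%VS -> (I * I <= I)%VS -> (I ^+ d = 0)%VS -> (W <= q)%VS.
Proof.
move=> [_ _ [b [bg ba bs bmax] bq]] Wg qW WW WI II Id.
pose WC := complexify W.
have bW X Y : X \in b -> Y \in WC -> lie_bracket X Y \in WC.
  by move=> /(subvP bq) Xq; exact: complexify_bracket qW _ _ Xq.
have WWC X Y : X \in WC -> Y \in WC -> lie_bracket X Y \in WC.
  exact: complexify_bracket WW X Y.
have brk (U : {vspace 'M[R[i]]_n.+1}) : (U <= b)%VS ->
    (bracket_space (U + WC) (U + WC) <= bracket_space U U + WC)%VS.
  move=> /subvP Ub; apply/bracket_spaceP => _ _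
    /memv_addP[X XU [A AW ->]] /memv_addP[Y YU [B BW ->]].
  have -> : lie_bracket (X + A) (Y + B) = lie_bracket X Y +
      (lie_bracket X B + (lie_bracket A B - lie_bracket Y A)).
    rewrite (lie_bracketN A Y) opprK.
    have D Z P Q : lie_bracket Z (P + Q) = lie_bracket Z P + lie_bracket Z Q.
      by have := lie_bracket_linearr Z 1 P Q; rewrite !scale1r.
    have := lie_bracket_linearl (Y + B) 1 X A; rewrite !scale1r => ->.
    by rewrite !D -addrA; congr (_ + (_ + _)); rewrite addrC.
  apply: memv_add; first by apply: ((bracket_spaceP _ _ _).1 (subvv _)).
  apply: memvD; first by apply: bW => //; exact: Ub.
  by apply: memvB; [exact: WWC|apply: bW => //; exact: Ub].
have Db k : (iter k (fun V => bracket_space V V) b <= b)%VS.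
  elim: k => [|k IH] /=; first exact: subvv.
  apply: subv_trans ba; apply/bracket_spaceP => X Y /(subvP IH) Xb /(subvP IH) Yb.
  exact: ((bracket_spaceP _ _ _).1 (subvv _)).
have bracketS (U U' : {vspace 'M[R[i]]_n.+1}) : (U <= U')%VS ->
    (bracket_space U U <= bracket_space U' U')%VS.
  move=> /subvP UU; apply/bracket_spaceP => X Y /UU XU /UU YU.
  exact: ((bracket_spaceP _ _ _).1 (subvv _)).
have iterS k (U U' : {vspace 'M[R[i]]_n.+1}) : (U <= U')%VS ->
    (iter k (fun V => bracket_space V V) U <= iter k (fun V => bracket_space V V) U')%VS.
  by move=> UU; elim: k => [//|k IH] /=; exact: bracketS.
have DbW k : (iter k (fun V => bracket_space V V) (b + WC) <=
    iter k (fun V => bracket_space V V) b + WC)%VS.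
  elim: k => [|k IH] /=; first exact: subvv.
  exact: subv_trans (bracketS _ _ IH) (brk _ (Db k)).
have [k0 Dk0] := bs.
have ICn k : (complexify I ^+ k.+1 <= complexify (I ^+ k.+1))%VS.
  elim: k => [|k IH]; first by rewrite !expv1 subvv.
  rewrite expvSl [X in (_ <= complexify X)%VS]expvSl.
  by apply: subv_trans (complexify_prodv _ _); apply: prodvSr.
(* The exponent 2^d is the one reached after d steps of the derived series. It is at least d.+1, a
   positive exponent as required by [ICn]. *)
have ICd : (complexify I ^+ (2 ^ d) = 0)%VS.
  have -> : (2 ^ d = d.+1 + (2 ^ d - d.+1))%N by rewrite subnKC// ltn_expl.
  rewrite expvD; have -> : (complexify I ^+ d.+1 = 0)%VS.
    apply/eqP; rewrite -subv0; apply: subv_trans (ICn d) _.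
    apply: complexify_sub => X; rewrite expvSl Id prodv0 memv0 => /eqP ->.
    by rewrite memv0; apply/eqP/matrixP => i j; rewrite !mxE.
  by rewrite prod0v.
have bWb : (b + WC)%VS = b.
  apply: bmax.
  - exact: addvSl.
  - by rewrite subv_add bg; apply: complexifyS.
  - apply: subv_trans (brk b (subvv _)) _; rewrite subv_add addvSr andbT.
    exact: subv_trans ba (addvSl _ _).
  (* After k0 steps the derived series of b + WC lies in WC, and d further steps kill it. *)
  - exists (d + k0)%N; apply/eqP; rewrite -subv0 iterD.
    apply: subv_trans (iterS d _ _ (DbW k0)) _; rewrite Dk0 add0v -ICd.
    by apply: nilpotent_bracket_iter; exact: complexifyS.
apply/subvP => X XW; apply: cplx_complexify; apply: (subvP bq).
by rewrite -bWb; apply: (subvP (addvSr _ _)); exact: cplx_in.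
Qed.

End BorelAbsorption.

(** * Parabolic subgroups and their unipotent radicals *)

Section Reductive.
Context (R : realType) (G : topologicalGroupType) (n : nat) (rho : G -> 'M[R]_n).
Hypothesis hG : real_reductive rho.
Local Notation mul := (fun x y : G => (x * y)%g).
Local Notation inv := (fun x : G => x^-1%g).

Lemma rho_conj g h X : rho (g * h)%g *m X *m rho (g * h)^-1%g =
  rho g *m (rho h *m X *m rho h^-1%g) *m rho g^-1%g.
Proof. by rewrite invgM !(rr_mul hG) !mulmxA. Qed.

Lemma rho_conjV g X : rho g^-1%g *m (rho g *m X *m rho g^-1%g) *m rho (g^-1)^-1%g = X.
Proof. by rewrite -rho_conj mulVg invg1 (rr_one hG) mul1mx mulmx1. Qed.

Lemma parabolic_subgroup P : parabolic rho P -> is_subgroup mul inv 1%g P.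
Proof.
move=> [g [p [_ _ ->]]]; split=> [X|x y hx hy X|x hx X] /=.
- by rewrite invg1 (rr_one hG) mul1mx mulmx1.
- by rewrite rho_conj; split=> [/(hy _).1/(hx _).1|/(hx _).2/(hy _).2].
- rewrite -{1}[X](rho_conjV (x^-1)%g) !invgK.
  by split=> [/(hx _).2|/(hx _).1].
Qed.

Lemma one_paramV (H : set G) (c : R -> G) t : one_param H c -> (c t)^-1%g = c (- t).
Proof.
move=> Hc; apply: (mulgI (c t)); rewrite mulgV; case: (Hc) => _ <- _.
by rewrite subrr (one_param0 Hc).
Qed.

Lemma rho_one_paramD (H : set G) (c : R -> G) : one_param H c ->
  forall s t, rho (c (s + t)) = rho (c s) *m rho (c t).
Proof. by move=> [_ cD _] s t; rewrite cD (rr_mul hG). Qed.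

Lemma rho_one_param0 (H : set G) (c : R -> G) : one_param H c -> rho (c 0) = 1%:M.
Proof. by move=> Hc; rewrite (one_param0 Hc) (rr_one hG). Qed.

Lemma one_param_lie (H : set G) (c : R -> G) : one_param H c ->
  exists2 A, lie_mx rho H A & mderiv (fun t => rho (c t)) 0 A.
Proof.
move=> Hc; have [A dA] : exists A, mderiv (fun t => rho (c t)) 0 A.
  apply: one_param_mx_derivable (rho_one_paramD Hc) (rho_one_param0 Hc) _ => i j t.
  have [cc _ _] := Hc.
  apply: (@continuous_comp _ _ _ c (fun g => rho g i j)); first exact: cc.
  apply: (@continuous_comp _ _ _ rho (fun M : 'M[R]_n => M i j)); first exact: rr_continuous hG _.
  exact: coord_continuous.
by exists A => //; exists c.
Qed.

Lemma conj_one_param (P N : set G) g (c : R -> G) : is_normal_in mul inv P N -> P g ->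
  one_param N c -> one_param N (fun t => (g * c t * g^-1)%g).
Proof.
move=> [_ nN] Pg [cc cD Nc]; split=> [|x y|t].
- apply: (continuous_comp2 (f := fun t => (g * c t)%g) (g := fun=> (g^-1)%g)
    _ _ (@mulg_continuous G)); last by move=> x; exact: cvg_cst.
  apply: (continuous_comp2 (f := fun=> g) (g := c) _ cc (@mulg_continuous G)).
  by move=> x; exact: cvg_cst.
- by rewrite cD !mulgA mulgVK.
- exact: nN.
Qed.

Lemma conj_lie (P N : set G) g A : is_normal_in mul inv P N -> P g ->
  lie_mx rho N A -> lie_mx rho N (rho g *m A *m rho g^-1%g).
Proof.
move=> nN Pg [c Nc dc]; exists (fun t => (g * c t * g^-1)%g); first exact: conj_one_param nN Pg Nc.
have := mderivM (mderivM (mderiv_cst (rho g) 0) dc) (mderiv_cst (rho g^-1%g) 0).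
rewrite mul0mx add0r mulmx0 addr0 => h i j; have := h i j.
congr (is_derive _ _ _ _); apply/funext => t.
by rewrite !(rr_mul hG).
Qed.

(** All factors share the parameter t, so the product is a path starting at 1; this makes the
    generated subgroup connected. *)
Definition gpath (cs : seq (R -> G)) (t : R) : G := foldr (fun c h => (c t * h)%g) 1%g cs.

Definition one_params (H : set G) : pred (seq (R -> G)) := all (fun c => `[< one_param H c >]).

Definition one_param_gen (H : set G) : set G :=
  [set g | exists2 cs, one_params H cs & g = gpath cs 1].

Lemma gpath_cat cs ds t : gpath (cs ++ ds) t = (gpath cs t * gpath ds t)%g.
Proof. by elim: cs => [|c cs IH] /=; rewrite ?mul1g// IH mulgA. Qed.

Lemma gpath_continuous H cs : one_params H cs -> continuous (gpath cs).
Proof.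
elim: cs => [_ t|c cs IH /= /andP[/asboolP[cc _ _] /IH cgs]]; first exact: cvg_cst.
exact: (continuous_comp2 cc cgs (@mulg_continuous G)).
Qed.

Lemma gpath0 H cs : one_params H cs -> gpath cs 0 = 1%g.
Proof.
by elim: cs => [//|c cs IH /= /andP[/asboolP Hc /IH ->]]; rewrite (one_param0 Hc) mulg1.
Qed.

Lemma gpath_in (H K : set G) cs t : is_subgroup mul inv 1%g K ->
  (forall (c : R -> G) t, one_param H c -> K (c t)) -> one_params H cs -> K (gpath cs t).
Proof.
move=> [K1 KM _] HK; elim: cs => [//|c cs IH /= /andP[/asboolP Hc /IH]].
by apply: KM; exact: HK.
Qed.

Lemma one_param_gen_in H (c : R -> G) t : one_param H c -> one_param_gen H (c t).
Proof.
move=> Hc; exists [:: fun x => c (t * x)]; last by rewrite /= mulr1 mulg1.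
by rewrite /one_params /= andbT; apply/asboolP; exact: one_param_scale.
Qed.

Lemma gpath_gen H cs t : one_params H cs -> one_param_gen H (gpath cs t).
Proof.
move=> Hcs; exists [seq (fun x => c (t * x)) | c <- cs].
  elim: cs Hcs => [//|c cs IH /= /andP[/asboolP Hc /IH ->]]; rewrite andbT.
  by apply/asboolP; exact: one_param_scale.
by elim: cs {Hcs} => [//|c cs IH] /=; rewrite IH mulr1.
Qed.

Lemma one_param_gen_ind H (K : set G) : K 1%g ->
  (forall (c : R -> G) g, one_param H c -> K g -> K (c (1%R : R) * g)%g) -> one_param_gen H `<=` K.
Proof.
move=> K1 KS _ [cs + ->]; elim: cs => [//|c cs IH /= /andP[/asboolP Hc /IH]].
exact: KS.
Qed.

Lemma one_param_gen_subgroup H : is_subgroup mul inv 1%g (one_param_gen H).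
Proof.
have H1 : one_param_gen H 1%g by exists [::].
have HM x y : one_param_gen H x -> one_param_gen H y -> one_param_gen H (x * y)%g.
  move=> [cs Hcs ->] [ds Hds ->]; exists (cs ++ ds); last by rewrite gpath_cat.
  by rewrite /one_params all_cat; apply/andP.
split=> //; apply: one_param_gen_ind; first by rewrite invg1.
move=> c g Hc IH; rewrite invgM; apply: HM => //.
by rewrite (one_paramV _ Hc); exact: one_param_gen_in.
Qed.

Lemma one_param_gen_connected H : connected (one_param_gen H).
Proof.
have -> : one_param_gen H = \bigcup_(cs in [set cs | one_params H cs]) (gpath cs @` setT).
  apply/seteqP; split=> [_ [cs Hcs ->]|_ [cs Hcs [t _ <-]]].
    by exists cs => //; exists 1.
  exact: gpath_gen.
apply: bigcup_connected => [|cs Hcs].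
  by exists 1%g => cs Hcs; exists 0 => //; exact: gpath0 Hcs.
apply: connected_continuous_connected; first by apply/connected_intervalP.
by apply: continuous_subspaceT; exact: gpath_continuous Hcs.
Qed.

Lemma one_param_gen_normal (P N : set G) : is_normal_in mul inv P N ->
  forall x u, P x -> one_param_gen N u -> one_param_gen N (x * u * x^-1)%g.
Proof.
move=> nN x u Px; have [_ HM _] := one_param_gen_subgroup N; move: u.
apply: one_param_gen_ind; first by rewrite mulg1 mulgV; have [] := one_param_gen_subgroup N.
move=> c g Nc IH; rewrite mulgA -(mulgVK x (x * c 1%R)%g) -!mulgA mulgA.
rewrite !mulgA -(mulgA _ x g) -(mulgA _ (x * g)%g); apply: HM => //.
exact: one_param_gen_in 1 (conj_one_param nN Px Nc).
Qed.

End Reductive.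

Section Radicals.
Context (R : realType) (G : topologicalGroupType) (n : nat) (rho : G -> 'M[R]_n.+1).
Hypothesis hG : real_reductive rho.
Local Notation mul := (fun x y : G => (x * y)%g).
Local Notation inv := (fun x : G => x^-1%g).

Section Unipotent.
Variables (N : set G).
Hypotheses (sN : is_subgroup mul inv 1%g N) (uN : forall u, N u -> unipotent_mx (rho u)).

Definition rho_image (M : 'M[R]_n.+1) := exists2 g, N g & M = rho g.

Lemma rho_imageM X Y : rho_image X -> rho_image Y -> rho_image (X * Y).
Proof.
move=> [g Ng ->] [h Nh ->]; exists (g * h)%g; first by case: sN => _ + _; apply.
by rewrite (rr_mul hG).
Qed.

Lemma rho_image_unipotent X : rho_image X -> exists k, (X - 1) ^+ k = 0.
Proof. by move=> [g Ng ->]; have [k h] := uN Ng; exists k. Qed.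

Lemma rho_expg g u : rho (g ^+ u)%g = rho g ^+ u.
Proof.
elim: u => [|u IH]; first by rewrite expg0 expr0 (rr_one hG).
by rewrite expgS exprS (rr_mul hG) IH.
Qed.

Lemma rho_gprod u (gs : seq G) : rho (gprod u gs) = \prod_(g <- gs) rho g ^+ u.
Proof.
elim: gs => [|g gs IH] /=; first by rewrite big_nil (rr_one hG).
by rewrite big_cons (rr_mul hG) rho_expg IH.
Qed.

(** The scale also involves the inverse of its argument; by this identity the same growth bound
    covers it. *)
Lemma gprodV u (gs : seq G) : (gprod u gs)^-1%g = gprod u (rev [seq g^-1%g | g <- gs]).
Proof.
elim: gs => [|g gs IH] /=; first by rewrite invg1.
by rewrite invgM IH rev_cons gprod_rcons expVgn.
Qed.

Lemma mxtrace_square_le (M : 'M[R]_n.+1) (c : R) : (forall i j, `|M i j| <= c) ->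
  \tr (M *m M^T) <= (n.+1 * n.+1)%:R * c ^+ 2.
Proof.
move=> Mc; rewrite /mxtrace.
rewrite (_ : (n.+1 * n.+1)%:R * c ^+ 2 = \sum_(i < n.+1) \sum_(j < n.+1) c ^+ 2).
  apply: ler_sum => i _; rewrite mxE; apply: ler_sum => j _.
  rewrite mxE -expr2 -real_normK ?num_real// lerXn2r// ?nnegrE//.
  exact: le_trans (Mc i j).
by rewrite !sumr_const !card_ord -mulrnA mulr_natl.
Qed.

Lemma scale_growth s : algebraic_scale rho s -> exists D : nat,
  forall gs : seq G, (forall g, g \in gs -> N g) ->
  exists C : R, forall u : nat, s (gprod u gs) <= C * u.+1%:R ^+ D.
Proof.
move=> [s0 [C0 [m hs]]].
have [d hd] := unipotent_growth rho_imageM rho_image_unipotent.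
(* The factor 2 comes from the squares of the matrix entries in [scale_of], and m from the
   comparison of s with [scale_of]. *)
exists (d * 2 * m)%N => gs Ngs.
have [|C1 h1] := hd (map rho gs).
  by move=> _ /mapP[g gs_g ->]; exists g => //; exact: Ngs.
have [|C2 h2] := hd (map rho (rev [seq g^-1%g | g <- gs])).
  move=> _ /mapP[g + ->]; rewrite mem_rev => /mapP[h /Ngs Nh ->].
  by exists h^-1%g => //; case: sN => _ _; apply.
pose K : R := (n.+1 * n.+1)%:R * (C1 ^+ 2 + C2 ^+ 2).
exists (`|C0| * K ^+ m) => u; have [hu _] := hs (gprod u gs).
have sc : scale_of rho (gprod u gs) <= K * u.+1%:R ^+ (d * 2).
  have -> : K * u.+1%:R ^+ (d * 2) = (n.+1 * n.+1)%:R * (C1 * u.+1%:R ^+ d) ^+ 2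
      + (n.+1 * n.+1)%:R * (C2 * u.+1%:R ^+ d) ^+ 2.
    by rewrite /K exprM !exprMn mulrDr mulrDl !mulrA.
  apply: lerD.
    by apply: mxtrace_square_le => i j; rewrite rho_gprod -(big_map rho xpredT (fun M => M ^+ u)).
  apply: mxtrace_square_le => i j; rewrite gprodV rho_gprod.
  by rewrite -(big_map rho xpredT (fun M => M ^+ u)).
have sc0 : 0 <= scale_of rho (gprod u gs).
  have h (M : 'M[R]_n.+1) : 0 <= \tr (M *m M^T).
    apply: sumr_ge0 => i _; rewrite mxE; apply: sumr_ge0 => j _.
    by rewrite mxE -expr2 sqr_ge0.
  by rewrite addr_ge0.
apply: (le_trans hu); apply: (@le_trans _ _ (`|C0| * scale_of rho (gprod u gs) ^+ m)).
  by rewrite ler_wpM2r ?exprn_ge0// ler_norm.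
rewrite -mulrA ler_wpM2l// exprM -exprMn lerXn2r// nnegrE//.
exact: le_trans sc0 sc.
Qed.

End Unipotent.

(** Once the span W of Lie(N) lies in q, the one-parameter subgroups of N normalize q and so lie in
    Q. The group they generate is connected, unipotent and, as Q is contained in P, normal in Q; the
    maximality of NQ concludes. *)
Lemma one_param_radical (P N Q NQ : set G) :
  parabolic rho P -> unipotent_radical rho P N ->
  parabolic rho Q -> unipotent_radical rho Q NQ -> Q `<=` P ->
  forall c : R -> G, one_param N c -> one_param NQ c.
Proof.
move=> hP [[sN nN cN uN] _] hQ [_ maxNQ] QP.
have sQ := parabolic_subgroup hG hQ.
have [g [q [hg hq QE]]] := hQ.
have [d [I [II Id SI]]] := kolchin (rho_imageM sN) (rho_image_unipotent uN).
have [xs [xsL Lxs]] := finite_span (lie_mx rho N).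
pose W : {vspace 'M[R]_n.+1} := <<xs>>%VS.
have Wind (T : {vspace 'M[R]_n.+1}) : (forall A, lie_mx rho N A -> A \in T) -> (W <= T)%VS.
  by move=> h; apply/span_subvP => A /xsL; exact: h.
have WI : (W <= I)%VS.
  apply: Wind => A [c Nc dc]; have [_ _ NcN] := Nc.
  have dA : mderiv (fun t => rho (c t) - 1) 0 A.
    move=> i j; have := is_deriveB (dc i j) (is_derive_cst ((1 : 'M[R]_n.+1) i j) 0 (1 : R)).
    rewrite subr0; congr (is_derive _ _ _ _); apply/funext => t.
    by rewrite -[LHS]/(rho (c t) i j - (1 : 'M[R]_n.+1) i j) [RHS]mxE [X in _ = _ + X]mxE.
  by apply: (mderiv_in dA) => t; apply: SI; exists (c t).
have adPW x A : P x -> A \in W -> rho x *m A *m rho x^-1%g \in W.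
  move=> Px; apply: (@span_ind _ _ _ (fun B => rho x *m B *m rho x^-1%g)) => [a B D|B /xsL LB].
    by rewrite mulmxDr mulmxDl -scalemxAr -scalemxAl.
  exact: Lxs (conj_lie hG nN Px LB).
have adW X A : lie_mx rho P X -> A \in W -> lie_bracket X A \in W.
  move=> [c Pc dc] AW; have [_ _ cP] := Pc.
  apply: (mderiv_in (conj_derive0 (rho_one_paramD hG Pc) (rho_one_param0 hG Pc) dc A)) => t.
  by rewrite -(one_paramV t Pc); exact: adPW.
have [qg qL _] := hq.
(* A direction X in q preserves q under bracket, hence its one-parameter group preserves q under
   conjugation, which is the definition of Q. *)
have qQ (H : set G) (c : R -> G) X : one_param H c -> mderiv (fun t => rho (c t)) 0 X ->
    X \in q -> forall t, Q (c t).
  move=> Hc dc Xq t; rewrite QE /= (one_paramV t Hc).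
  have h Y x : Y \in q -> rho (c x) *m Y *m rho (c (- x)) \in q.
    apply: (conj_in (rho_one_paramD hG Hc) (rho_one_param0 hG Hc) dc).
    by move=> Z Zq; exact: ((bracket_spaceP _ _ _).1 qL).
  move=> Y; split=> [/h //|/(h _ (- t))].
  by rewrite opprK -(one_paramV t Hc) -{4}[c t]invgK (rho_conjV hG).
have Wg : (W <= g)%VS.
  by apply: Wind => A [c Nc dc]; apply/hg; exists c => //; exact: one_paramS Nc.
have qP X : X \in q -> lie_mx rho P X.
  move=> Xq; have /hg[c [cc cD _] dc] := subvP qg _ Xq.
  exists c => //; split=> // t; apply: QP; apply: (qQ setT c X) => //.
have Wq : (W <= q)%VS.
  apply: (borel_absorbs hq Wg _ _ WI II Id) => X A XW AW; first exact: adW (qP X XW) AW.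
  apply: (span_ind (lie_bracket_linearl A) _ XW) => B /xsL[c Nc dc].
  by apply: adW AW; exists c => //; exact: one_paramS nN.1 Nc.
have NQ' (c : R -> G) t : one_param N c -> Q (c t).
  move=> Nc; have [A LA dA] := one_param_lie hG Nc.
  apply: (qQ N c A) => //; apply: (subvP Wq); exact: Lxs.
move=> c Nc; have [cc cD _] := Nc; split=> // t.
suff sub : @one_param_gen R G N `<=` NQ by apply: sub; exact: one_param_gen_in.
apply: maxNQ; split.
- exact: one_param_gen_subgroup.
- split=> [_ [cs Ncs ->]|x u Qx]; first exact: gpath_in sQ NQ' Ncs.
  by apply: one_param_gen_normal nN _ _ _; exact: QP.
- exact: one_param_gen_connected.
- move=> _ [cs Ncs ->]; apply: uN; apply: (gpath_in 1 sN _ Ncs).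
  by move=> d' t' [_ _ ].
Qed.

End Radicals.

(** * The functors CJ and CJ_s *)

Lemma dense_closureP (T : topologicalType) (S : set T) : dense S <-> forall x, closure S x.
Proof.
split=> [dS x A /[dup] nA|cS O [x Ox] oO].
  rewrite nbhsE => -[B [oB Bx] BA].
  have [y [By Sy]] := dS B (ex_intro _ x Bx) oB.
  by exists y; split=> //; exact: BA.
have [y [Sy Oy]] := cS x O (open_nbhs_nbhs (conj oO Ox)).
by exists y.
Qed.

Section QuotientIso.
Context (R : realType) (G : topologicalGroupType) (H : set G).
Variables (V X Y : representation R G) (a : V -> X) (b : V -> Y).
Hypotheses (la : linear a) (ca : continuous a) (sa : forall x, exists v, a v = x).
Hypothesis oa : forall v A, nbhs v A -> nbhs (a v) (a @` A).
Hypothesis ea : forall h v, H h -> a (rep_act h v) = rep_act h (a v).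
Hypotheses (lb : linear b) (cb : continuous b).
Hypothesis eb : forall h v, H h -> b (rep_act h v) = rep_act h (b v).
Hypothesis ab : forall v, a v = 0 -> b v = 0.

(** The lift through a is discontinuous in general; continuity of the factored map comes from the
    openness of a. *)
Lemma quot_factor : exists2 f : X -> Y, morphism H f & forall v, f (a v) = b v.
Proof.
exists (fun x => b (quot_lift a x)); last first.
  move=> v; apply/eqP; rewrite -subr_eq0 -(linear_mapB lb); apply/eqP/ab.
  by rewrite (linear_mapB la) (quot_liftK sa) subrr.
have fE v : b (quot_lift a (a v)) = b v.
  apply/eqP; rewrite -subr_eq0 -(linear_mapB lb); apply/eqP/ab.
  by rewrite (linear_mapB la) (quot_liftK sa) subrr.
split.
- move=> k x y; have [v <-] := sa x; have [w <-] := sa y.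
  by rewrite -la !fE lb.
- move=> x A; have [v <-] := sa x; rewrite fE => /cb /oa nA.
  refine (@filterS _ (nbhs (a v)) _ _ _ _ nA) => _ [w /= Aw <-]; rewrite /= fE.
  exact: Aw.
- by move=> h x Hh; have [v <-] := sa x; rewrite -ea// !fE eb.
Qed.

End QuotientIso.

Lemma quot_isomorphic (R : realType) (G : topologicalGroupType) (H : set G)
    (V X Y : representation R G) (a : V -> X) (b : V -> Y) :
  linear a -> continuous a -> (forall x, exists v, a v = x) ->
  (forall v A, nbhs v A -> nbhs (a v) (a @` A)) ->
  (forall h v, H h -> a (rep_act h v) = rep_act h (a v)) ->
  linear b -> continuous b -> (forall x, exists v, b v = x) ->
  (forall v A, nbhs v A -> nbhs (b v) (b @` A)) ->
  (forall h v, H h -> b (rep_act h v) = rep_act h (b v)) ->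
  (forall v, a v = 0 <-> b v = 0) -> isomorphic H X Y.
Proof.
move=> la ca sa oa ea lb cb sb ob eb ab.
have [f mf fE] := quot_factor la sa oa ea lb cb eb (fun v => (ab v).1).
have [g mg gE] := quot_factor lb sb ob eb la ca ea (fun v => (ab v).2).
exists f, g; split=> //.
- by move=> x; have [v <-] := sa x; rewrite fE gE.
- by move=> x; have [v <-] := sb x; rewrite gE fE.
Qed.

Lemma CJ_map_proj (R : realType) (G : topologicalGroupType) (N : set G)
    (V1 V2 : representation R G) (f : V1 -> V2) v : N_compatible N f ->
  CJ_map f (CJ_proj N V1 v) = CJ_proj N V2 (f v).
Proof. by move=> fN; apply: CJ_eqP => k; exact: (CJ_mapE fN). Qed.

Section CasselmanJacquetTheory.
Context (R : realType) (G : topologicalGroupType).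
Variables (P N : set G) (s : G -> R).
Local Notation mul := (fun x y : G => (x * y)%g).
Local Notation inv := (fun x : G => x^-1%g).
Hypotheses (subP : is_subgroup mul inv 1%g P) (nN : is_normal_in mul inv P N).
Hypothesis s0 : forall g, 0 < s g.
Hypothesis grow : exists D : nat, forall gs : seq G, (forall g, g \in gs -> N g) ->
  exists C : R, forall u : nat, s (gprod u gs) <= C * u.+1%:R ^+ D.

Section OneRepresentation.
Variable V : representation R G.
Hypothesis rP : Rep P s V.
Let fV : frechet V := Rep_frechet rP.
Let stable := Fil_stable subP nN rP s0 grow.

Lemma CJ_proj_equiv h v : P h ->
  CJ_proj N V (rep_act h v) = rep_act (r := CJ N V) h (CJ_proj N V v).
Proof. by move=> Ph; apply/esym; exact: CJ_map_proj (act_compat subP nN rP Ph). Qed.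

Lemma CJ_proj_ker_closed : closed [set v | CJ_proj N V v = 0].
Proof.
rewrite (_ : [set v | _] = CJs_set N V); first exact: CJs_set_closed.
by apply/seteqP; split=> v /CJ_proj_ker.
Qed.

(** The axioms are carried over from V along the open surjection [CJ_proj], not verified on the
    inverse limit. *)
Lemma CJ_Rep : Rep P s (CJ N V).
Proof.
apply: (@quot_Rep _ _ V (CJ N V) (CJ_proj N V)) => //.
- exact: CJ_proj_linear.
- exact: CJ_proj_continuous.
- exact: CJ_proj_surj fV stable.
- exact: CJ_proj_open fV stable.
- exact: CJ_proj_ker_closed.
- by move=> h v; exact: CJ_proj_equiv.
Qed.

Lemma CJs_incl_linear : linear (CJs_incl N V).
Proof. by move=> a u v. Qed.

Lemma CJs_incl_continuous : continuous (CJs_incl N V).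
Proof. exact: (@sub_space_val_continuous _ _ (@CJs_pred R G N V)). Qed.

Lemma CJs_incl_inj : injective (CJs_incl N V).
Proof. exact: val_inj. Qed.

Lemma CJs_incl_range : range (CJs_incl N V) = CJs_set N V.
Proof.
apply/seteqP; split=> [_ [u _ <-]|v vS].
  by have := valP (u : CJs_space N V); rewrite inE.
have vS' : v \in @CJs_pred R G N V by rewrite inE.
by exists (Sub v vS' : CJs_space N V).
Qed.

Lemma CJs_initial (u : CJs N V) A : nbhs u A ->
  exists2 B, nbhs (CJs_incl N V u) B & forall w, B (CJs_incl N V w) -> A w.
Proof.
rewrite nbhsE => -[B [[D oD DB] Bu] BA].
exists D; first by apply: open_nbhs_nbhs; split=> //; rewrite -DB in Bu.
by move=> w Dw; apply: BA; rewrite -DB.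
Qed.

Lemma CJs_incl_equiv h u : P h ->
  CJs_incl N V (rep_act h u) = rep_act h (CJs_incl N V u).
Proof. by move=> Ph; exact: (CJs_mapE (act_compat subP nN rP Ph)). Qed.

Lemma CJs_Rep : Rep P s (CJs N V).
Proof.
apply: (@sub_Rep _ _ (CJs N V) V (CJs_incl N V)) => //.
- exact: CJs_incl_continuous.
- by rewrite CJs_incl_range; exact: CJs_set_closed.
- exact: CJs_initial.
- by move=> h u; exact: CJs_incl_equiv.
Qed.

Lemma CJ_proj_range : range (CJ_proj N V) = setT.
Proof.
by apply/seteqP; split=> // x _; have [v <-] := CJ_proj_surj fV stable x; exists v.
Qed.

Lemma CJ_exact : strict_short_exact P s (CJs_incl N V : CJs N V -> V)
  (CJ_proj N V : V -> CJ N V).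
Proof.
split.
- by split=> //; [exact: CJs_Rep|exact: CJ_Rep].
- split; split.
  + exact: CJs_incl_linear.
  + exact: CJs_incl_continuous.
  + by move=> h u; exact: CJs_incl_equiv.
  + exact: CJ_proj_linear.
  + exact: CJ_proj_continuous.
  + by move=> h v; exact: CJ_proj_equiv.
- exact: CJs_incl_inj.
- rewrite CJs_incl_range; apply/seteqP; split=> v /=; by rewrite (CJ_proj_ker N v).
- exact: CJ_proj_range.
- rewrite CJ_proj_range CJs_incl_range; split; first exact: CJs_set_closed.
  exact: closedT.
Qed.

Lemma act_CJs g v : P g -> CJs_set N V v -> CJs_set N V (rep_act g v).
Proof. by move=> Pg h k _; apply: (act_Fil subP nN rP Pg); exact: h. Qed.

(* Working with g - 1, g in exp(n), rather than with X in n makes the bound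
   uniform: p (g w) <= s(g)^r p2 w with r and p2 independent of g. *)
Lemma closure_ndot_CJs : closure (lspan (ndot N (CJs_set N V))) = CJs_set N V.
Proof.
have lC := @CJs_set_linear R G N V; have cC := @CJs_set_closed R G N V.
apply/seteqP; split.
  apply: closure_lspan_sub => // w [c [v [Nc Cv dw]]].
  apply: cC; have [_ _ cN] := Nc.
  apply: (derivative_in_closure rP lC _ (one_param0 Nc) dw) => t.
  by apply: (linear_setB lC) => //; apply: act_CJs => //; exact/nN.1.
pose T := closure (lspan (ndot N (CJs_set N V))).
have lT : linear_set T by exact/closure_linear/lspan_linear.
have cT : closed T by exact: closed_closure.
have act_T g u : P g -> T u -> T (rep_act g u).
  move=> Pg; have [lg cg gc] := act_compat subP nN rP Pg.
  apply: lin_closure_sub => // w [c [v [Nc Cv dw]]].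
  have [c' Nc' cc'] := gc c Nc.
  apply/subset_closure/sub_lspan; exists c', (rep_act g v); split=> //.
    exact: act_CJs.
  have := derivative_at0_lin lg cg dw; apply: derivative_at0_ext => t /=.
  exact: cc'.
have act1_T g z : exp_of R N g -> CJs_set N V z -> T (act1 g z).
  move=> [c Nc ->] Cz; have Pc := one_paramS nN.1 Nc; have [_ _ cP] := Pc.
  have [w dw] := orbit_derivative subP rP z Pc.
  apply: (act1_in subP nN rP 1 Pc lT cT _ dw); first by move=> x u; exact: act_T.
  by apply/subset_closure/sub_lspan; exists c, z.
move=> v Cv; apply/(closure_pdist _ fV (lspan_linear _)) => p cp.
suff : pdist p T v = 0.
  move=> pT; apply/eqP; rewrite eq_le (pdist_ge0 cp.1 (lspan_linear _)) andbT.
  apply/ler_addgt0Pr => e e0; rewrite add0r.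
  have e2 : 0 < e / 2 by rewrite divr_gt0.
  have /(pdist_lt cp.1 lT)[t Tt vt] : pdist p T v < e / 2 by rewrite pT.
  have [u Lu tu] := (closure_csemi fV _ _).1 Tt p cp _ e2.
  apply: (le_trans (pdist_le_dist cp.1 (lspan_linear _) _ Lu)).
  by rewrite ltW// (le_lt_trans (seminorm_dist cp.1 _ t _))// [e]splitr ltrD.
have cq := pdist_csemi cp lT.
have [r [p2 [s2 c2 h2]]] := Rep_moderate rP cp.1 cp.2.
(* Density of CJ_s for p + p2 lets one z approximate w for both seminorms. Since v lies in F_(m+1),
   [Fil_step] reduces it to vectors (g - 1) w with w in F_m, the range where this density holds. *)
have cpp := csemiD cp (conj s2 c2).
have [m hm] := Fil_CJs_dense fV stable cpp.
have Fv : Fil N m.+1 v by exact: Cv.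
apply: (closure_lspan_sub (null_linear cq.1) (null_closed fV cq) _ (Fil_step rP Fv)).
move=> _ [g [w [Eg Fw ->]]] /=.
have Pg : P g by apply/nN.1/(exp_of_sub Eg).
apply/eqP; rewrite eq_le (pdist_ge0 cp.1 lT) andbT.
apply/ler_addgt0Pr => e e0; rewrite add0r.
(* The error p ((g - 1)(w - z)) is at most s(g)^r p2 (w - z) + p (w - z), which s(g)^r + 1 times (p
   + p2)(w - z) dominates. *)
have K0 : 0 < s g ^+ r + 1 by rewrite addr_gt0// exprn_gt0.
have [z Cz wz] := hm w _ (divr_gt0 e0 K0) Fw.
apply: (le_trans (pdist_le_dist cp.1 lT _ (act1_T g z Eg Cz))).
rewrite -(linear_mapB (act1_linear subP nN rP Pg)) /act1.
apply: (le_trans (seminorm_triB cp.1 _ _)).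
move: wz; rewrite ltr_pdivlMr// => /ltW; apply: le_trans.
have a1 := h2 g (w - z) Pg; have a2 := seminorm_ge0 cp.1 (w - z).
have a3 := seminorm_ge0 s2 (w - z); have a4 : 0 < s g ^+ r by rewrite exprn_gt0.
nra.
Qed.

End OneRepresentation.

Section Functorial.
Variables (V1 V2 : representation R G) (f : V1 -> V2).
Hypotheses (r1 : Rep P s V1) (r2 : Rep P s V2) (mf : morphism setT f).
Let f1 : frechet V1 := Rep_frechet r1.
Let f2 : frechet V2 := Rep_frechet r2.
Let stable1 := Fil_stable subP nN r1 s0 grow.
Let stable2 := Fil_stable subP nN r2 s0 grow.
Let fN : N_compatible N f := morphism_N_compatible N mf.
Let fl : linear f := mor_linear mf.
Let fc : continuous f := mor_continuous mf.

Lemma CJ_map_morphism : morphism P (CJ_map f : CJ N V1 -> CJ N V2).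
Proof.
have [g mg gE] := @quot_factor R G P V1 (CJ N V1) (CJ N V2) (CJ_proj N V1) (CJ_proj N V2 \o f)
  (@CJ_proj_linear _ _ N V1) (CJ_proj_surj f1 stable1)
  (CJ_proj_open f1 stable1) (fun h v => CJ_proj_equiv r1 v)
  (fun a u v => etrans (congr1 _ (fl a u v)) (@CJ_proj_linear _ _ N V2 a _ _))
  (fun v A nA => fc (@CJ_proj_continuous _ _ N V2 (f v) A nA))
  (fun h v Ph => etrans (congr1 _ (mor_equivariant mf v I)) (CJ_proj_equiv r2 _ Ph))
  (fun v h => (CJ_proj_ker N _).2 (fun k _ => N_compatible_npow_cl fN ((CJ_proj_ker N _).1 h k I))).
rewrite (_ : (CJ_map f : CJ N V1 -> CJ N V2) = g)//.
apply/funext => x; have [v <-] := CJ_proj_surj f1 stable1 x.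
by rewrite gE CJ_map_proj.
Qed.

Lemma CJs_map_morphism : morphism P (CJs_map f : CJs N V1 -> CJs N V2).
Proof.
split.
- move=> a u v; apply: val_inj.
  rewrite -[RHS]/(a *: val (CJs_map f u : CJs_space N V2) + val (CJs_map f v : CJs_space N V2)).
  by rewrite !(CJs_mapE fN) -fl.
- move=> u A /CJs_initial[B]; rewrite {1}/CJs_incl (CJs_mapE fN) => /fc nB hB.
  refine (@filterS _ (nbhs u) _ _ _ _ (@CJs_incl_continuous V1 u _ nB)) => w Bw.
  by apply: hB; rewrite /CJs_incl (CJs_mapE fN).
- move=> h u Ph; apply: val_inj; rewrite (CJs_mapE fN).
  rewrite -/(CJs_incl N V1 (rep_act h u)) CJs_incl_equiv//.
  rewrite -/(CJs_incl N V2 (rep_act h _)) CJs_incl_equiv//.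
  by rewrite /CJs_incl (CJs_mapE fN) (mor_equivariant mf).
Qed.

Lemma CJ_map_surj : range f = setT -> range (CJ_map f : CJ N V1 -> CJ N V2) = setT.
Proof.
move=> rf; apply/seteqP; split=> // y _; have [w <-] := CJ_proj_surj f2 stable2 y.
have [v _ <-] : range f w by rewrite rf.
by exists (CJ_proj N V1 v) => //; rewrite CJ_map_proj.
Qed.

Hypothesis df : dense (range f).

(** F_(k+1) is generated by the (g - 1) w with w in F_k, and g - 1 is continuous and commutes with
    f, so density propagates from one step to the next. *)
Lemma Fil_dense k : Fil N k `<=` closure (f @` Fil N k).
Proof.
have lf k' : linear_set (f @` Fil N k').
  have [F0 Fl] := @Fil_linear R G N V1 k'; split.
    by exists 0 => //; exact: linear_map0.
  move=> a _ _ [u Fu <-] [v Fv <-]; exists (a *: u + v); last exact: fl.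
  exact: Fl.
elim: k => [|k IH] v.
  move=> _; have /dense_closureP/(_ v) := df; apply: closure_subset => _ [u _ <-].
  by exists u => //; exact: Fil0.
move=> /(Fil_step r2); apply: closure_lspan_sub; [exact: closure_linear|exact: closed_closure|].
move=> _ [g [w [Eg /IH Fw ->]]]; have Pg : P g by apply/nN.1/(exp_of_sub Eg).
have {}Fw : closure (lspan (f @` Fil N k)) w by apply: closure_subset Fw; exact: sub_lspan.
apply: (lin_closure_sub (act1_linear subP nN r2 Pg) (act1_continuous subP nN r2 Pg) _ _ _ Fw);
  [exact: closure_linear|exact: closed_closure|].
move=> _ [u Fu <-]; apply: subset_closure; exists (act1 g u).
  exact: (act1_Fil subP nN r1 Eg Fu).
by rewrite /act1 (linear_mapB fl) (mor_equivariant mf).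
Qed.

(** Choose m so that CJ_s of V1 is dense in F_m for the seminorm p o f. An element of CJ_s of V2 is
    p-close to some f w with w in F_m, and w is then replaced by an element of CJ_s. *)
Lemma CJs_map_dense : dense (range (CJs_map f : CJs N V1 -> CJs N V2)).
Proof.
apply/dense_closureP => y A /CJs_initial[B /(nbhs_csemi f2)[p cp [e e0 pB]] hB].
have [m hm] := Fil_CJs_dense f1 stable1 (csemi_comp fl fc cp).
have Cy : CJs_set N V2 (CJs_incl N V2 y) by rewrite -CJs_incl_range; exists y.
have e2 : 0 < e / 2 by rewrite divr_gt0.
have [_ [w Fw <-] yw] := (closure_csemi f2 _ _).1 (Fil_dense (Cy m I)) p cp _ e2.
have [z Cz /= wz] := hm w _ e2 Fw.
have [x _ xz] : range (CJs_incl N V1) z by rewrite CJs_incl_range.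
exists (CJs_map f x); split; first by exists x.
apply: hB; apply: pB; rewrite {1}/CJs_incl (CJs_mapE fN) -/(CJs_incl N V1 x) xz.
rewrite (seminormB cp.1) (le_lt_trans (seminorm_dist cp.1 _ (f w) _))//.
by rewrite -(linear_mapB fl) [e]splitr ltrD.
Qed.

Lemma CJ_map_dense : dense (range (CJ_map f : CJ N V1 -> CJ N V2)).
Proof.
apply/dense_closureP => y; have [w <-] := CJ_proj_surj f2 stable2 y.
move=> A /(@CJ_proj_continuous R G N V2) nA.
have /dense_closureP/(_ w _ nA)[_ [[v _ <-] Av]] := df.
exists (CJ_proj N V2 (f v)); split=> //; exists (CJ_proj N V1 v) => //.
by rewrite CJ_map_proj.
Qed.

End Functorial.

End CasselmanJacquetTheory.

(** * Transitivity for Q contained in P *)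

Section Transitivity.
Context (R : realType) (G : topologicalGroupType).
Variables (P N Q NQ : set G) (s : G -> R).
Local Notation mul := (fun x y : G => (x * y)%g).
Local Notation inv := (fun x : G => x^-1%g).
Hypotheses (subP : is_subgroup mul inv 1%g P) (nN : is_normal_in mul inv P N).
Hypotheses (subQ : is_subgroup mul inv 1%g Q) (nNQ : is_normal_in mul inv Q NQ).
Hypotheses (QP : Q `<=` P) (NNQ : forall c : R -> G, one_param N c -> one_param NQ c).
Hypothesis s0 : forall g, 0 < s g.
Hypothesis growN : exists D : nat, forall gs : seq G, (forall g, g \in gs -> N g) ->
  exists C : R, forall u : nat, s (gprod u gs) <= C * u.+1%:R ^+ D.
Hypothesis growNQ : exists D : nat, forall gs : seq G, (forall g, g \in gs -> NQ g) ->
  exists C : R, forall u : nat, s (gprod u gs) <= C * u.+1%:R ^+ D.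
Variable V : representation R G.
Hypothesis rP : Rep P s V.

Let W : representation R G := CJ N V.
Let q : V -> W := CJ_proj N V.
Let rQ : Rep Q s V := Rep_subgroup QP rP.
Let rW : Rep Q s W := Rep_subgroup QP (CJ_Rep subP nN s0 growN rP).
Let fV : frechet V := Rep_frechet rP.
Let fW : frechet W := Rep_frechet rW.
Let lq : linear q. Proof. exact: CJ_proj_linear. Qed.
Let cq : continuous q. Proof. exact: CJ_proj_continuous. Qed.
Let sq : forall x, exists v, q v = x.
Proof. exact: CJ_proj_surj fV (Fil_stable subP nN rP s0 growN). Qed.
Let oq : forall v A, nbhs v A -> nbhs (q v) (q @` A).
Proof. exact: CJ_proj_open fV (Fil_stable subP nN rP s0 growN). Qed.
Let eqv h v : Q h -> q (rep_act h v) = rep_act h (q v).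
Proof. by move=> /QP Ph; exact: (CJ_proj_equiv subP nN rP). Qed.

Lemma Fil_mono k (v : V) : Fil N k v -> Fil NQ k v.
Proof.
apply: closure_subset; apply: lspan_mono; elim: k => [//|k IH] /= w [c [u [Nc Au dw]]].
by exists c, u; split=> //; [exact: NNQ|exact: IH].
Qed.

Lemma Fil_proj k v : Fil NQ k v -> Fil NQ k (q v).
Proof.
apply: (N_compatible_npow_cl (f := q)); split=> // c NQc; exists c => // t u.
by apply: eqv; apply: nNQ.1; case: NQc.
Qed.

(** The kernel of q lies in every F_k for NQ, so F_k is saturated for q and, q being open, its image
    is closed. That image contains the generators of F_k in W because derivatives of orbits lift. *)
Lemma Fil_proj_lift k v : Fil NQ k (q v) -> Fil NQ k v.
Proof.
pose T := q @` Fil NQ k.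
have lF := @Fil_linear R G NQ V k.
have Tin u : T (q u) -> Fil NQ k u.
  move=> [w Fw qw]; have Cuw : CJs_set N V (u - w).
    by apply/(CJ_proj_ker N); rewrite -/q (linear_mapB lq) qw subrr.
  by rewrite -(subrK w u); apply: (linear_setD lF) => //; apply: Fil_mono; exact: Cuw.
move=> Fv; apply: (Tin); move: (q v) Fv; apply: closure_lspan_sub.
- split; first by exists 0; [exact: lF.1|exact: linear_map0].
  move=> a _ _ [u Fu <-] [w Fw <-]; exists (a *: u + w); last exact: lq.
  exact: lF.2.
- move=> x; have [u <-] := sq x => cT; exists u => //.
  apply: (@Fil_closed R G NQ V k) => A /oq nA.
  have [_ [[w Fw <-] [z Az qz]]] := cT _ nA.
  by exists z; split=> //; apply: Tin; exists w.
- suff H j w : iter j (ndot NQ (V := W)) setT w ->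
      exists2 u, iter j (ndot NQ (V := V)) setT u & q u = w.
    by move=> w /H[u Au <-]; exists u => //; exact/subset_closure/sub_lspan.
  elim: j w => [|j IH] w /=; first by move=> _; have [u <-] := sq w; exists u.
  move=> [c [x [NQc /IH[u Au ux] dw]]].
  have Qc := one_paramS nNQ.1 NQc; have [_ _ cQ] := Qc.
  have [u' du'] := orbit_derivative subQ rQ u Qc.
  exists u'; first by exists c, u.
  have dq := derivative_at0_lin lq cq du'.
  (* The image of the derivative upstairs and the given derivative w are limits of the same
     quotients in W. *)
  apply: (frechet_cvg_unique fW (FF := Proper_dnbhs_numFieldType _) _ dw).
  apply: derivative_at0_ext dq => t /=.
  by rewrite eqv// ux.
Qed.

Lemma CJ_trans : isomorphic Q (CJ NQ (CJ N V)) (CJ NQ V).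
Proof.
have stQ := Fil_stable subQ nNQ rQ s0 growNQ.
have stW := Fil_stable subQ nNQ rW s0 growNQ.
apply: (@quot_isomorphic R G Q V (CJ NQ W) (CJ NQ V) (CJ_proj NQ W \o q) (CJ_proj NQ V)).
- by move=> a u v /=; rewrite lq; exact: CJ_proj_linear.
- by move=> v A /CJ_proj_continuous/cq.
- move=> x; have [w <-] := CJ_proj_surj fW stW x; have [v <-] := sq w.
  by exists v.
- move=> v A /oq /(CJ_proj_open fW stW).
  by rewrite -image_comp.
- move=> h v Qh /=; rewrite eqv//; exact: (CJ_proj_equiv subQ nNQ rW).
- exact: CJ_proj_linear.
- exact: CJ_proj_continuous.
- exact: CJ_proj_surj fV stQ.
- exact: CJ_proj_open fV stQ.
- by move=> h v; exact: (CJ_proj_equiv subQ nNQ rQ).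
- move=> v /=; rewrite !CJ_proj_ker; split=> h k _.
    by apply: Fil_proj_lift; exact: h.
  by apply: Fil_proj; exact: h.
Qed.

End Transitivity.

Theorem theorem1p2 (R : realType) (G : topologicalGroupType) (n : nat)
    (rho : G -> 'M[R]_n) (hG : real_reductive rho)
    (s : G -> R) (hs : algebraic_scale rho s)
    (P N : set G) (hP : parabolic rho P) (hN : unipotent_radical rho P N) :
  [/\ (* (1) *)
      forall V : representation R G, Rep setT s V ->
        closure (lspan (ndot N (CJs_set N V))) = CJs_set N V,
      (* (2) *)
      forall V : representation R G, Rep setT s V ->
        range (CJ_proj N V) = setT /\
        strict_short_exact P s
          (CJs_incl N V : CJs N V -> V)
          (CJ_proj N V : V -> CJ N V),
      (* (3) *)
      forall (V1 V2 : representation R G) (f : V1 -> V2),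
        Rep setT s V1 -> Rep setT s V2 ->
        (epimorphism setT f ->
           epimorphism P (CJ_map f : CJ N V1 -> CJ N V2) /\
           epimorphism P (CJs_map f : CJs N V1 -> CJs N V2)) /\
        (morphism setT f -> range f = setT ->
           range (CJ_map f : CJ N V1 -> CJ N V2) = setT)
    & (* (4) *)
      forall Q NQ : set G,
        parabolic rho Q -> unipotent_radical rho Q NQ -> Q `<=` P ->
        forall V : representation R G, Rep setT s V ->
          isomorphic Q (CJ NQ (CJ N V)) (CJ NQ V)].
Proof.
(* Matrices of positive size form a unital ring, in which the results on unipotent groups are
   stated; size 0 is excluded by [rr_dim]. *)
case: n rho hG hs hP hN => [rho hG|n rho hG hs hP hN]; first by have := rr_dim hG.
have subP := parabolic_subgroup hG hP.
have [[sN nN _ uN] _] := hN.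
have grow := scale_growth hG sN uN hs.
have s0 := hs.1.
have rP V : Rep setT s V -> Rep P s V by exact: Rep_subgroup (@subsetT _ P).
split=> [V /rP rV|V /rP rV|V1 V2 f /rP r1 /rP r2|Q NQ hQ hNQ QP V /rP rV].
- exact: closure_ndot_CJs subP nN s0 grow V rV.
- split; first exact: CJ_proj_range subP nN s0 grow V rV.
  exact: CJ_exact subP nN s0 grow V rV.
- split=> [[mf df]|mf]; last exact: (CJ_map_surj subP nN s0 grow r2 mf).
  split; split.
  + exact: (CJ_map_morphism subP nN s0 grow r1 r2 mf).
  + exact: (CJ_map_dense subP nN s0 grow r2 mf df).
  + exact: (CJs_map_morphism subP nN r1 r2 mf).
  + exact: (CJs_map_dense subP nN s0 grow r1 r2 mf df).
- have subQ := parabolic_subgroup hG hQ; have [[sNQ nNQ _ uNQ] _] := hNQ.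
  apply: (CJ_trans subP nN subQ nNQ QP _ s0 grow (scale_growth hG sNQ uNQ hs) rV).
  exact: (one_param_radical hG hP hN hQ hNQ QP).
Qed.
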